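(* Let $T$ be the rank-one transformation associated with cutting and stacking parameters $(p_n)_{n\ge1}$, $(s_{n,i})_{n\ge1,\,0\le i\le p_n-1}$. Assume there is a stabilizing subsequence $(n_k)$ with limit parameters $(\pi_m)_{m\in\mathbb Z}$, $(\eta_{m,j})$ such that (i) $\sup_{m\in\mathbb Z,\,0\le j\le \pi_m-1}\eta_{m,j}<\infty$ (bounded-recurrent) and (ii) $\mathcal E_m\neq\{0\}$ for at least one $m\in\mathbb Z$ (non-flat). Then for any integers $1\le j_1<j_2$, the continuous parts of the maximal spectral types of $T^{j_1}$ and $T^{j_2}$ are mutually singular.
   Context: Rank-one construction: given integers $p_n\ge2$ ($n\ge1$) and integers $s_{n,i}\ge0$ ($n\ge1$, $0\le i\le p_n-1$), set $h_1=1$ and $h_{n+1}=p_nh_n+\sum_{i=0}^{p_n-1}s_{n,i}$, and assume $\sum_{n\ge1}\frac1{h_{n+1}}\sum_{i=0}^{p_n-1}s_{n,i}<\infty$. The rank-one transformation $T$ is the invertible measure-preserving map of a standard probability space built by cutting and stacking: tower $1$ is a single interval; at stage $n$ the tower (a stack of $h_n$ intervals of equal length, $T$ mapping each level linearly onto the one above) is cut vertically into $p_n$ columns of equal width numbered $0,\dots,p_n-1$, $s_{n,i}$ new intervals (spacers) are put on top of column $i$, and the columns are stacked with column $i+1$ on top of column $i$, producing tower $n+1$ of height $h_{n+1}$; the total measure is normalized to $1$. Spectral notions refer to the Koopman operator $U_T f=f\circ T$ restricted to the orthocomplement of constants in $L^2$; the maximal spectral type of $T^j$ is that of $U_T^j$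 there. Stabilizing subsequence: an increasing sequence $(n_k)$ together with integers $\pi_m$ ($m\in\mathbb Z$) and $\eta_{m,j}\ge0$ ($m\in\mathbb Z$, $0\le j\le\pi_m-1$) such that for every $m\in\mathbb Z$ and $0\le j\le\pi_m-1$, $p_{n_k+m}\to\pi_m$ and $s_{n_k+m,j}\to\eta_{m,j}$ as $k\to\infty$ (so $\pi_m\ge2$). Write $\eta_m$ for the map $j\mapsto\eta_{m,j}$ and set $\mathcal S_m=\eta_m(\{0,\dots,\pi_m-2\})\cup\big(\eta_{m,\pi_m-1}+\eta_{m+1}(\{0,\dots,\pi_{m+1}-2\})\big)$, $\mathcal E_m=\mathcal S_m-\mathcal S_m=\{a-b:a,b\in\mathcal S_m\}$. *)

(* Defs.v *)
From HB Require Import structures.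
From mathcomp Require Import all_boot all_order all_algebra.
From mathcomp Require Import all_classical all_reals all_analysis.
Set Implicit Arguments.
Unset Strict Implicit.
Unset Printing Implicit Defensive.
Import Order.TTheory GRing.Theory Num.Theory.
Import numFieldNormedType.Exports.
Local Open Scope classical_set_scope.
Local Open Scope ring_scope.

(* Rank-one parameters.  p n (n >= 1) = number of columns at stage n,  *)
(* s n i (0 <= i <= p n - 1) = number of spacers on column i.          *)
(* Values at n = 0 / at i >= p n are irrelevant.                       *)

(* h_1 = 1, h_{n+1} = p_n h_n + sum_{i<p_n} s_{n,i}  (h_0 := 1 dummy) *)
Fixpoint hgt (p : nat -> nat) (s : nat -> nat -> nat) (n : nat) : nat :=
  match n with
  | 0 => 1%N
  | n'.+1 => if n' is 0 then 1%N
             else (p n' * hgt p s n' + \sum_(i < p n') s n' i)%N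
  end.

(* position in tower n+1 of the bottom level of column i of tower n *)
Definition col_off (p : nat -> nat) (s : nat -> nat -> nat) (n i : nat) : nat :=
  (i * hgt p s n + \sum_(i' < i) s n i')%N.

Definition inv_mps d (X : measurableType d) (R : realType)
  (mu : probability X R) (T : X -> X) : Prop :=
  [/\ measurable_fun setT T,
      (exists Tinv : X -> X,
         [/\ cancel T Tinv, cancel Tinv T & measurable_fun setT Tinv]) &
      forall A, measurable A -> mu (T @^-1` A) = mu A].

(* (X, mu, T) is (a realization of) the rank-one transformation built by
   cutting and stacking with parameters p, s: L n k (n >= 1, k < h_n) is
   the k-th level of tower n; T maps each level onto the next one; level
   k of tower n is the union over columns i < p_n of the levels
   col_off n i + k of tower n+1 (the remaining levels of tower n+1 being
   the spacers); and the levels generate the measure algebra. *)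
Definition rank_one d (X : measurableType d) (R : realType)
  (mu : probability X R) (T : X -> X)
  (p : nat -> nat) (s : nat -> nat -> nat) : Prop :=
  inv_mps mu T /\
  exists L : nat -> nat -> set X,
  [/\ forall n k, (1 <= n)%N -> (k < hgt p s n)%N -> measurable (L n k),
      forall n k k', (1 <= n)%N -> (k < hgt p s n)%N -> (k' < hgt p s n)%N ->
        k != k' -> L n k `&` L n k' = set0,
      forall n k, (1 <= n)%N -> (k.+1 < hgt p s n)%N -> T @` L n k = L n k.+1,
      forall n k, (1 <= n)%N -> (k < hgt p s n)%N ->
        L n k = \bigcup_(i in [set i | (i < p n)%N]) L n.+1 (col_off p s n i + k)
    & forall A, measurable A -> forall eps : R, 0 < eps ->
        exists n, (1 <= n)%N /\ exists K : set nat,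
          K `<=` [set k | (k < hgt p s n)%N] /\
          (mu ((A `\` \bigcup_(k in K) L n k) `|` (\bigcup_(k in K) L n k `\` A))
            < eps%:E)%E].

Definition stabilizing (p : nat -> nat) (s : nat -> nat -> nat)
  (nk : nat -> nat) (pi : int -> nat) (eta : int -> nat -> nat) : Prop :=
  (forall k, (nk k < nk k.+1)%N) /\
  forall m : int,
    (exists K, forall k, (K <= k)%N ->
        0 < (nk k)%:Z + m /\ p (absz ((nk k)%:Z + m)) = pi m) /\
    (forall j, (j < pi m)%N -> exists K, forall k, (K <= k)%N ->
        0 < (nk k)%:Z + m /\ s (absz ((nk k)%:Z + m)) j = eta m j).

Definition Sset (pi : int -> nat) (eta : int -> nat -> nat) (m : int) : set int :=
  [set x | (exists2 j, (j.+1 < pi m)%N & x = (eta m j)%:Z) \/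
           (exists2 j, (j.+1 < pi (m + 1)%R)%N &
              x = (eta m (pi m).-1 + eta (m + 1)%R j)%:Z)].

Definition Eset (pi : int -> nat) (eta : int -> nat -> nat) (m : int) : set int :=
  [set z | exists x y, Sset pi eta m x /\ Sset pi eta m y /\ z = x - y].

(* A complex function f is written f = g + i h with g, h real.         *)
(* The circle is identified with [0,1) via t |-> exp(2 pi i t).        *)

Definition L2_0 d (X : measurableType d) (R : realType)
  (mu : probability X R) (g : X -> R) : Prop :=
  [/\ measurable_fun setT g,
      mu.-integrable setT (fun x => ((g x) ^+ 2)%:E) &
      (\int[mu]_x (g x)%:E = 0)%E].

Definition circle_measure (R : realType) (sigma : {measure set R -> \bar R}) : Prop :=
  (sigma setT < +oo)%E /\ sigma (~` [set t : R | 0 <= t < 1]) = 0%E.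

(* sigma is the spectral measure of f = g + i h for U_T^j:
   int e^{2 pi i n t} d sigma(t) = < U_T^{j n} f, f >  for all n >= 0
   (this determines sigma; negative n follow by conjugation). *)
Definition spectral_measure d (X : measurableType d) (R : realType)
  (mu : probability X R) (T : X -> X) (j : nat) (g h : X -> R)
  (sigma : {measure set R -> \bar R}) : Prop :=
  circle_measure sigma /\
  forall n : nat,
    (\int[sigma]_t (cos (2 * pi * n%:R * t))%:E =
      \int[mu]_x ((g (iter (j * n) T x) * g x + h (iter (j * n) T x) * h x)%:E))%E
    /\
    (\int[sigma]_t (sin (2 * pi * n%:R * t))%:E =
      \int[mu]_x ((h (iter (j * n) T x) * g x - g (iter (j * n) T x) * h x)%:E))%E.

Definition max_spectral_type d (X : measurableType d) (R : realType)
  (mu : probability X R) (T : X -> X) (j : nat)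
  (sigma : {measure set R -> \bar R}) : Prop :=
  [/\ circle_measure sigma,
      (forall g h (nu : {measure set R -> \bar R}),
          L2_0 mu g -> L2_0 mu h -> spectral_measure mu T j g h nu -> nu `<< sigma) &
      exists g h (nu : {measure set R -> \bar R}),
        [/\ L2_0 mu g, L2_0 mu h, spectral_measure mu T j g h nu & sigma `<< nu]].

Definition atoms (R : realType) (sigma : {measure set R -> \bar R}) : set R :=
  [set t | (0 < sigma [set t])%E].

Definition cont_part (R : realType) (sigma : {measure set R -> \bar R}) :
  set R -> \bar R :=
  fun A => sigma (A `\` atoms sigma).

Definition mutually_singular (R : realType) (a b : set R -> \bar R) : Prop :=
  exists A : set R, [/\ measurable A, a A = 0%E & b (~` A) = 0%E].

(* Main.v *)
(* Let q_M be the number of copies of tower n_k + m inside tower n_k + m + M and,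
   for t = j d, let F_M(z) be the average over these copies of z^w, where w is
   the number of spacers met while crossing the next t copies.  As k grows, the
   powers U^(j d h(n_k + m)) become F_M(U^-1) in the weak operator topology, up
   to an error vanishing with M, so they have a weak limit F_j(U^-1) where F_j
   is a power series with radius of convergence larger than 1.  By averaging,
   weak limits along the same heights become strong ones, which yields
   polynomials u with u(U^j1) near F_j1(U^-1) for the first spectral measure
   and u(U^j2) near F_j2(U^-1) for the second.  Up to descending from z to
   w = z^j, a resultant eliminates F_j1 and F_j2: some polynomials converge to
   Res(w) in L^2 of the first measure and to 0 in L^2 of the second one, so the
   measures are mutually singular off the zeros of Res.  These are the w for
   which F_j1(z1) = F_j2(z2) with z1^j1 = z2^j2 = w; by Jensen's inequality
   there are finitely many of them, unless the lowest exponents e_1, e_2 of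
   F_j1, F_j2 satisfy j2 e_1 = j1 e_2.  The exponent e is the minimal number of
   spacers between copies at distance t; were it proportional for all m and d,
   its defect from its linear growth rate would be both tiny, by scaling, and
   bounded below, since a non-flat stage produces windows of more than minimal
   size at every larger scale. *)

Require Import Defs.
From HB Require Import structures.
From mathcomp Require Import all_boot all_order all_algebra.
From mathcomp Require Import finmap.
From mathcomp Require Import all_classical all_reals all_analysis.
From mathcomp Require Import measurable_realfun complex separable cyclic cyclotomic.
From mathcomp Require Import zify ring lra.
Set Implicit Arguments.
Unset Strict Implicit.
Unset Printing Implicit Defensive.
Import Order.TTheory GRing.Theory Num.Theory.
Import numFieldNormedType.Exports.
Local Open Scope classical_set_scope.
Local Open Scope ring_scope.

(** The comparison of lowest exponents comes from a change of variable: if [z1^j1 = z2^j2 = w] and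
    [w = y^(j1 j2)], then [z1] and [z2] are [y^j2] and [y^j1] up to roots of unity, so a zero of the
    resultant is a zero of some [F_j1(u y^j2) - F_j2(v y^j1)]. Its two lowest terms have degrees
    [j2 e_1] and [j1 e_2] and cannot cancel when these differ. The stage [m] and the factor [d] are
    free, so one good pair [(m, d)] is enough; the finitely many zeros can then only carry atoms.

    The obstacle is that [F_j] need not be a polynomial: for each truncation the weak convergence
    holds only up to an error, which must be fixed before the truncation is chosen. Hence series are
    sequences of polynomials forming a commutative ring, where resultants make sense, and the
    tolerance in the averaging lemma depends only on a bound for the polynomials involved. The
    averages must also be the same for both measures: powers are chosen one at a time, each
    contributing an error almost orthogonal to the accumulated one, in both forms at once, so that a
    single [u] serves [U^j1] and [U^j2]. *)

(** * Spacers between copies of a tower *)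

Section Gap.
Local Open Scope nat_scope.
Variables (P : nat -> nat) (S : nat -> nat -> nat).

(** Adding one to [i] in mixed radix: without carry the gap is the spacer stack of an inner column;
    a carry adds the stack of the last column to a gap of the next tower. Fuel [i.+1] suffices
    because a carry lowers the index. *)
Fixpoint gap_fuel (f l i : nat) : nat :=
  if f is f'.+1 then
    if P l %| i.+1 then S l (P l).-1 + gap_fuel f' l.+1 (i %/ P l)
    else S l (i %% P l)
  else 0.

(* Number of spacers between the i-th and the (i+1)-st copy of tower l inside
   a later tower. *)
Definition gap (l i : nat) : nat := gap_fuel i.+1 l i.

Definition gapsum (l x t : nat) : nat := \sum_(u < t) gap l (x + u).

Definition copies (l M : nat) : nat := \prod_(k < M) P (l + k).

Lemma copies0 l : copies l 0 = 1.
Proof. by rewrite /copies big_ord0. Qed.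

Lemma copiesS l M : copies l M.+1 = P l * copies l.+1 M.
Proof.
rewrite /copies big_ord_recl addn0; congr (_ * _).
by apply: eq_bigr => i _; rewrite /= /bump /= addnA addn1.
Qed.

Lemma copiesSr l M : copies l M.+1 = copies l M * P (l + M).
Proof. by rewrite /copies big_ord_recr. Qed.

Lemma copiesD l M M' : copies l (M + M') = copies l M * copies (l + M) M'.
Proof.
elim: M' => [|M' IH]; first by rewrite addn0 copies0 muln1.
by rewrite addnS !copiesSr IH mulnA addnA.
Qed.

Hypothesis P2 : forall l, 2 <= P l.

Lemma copies_ge l M : 2 ^ M <= copies l M.
Proof.
elim: M l => [|M IH] l; first by rewrite copies0.
by rewrite copiesS expnS leq_mul.
Qed.

Lemma copies_gt0 l M : 0 < copies l M.
Proof. by apply: leq_trans (copies_ge l M); rewrite expn_gt0. Qed.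

Let P0 l : 0 < P l. Proof. exact: ltnW. Qed.

Lemma gap_fuel_irrel f f' l i : i < f -> i < f' -> gap_fuel f l i = gap_fuel f' l i.
Proof.
elim: f f' l i => [//|f IH] [//|f'] l i /= Hf Hf'.
case: ifP => // Hd; congr (_ + _).
have Hlt : i %/ P l < i.
  by rewrite ltn_Pdiv //; case: i Hd {Hf Hf'} => // /dvdn_leq H; have := H isT; rewrite leqNgt P2.
by apply: IH; lia.
Qed.

Lemma gapE l i : gap l i =
  if P l %| i.+1 then S l (P l).-1 + gap l.+1 (i %/ P l) else S l (i %% P l).
Proof.
rewrite {1}/gap [LHS]/=; case: ifP => // Hd; congr (_ + _).
have Hlt : i %/ P l < i.
  by rewrite ltn_Pdiv //; case: i Hd => // /dvdn_leq H; have := H isT; rewrite leqNgt P2.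
by apply: gap_fuel_irrel => //; lia.
Qed.

Lemma gap_low l i j : j.+1 < P l -> gap l (i * P l + j) = S l j.
Proof.
move=> Hj; rewrite gapE -addnS dvdn_addr ?dvdn_mull // gtnNdvd //.
by rewrite modnMDl modn_small // ltnW.
Qed.

Lemma gap_high l i : gap l (i * P l + (P l).-1) = S l (P l).-1 + gap l.+1 i.
Proof.
rewrite gapE -addnS prednK // dvdn_addr ?dvdn_mull // dvdnn.
by rewrite divnMDl // [_ %/ P l]divn_small ?addn0 // prednK.
Qed.

Definition carry (l M : nat) : nat := \sum_(k < M) S (l + k) (P (l + k)).-1.

Lemma carryS l M : carry l M.+1 = S l (P l).-1 + carry l.+1 M.
Proof.
rewrite /carry big_ord_recl addn0; congr (_ + _).
by apply: eq_bigr => i _; rewrite /= /bump /= addnA addn1.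
Qed.

(** The carry stays inside the block, so its digits alone decide the gap. *)
Lemma gap_block M l i u : u.+1 < copies l M -> gap l (i * copies l M + u) = gap l u.
Proof.
elim: M l i u => [|M IH] l i u; first by rewrite copies0.
rewrite copiesS => Hu.
have -> : i * (P l * copies l.+1 M) + u =
  (i * copies l.+1 M + u %/ P l) * P l + u %% P l.
  by rewrite mulnDl -addnA -divn_eq [P l * _]mulnC mulnA.
rewrite [in RHS](divn_eq u (P l)).
have Hm := ltn_pmod u (P0 l).
case: (ltnP (u %% P l).+1 (P l)) => Hlt; first by rewrite !gap_low.
have E : (u %% P l).+1 = P l by apply/eqP; rewrite eqn_leq Hm.
have Em : u %% P l = (P l).-1 by apply: succn_inj; rewrite E prednK.
rewrite Em !gap_high IH //.
have : u.+1 = (u %/ P l).+1 * P l by rewrite {1}(divn_eq u (P l)) mulSn addnC -addSn E.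
by move=> E2; move: Hu; rewrite E2 mulnC ltn_pmul2l.
Qed.

(** At the last copy in a block all [M] digits carry. *)
Lemma gap_carry M l i :
  gap l (i * copies l M + (copies l M).-1) = carry l M + gap (l + M) i.
Proof.
elim: M l i => [|M IH] l i.
  by rewrite copies0 /carry big_ord0 muln1 !addn0.
rewrite copiesS carryS.
have c0 := copies_gt0 l.+1 M; have p0 := P0 l.
have -> : i * (P l * copies l.+1 M) + (P l * copies l.+1 M).-1 =
  (i * copies l.+1 M + (copies l.+1 M).-1) * P l + (P l).-1.
  apply: succn_inj; rewrite -!addnS !prednK ?muln_gt0 ?p0 //.
  rewrite -[X in _ = _ + X]mul1n -mulnDl -addnA addn1 prednK //; ring.
by rewrite gap_high IH addSnnS addnA.
Qed.

Lemma gapsum0 l x : gapsum l x 0 = 0.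
Proof. by rewrite /gapsum big_ord0. Qed.

Lemma gapsumD l x t t' : gapsum l x (t + t') = gapsum l x t + gapsum l (x + t) t'.
Proof.
rewrite /gapsum big_split_ord /=; congr (_ + _).
by apply: eq_bigr => i _; rewrite addnA.
Qed.

Lemma gapsum1 l x : gapsum l x 1 = gap l x.
Proof. by rewrite /gapsum big_ord1 addn0. Qed.

Lemma gapsum_block M l i u t : u + t < copies l M ->
  gapsum l (i * copies l M + u) t = gapsum l u t.
Proof.
move=> H; apply: eq_bigr => k _; rewrite -addnA gap_block //.
by have := ltn_ord k; lia.
Qed.

(** Each group of [P l] consecutive gaps meets every column once, the last column together with a
    gap of tower [l.+1]. *)
Lemma gapsum_pass l t : gapsum l 0 (P l * t) = t * (\sum_(j < P l) S l j) + gapsum l.+1 0 t.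
Proof.
elim: t => [|t IH]; first by rewrite muln0 !gapsum0.
have -> : gapsum l.+1 0 t.+1 = gapsum l.+1 0 t + gap l.+1 t.
  by rewrite -[t.+1]addn1 gapsumD gapsum1.
rewrite mulnSr gapsumD IH add0n mulSn.
suff -> : gapsum l (P l * t) (P l) = \sum_(j < P l) S l j + gap l.+1 t by lia.
rewrite /gapsum; have := @gap_low l t; have := gap_high l t; have := P0 l.
case: (P l) => // q _ /= Hh Hl.
rewrite !big_ord_recr /= mulnC Hh addnA; congr (_ + _ + _).
by apply: eq_bigr => i _; rewrite Hl // ltnS ltn_ord.
Qed.

Lemma gapsum_low l x j : j < P l -> gapsum l (x * P l) j = \sum_(i < j) S l i.
Proof.
move=> Hj; apply: eq_bigr => i _; rewrite gap_low //.
by have := ltn_ord i; lia.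
Qed.

Lemma leq_gapsum l x t t' : t <= t' -> gapsum l x t <= gapsum l x t'.
Proof. by move/subnKC <-; rewrite gapsumD leq_addr. Qed.

End Gap.

(** A gap inside a block reads finitely many stages only; this transfers stabilized parameters to
    the limit parameters. *)
Lemma eq_gap P S P' S' M l i :
  (forall l, 1 < P l)%N -> (forall l, 1 < P' l)%N ->
  (forall k, (k < M)%N -> P (l + k)%N = P' (l + k)%N /\
     forall j, (j < P (l + k))%N -> S (l + k)%N j = S' (l + k)%N j) ->
  (i.+1 < copies P l M)%N -> gap P S l i = gap P' S' l i.
Proof.
move=> P2 P2'; elim: M l i => [|M IH] l i H; first by rewrite copies0.
rewrite copiesS => Hi.
have [] := H 0%N isT; rewrite addn0 => EP ES.
have p0 : (0 < P l)%N := ltnW (P2 l).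
rewrite (gapE _ P2) (gapE _ P2') -EP; case: ifP => Hd; last by rewrite ES // ltn_pmod.
rewrite (ES (P l).-1) ?ltn_predL //; congr (_ + _)%N.
apply: IH => [k Hk|].
  by rewrite addSnnS; apply: H.
move: Hi; rewrite (divn_eq i.+1 (P l)) (eqP Hd) addn0 divnS // Hd add1n mulnC.
by rewrite ltn_pmul2l.
Qed.

(** * Minimal gaps *)

Section MinGap.
Variables (P : nat -> nat) (S : nat -> nat -> nat).
Hypothesis P2 : forall l, (1 < P l)%N.

Let mingap_ex l t : exists m, `[< exists x, gapsum P S l x t = m >].
Proof. by exists (gapsum P S l 0 t); apply/asboolP; exists 0%N. Qed.

(** The minimum runs over all starting copies in arbitrarily high towers; for [l = 0] it is the
    lowest exponent of the limit series. *)
Definition mingap l t : nat := ex_minn (mingap_ex l t).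

Lemma mingap_attained l t : exists x, gapsum P S l x t = mingap l t.
Proof. by rewrite /mingap; case: ex_minnP => m /asboolP. Qed.

Lemma mingap_le l t x : (mingap l t <= gapsum P S l x t)%N.
Proof.
by rewrite /mingap; case: ex_minnP => m _; apply; apply/asboolP; exists x.
Qed.

Lemma mingapD l t t' : (mingap l t + mingap l t' <= mingap l (t + t'))%N.
Proof.
by have [x <-] := mingap_attained l (t + t'); rewrite gapsumD leq_add ?mingap_le.
Qed.

Lemma mingapM l t k : (k * mingap l t <= mingap l (k * t))%N.
Proof.
elim: k => [|k IH]; first by rewrite !mul0n.
by rewrite !mulSn; apply: leq_trans (mingapD _ _ _); rewrite leq_add2l.
Qed.

Lemma mingap_tiles l t k x : (k * mingap l t <= gapsum P S l x (k * t))%N.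
Proof. by apply: leq_trans (mingap_le _ _ _); apply: mingapM. Qed.

(** Carries occur at most at every second copy, so the successive levels contribute at most [B t],
    [B t / 2], [B t / 4], and so on. *)
Lemma gapsum_bound B :
  (forall l j, (j < P l)%N -> (S l j <= B)%N) ->
  forall l t, (gapsum P S l 0 t <= 2 * B * t)%N.
Proof.
move=> SB.
have step l t : (gapsum P S l 0 t <= B * t + gapsum P S l.+1 0 (t %/ P l))%N.
  elim: t => [|t IH]; first by rewrite gapsum0.
  rewrite -[in X in (X <= _)%N]addn1 gapsumD gapsum1 add0n gapE // mulnS.
  rewrite divnS ?(ltnW (P2 l)) //.
  case: ifP => Hd; rewrite ?add0n.
    rewrite add1n -[(t %/ _).+1]addn1 gapsumD gapsum1 add0n.
    by have := SB l (P l).-1; rewrite ltn_predL (ltnW (P2 l)) => /(_ isT); lia.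
  by have := SB l (t %% P l)%N; rewrite ltn_pmod ?(ltnW (P2 l)) // => /(_ isT); lia.
move=> l t; elim/ltn_ind: t l => t IH l.
case: t IH => [|t] IH; first by rewrite gapsum0.
have Hlt : (t.+1 %/ P l < t.+1)%N by rewrite ltn_Pdiv.
have := IH _ Hlt l.+1.
have Hh : (t.+1 %/ P l * 2 <= t.+1)%N.
  apply: leq_trans (leq_trunc_div t.+1 (P l)).
  by rewrite leq_mul2l P2 orbT.
have := step l t.+1.
move: (t.+1 %/ P l)%N Hh {Hlt} => u Hu.
have : (B * (u * 2) <= B * t.+1)%N by rewrite leq_mul2l Hu orbT.
lia.
Qed.

(** A window of [k.+1] block lengths contains [k] whole blocks wherever it starts; the gaps between
    blocks are dropped. *)
Lemma gapsum_blocks l M x k :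
  (k * gapsum P S l 0 (copies P l M).-1 <= gapsum P S l x (k.+1 * copies P l M))%N.
Proof.
set q := copies P l M.
have q0 : (0 < q)%N by exact: copies_gt0.
have aligned k' i :
    (k' * gapsum P S l 0 q.-1 <= gapsum P S l (i * q) (k' * q))%N.
  elim: k' i => [|k' IH] i; first by rewrite mul0n.
  rewrite !mulSn gapsumD leq_add //.
    rewrite -[X in (_ <= gapsum _ _ _ _ X)%N](prednK q0) -addn1 gapsumD.
    rewrite -{1}(addn0 (i * q)%N) gapsum_block ?add0n ?leq_addr //.
    by rewrite ltn_predL.
  by rewrite -mulSnr.
set r := ((x %/ q).+1 * q - x)%N.
have Hr : (x + r = (x %/ q).+1 * q)%N.
  by rewrite subnKC // ltnW // ltn_ceil.
have Hrq : (r <= q)%N.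
  by have := leq_trunc_div x q; move: Hr; rewrite mulSn; lia.
have -> : (k.+1 * q = r + (k * q + (q - r)))%N by rewrite mulSn; lia.
rewrite !gapsumD Hr.
apply: leq_trans (aligned _ _) _.
by apply: leq_trans (leq_addl _ _); apply: leq_addr.
Qed.

(* A block of tower r sees its two neighbours separated by a longer gap at
   position [i'] than at position [i]; every window of length at most one block
   through the longer gap therefore exceeds the minimum. *)
Lemma mingap_bad r i i' c M t x :
  (gap P S r i < gap P S r i')%N -> (i'.+1 < copies P r M)%N ->
  (t <= copies P 0 r)%N ->
  let y := ((i' + c * copies P r M) * copies P 0 r + (copies P 0 r).-1)%N in
  (x <= y < x + t)%N -> (mingap 0 t < gapsum P S 0 x t)%N.
Proof.
move=> Hi HM Ht y /andP[Hx1 Hx2].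
set q := copies P 0 r in Ht y Hx1 Hx2 *; set Q := copies P r M in HM y Hx1 Hx2.
have q0 : (0 < q)%N by exact: copies_gt0.
(* [l] is the offset of [x] in the block that ends at [y]. The window with the same offset in block
   [i] differs from this one only in the gap after the block. *)
set l := (x - (i' + c * Q) * q)%N.
have Ex : (x = (i' + c * Q) * q + l)%N.
  by rewrite /l; move: Hx1 Hx2; rewrite /y; lia.
have Hl : (l <= q.-1)%N by move: Hx1 Hx2; rewrite /y Ex; lia.
have Hlt : (q.-1 < l + t)%N by move: Hx1 Hx2; rewrite /y Ex; lia.
apply: leq_ltn_trans (mingap_le 0 t (i * q + l)) _.
set v := (q.-1 - l)%N.
have split z : gapsum P S 0 (z * q + l) t =
  (gapsum P S 0 l v + (carry P S 0 r + gap P S r z) + gapsum P S 0 0 (t - v - 1))%N.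
  have Et : t = (v + (1 + (t - v - 1)))%N by rewrite /v; lia.
  rewrite [in LHS]Et gapsumD gapsumD gapsum1 -[RHS]addnA.
  rewrite gapsum_block //; last by rewrite /v; lia.
  have -> : (z * q + l + v = z * q + q.-1)%N by rewrite /v; lia.
  rewrite gap_carry // add0n; congr (_ + (_ + _))%N.
  have -> : (z * q + q.-1 + 1 = z.+1 * q + 0)%N by rewrite mulSn; lia.
  by rewrite gapsum_block ?add0n //; rewrite /v; lia.
rewrite Ex !split !addnA ltn_add2r ltn_add2l.
by rewrite addnC gap_block.
Qed.

(** The longer gap recurs with period [copies P r M * copies P 0 r], which is at least [t]. In the
    tiling by windows of length [t] its occurrences therefore fall into different tiles, each
    exceeding the minimum by at least one. *)
Lemma gapsum_bad_tiles r i i' M t N :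
  (gap P S r i < gap P S r i')%N -> (i'.+1 < copies P r M)%N ->
  (0 < t <= copies P 0 r)%N ->
  exists2 u, (u * t <= (N * (copies P r M * copies P 0 r)).-1)%N &
    (u * mingap 0 t + N <= gapsum P S 0 0 (u * t))%N.
Proof.
move=> Hi HM /andP[t0 Ht].
set q := copies P 0 r in Ht *; set Q := copies P r M in HM *.
have q0 : (0 < q)%N by exact: copies_gt0.
pose y c := ((i' + c * Q) * q + q.-1)%N.
have yS c : y c.+1 = (y c + Q * q)%N by rewrite /y; ring.
have Qq2 : (t <= Q * q)%N.
  by apply: leq_trans Ht _; rewrite leq_pmull //; apply: leq_trans HM.
suff [u Hu1 Hu2] : exists2 u,
    (if N is N'.+1 then (u * t <= y N' + t)%N else u == 0%N) &
    (u * mingap 0 t + N <= gapsum P S 0 0 (u * t))%N.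
  exists u => //; case: N Hu1 {Hu2} => [/eqP -> // | N' H].
  apply: leq_trans H _; rewrite /y mulSn.
  have : (i'.+2 * q <= Q * q)%N by rewrite leq_mul2r HM orbT.
  rewrite mulnDl -mulnA !mulSn; lia.
elim: N => [|N [u Hu1 Hu2]]; first by exists 0%N; rewrite // mul0n gapsum0.
have Huy : (u * t <= y N)%N.
  case: N Hu1 {Hu2} => [/eqP-> // | N' H]; rewrite yS; lia.
have Hu : (u <= y N %/ t)%N by rewrite leq_divRL.
(* The extended tiling stops right after the tile that contains the occurrence [y N]. *)
exists (y N %/ t).+1.
  by rewrite mulSn addnC leq_add2r leq_trunc_div.
have -> : ((y N %/ t).+1 * t = u * t + ((y N %/ t - u) * t + t))%N.
  by rewrite mulnBl mulSn; have := leq_mul2r t u (y N %/ t); rewrite Hu orbT; lia.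
rewrite !gapsumD add0n.
have Hb : (mingap 0 t < gapsum P S 0 (u * t + (y N %/ t - u) * t) t)%N.
  apply: (mingap_bad Hi HM Ht (c := N)).
  by rewrite -mulnDl subnKC // leq_trunc_div /= -mulSnr ltn_ceil.
have Hm := mingap_tiles 0 t (y N %/ t - u) (u * t).
have -> : ((y N %/ t).+1 * mingap 0 t =
   u * mingap 0 t + (y N %/ t - u) * mingap 0 t + mingap 0 t)%N.
  by rewrite -mulnDl subnKC // mulSn addnC.
move: Hb Hm Hu2; move: (u * _)%N ((_ - _) * mingap _ _)%N => ? ?; lia.
Qed.

End MinGap.

Lemma nat_above (R : realType) (x : R) : exists n : nat, x < n%:R.
Proof.
by exists (Num.bound `|x|); apply: le_lt_trans (ler_norm x) (archi_boundP (normr_ge0 x)).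
Qed.

(* A sublinear subadditive defect that scales like [psi (b d) = (b/a) psi (a d)]
   is bounded along multiples of [a]: otherwise iterating
   [d |-> floor (d b / a)] would make it grow linearly. *)
Lemma scaling_defect_bounded (R : realType) (psi : nat -> R) (c : R) (a b : nat) :
  (0 < a < b)%N ->
  (forall x y, psi (x + y)%N <= psi x + psi y) ->
  (forall x, 0 <= psi x <= c * x%:R) ->
  (forall e : R, 0 < e -> exists N, forall x, (N <= x)%N -> psi x <= e * x%:R) ->
  (forall d, a%:R * psi (b * d)%N = b%:R * psi (a * d)%N) ->
  forall d, psi (a * d)%N <= c * a%:R * a%:R / (b%:R - a%:R).
Proof.
move=> /andP[a0 ab] psiD psic psio Hab d0; set C := (X in _ <= X).
have aR : 0 < a%:R :> R by rewrite ltr0n.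
have baR : 0 < b%:R - a%:R :> R by rewrite subr_gt0 ltr_nat.
have c0 : 0 <= c.
  by have /andP[H1 H2] := psic 1%N; move: (le_trans H1 H2); rewrite mulr1.
(* [C] absorbs the rounding error: above it, the excess [psi - C] grows at least by the factor
   [b / a] at each step, while [d] grows at most by that factor. *)
have HC : (b%:R - a%:R) * C = c * a%:R * a%:R by rewrite /C mulrC divfK // gt_eqF.
rewrite leNgt; apply/negP => HCd.
have step d : C < psi (a * d)%N -> let d' := ((d * b) %/ a)%N in
  [/\ (d < d')%N, a%:R * (d' : nat)%:R <= b%:R * d%:R :> R &
      b%:R * (psi (a * d)%N - C) <= a%:R * (psi (a * d')%N - C)].
  move=> Hd d'.
  have E : (b * d = a * d' + (d * b) %% a)%N by rewrite mulnC {1}(divn_eq (d * b) a) mulnC.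
  have Hr : psi ((d * b) %% a)%N <= c * a%:R.
    have /andP[_ H] := psic ((d * b) %% a)%N; apply: le_trans H _.
    by rewrite ler_wpM2l // ler_nat ltnW // ltn_pmod.
  have H1 : b%:R * psi (a * d)%N <= a%:R * (psi (a * d')%N + c * a%:R).
    by rewrite -Hab ler_pM2l // E; apply: le_trans (psiD _ _) _; rewrite lerD2l.
  have H3 : b%:R * (psi (a * d)%N - C) <= a%:R * (psi (a * d')%N - C).
    by move: HC H1; nra.
  split => //; last first.
    by rewrite -!natrM ler_nat mulnC [X in (_ <= X)%N]mulnC leq_trunc_div.
  have Hdd' : (d <= d')%N by rewrite leq_divRL // leq_mul2l (ltnW ab) orbT.
  rewrite ltn_neqAle Hdd' andbT; apply/eqP => Edd.
  by move: H3; rewrite -Edd; nra.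
pose x k := iter k (fun d => (d * b) %/ a)%N d0.
have Hx k : [/\ (k <= x k)%N, C < psi (a * x k)%N &
   (psi (a * d0)%N - C) * (x k)%:R <= (psi (a * x k)%N - C) * d0%:R].
  elim: k => [|k [H1 H2 H3]]; first by [].
  have [S1 S2 S3] := step _ H2; rewrite -[(_ %/ _)%N]/(x k.+1) in S1 S2 S3.
  split; first exact: leq_ltn_trans H1 S1.
    have b0 : 0 < b%:R :> R by rewrite ltr0n (ltn_trans a0).
    rewrite -subr_gt0 -(pmulr_rgt0 _ aR); apply: lt_le_trans S3.
    by rewrite mulr_gt0 ?subr_gt0.
  rewrite -(ler_pM2l aR).
  have bd := ler_wpM2r (ler0n R d0) S3.
  have H0 : 0 <= psi (a * d0)%N - C by rewrite subr_ge0 ltW.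
  have b0 : 0 <= b%:R :> R by [].
  have := ler_wpM2l b0 H3; have := ler_wpM2l H0 S2; lra.
have d00 : (0 < d0)%N.
  case: d0 HCd {Hx x} => //; rewrite muln0.
  have /andP[_] := psic 0%N; rewrite mulr0 => H /(fun h => lt_le_trans h H).
  by rewrite ltNge /C divr_ge0 ?mulr_ge0 // ltW.
set k0 := psi (a * d0)%N - C in Hx.
have k0p : 0 < k0 by rewrite subr_gt0.
have dR : 0 < d0%:R :> R by rewrite ltr0n.
have C0 : 0 <= C by rewrite /C divr_ge0 ?mulr_ge0 // ltW.
(* Half of the linear rate at which the excess is forced to grow along [a * x k]. *)
have e0 : 0 < k0 / (2 * a%:R * d0%:R) by rewrite divr_gt0 // !mulr_gt0.
have [N HN] := psio _ e0.
have [Hx1 Hx2 Hx3] := Hx N.+1.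
have := HN (a * x N.+1)%N.
rewrite (leq_trans (ltnW Hx1)) ?leq_pmull // natrM => /(_ isT) Hlow.
have xp : 0 < (x N.+1)%:R :> R by rewrite ltr0n; case: (x N.+1) Hx1.
have E : k0 / (2 * a%:R * d0%:R) * (a%:R * (x N.+1)%:R) * d0%:R = k0 * (x N.+1)%:R / 2.
  by field; rewrite !gt_eqF.
have := ler_wpM2r (ltW dR) Hlow; rewrite E.
have := mulr_gt0 k0p xp; have := mulr_ge0 C0 (ltW dR); lra.
Qed.

(** Each factor [a] of the argument traded for [b] gains [a / b]; one factor [a] is kept so that the
    uniform bound still applies. *)
Lemma scaling_defect_decay (R : realType) (psi : nat -> R) (c : R) (a b : nat) :
  (0 < a < b)%N ->
  (forall x y, psi (x + y)%N <= psi x + psi y) ->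
  (forall x, 0 <= psi x <= c * x%:R) ->
  (forall e : R, 0 < e -> exists N, forall x, (N <= x)%N -> psi x <= e * x%:R) ->
  (forall d, a%:R * psi (b * d)%N = b%:R * psi (a * d)%N) ->
  forall K d, psi (a ^ K.+1 * d)%N <= (a%:R / b%:R) ^+ K * (c * a%:R * a%:R / (b%:R - a%:R)).
Proof.
move=> ab psiD psic psio Hab; have /andP[a0 ab'] := ab.
have bR : 0 < b%:R :> R by rewrite ltr0n (ltn_trans a0).
elim=> [|K IH] d.
  by rewrite expn1 expr0 mul1r; apply: scaling_defect_bounded.
have -> : psi (a ^ K.+2 * d)%N = a%:R / b%:R * psi (a ^ K.+1 * (b * d))%N.
  apply: (mulfI (lt0r_neq0 bR)); rewrite mulrA mulrCA divff ?gt_eqF // mulr1.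
  rewrite expnS -mulnA -Hab; by rewrite mulnCA.
rewrite exprS -[X in _ <= X]mulrA; apply: ler_wpM2l; last exact: IH.
by rewrite divr_ge0.
Qed.

(** * Defect of the minimal gap from linear growth *)

Section DefectOfMinGap.
Variables (R : realType) (P : nat -> nat) (S : nat -> nat -> nat) (B : nat).
Hypothesis P2 : forall l, (1 < P l)%N.
Hypothesis SB : forall l j, (j < P l)%N -> (S l j <= B)%N.

(** The Fekete limit of the superadditive sequence [mingap]; bounded spacers make it finite. *)
Definition mingap_slope : R :=
  sup [set y | exists2 t, (0 < t)%N & y = (mingap P S 0 t)%:R / t%:R].

Local Notation alpha := mingap_slope.
Local Notation mu t := (mingap P S 0 t).

Let slope_ub t : (0 < t)%N -> (mu t)%:R / t%:R <= (2 * B)%:R :> R.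
Proof.
move=> t0; rewrite ler_pdivrMr ?ltr0n // -natrM ler_nat.
exact: leq_trans (mingap_le _ _ _ _ 0) (gapsum_bound P2 SB _ _).
Qed.

Let slope_sup : has_sup [set y | exists2 t, (0 < t)%N & y = (mu t)%:R / t%:R :> R].
Proof.
split; first by exists ((mu 1)%:R / 1%:R); exists 1%N.
by exists (2 * B)%:R => _ [t t0 ->]; apply: slope_ub.
Qed.

Lemma mingap_slope_ub t : (mu t)%:R <= alpha * t%:R.
Proof.
case: t => [|t].
  rewrite mulr0; have := mingap_le P S 0 0 0; rewrite gapsum0.
  by rewrite leqn0 => /eqP ->.
rewrite -ler_pdivrMr ?ltr0n //; apply: sup_ubound; first exact: slope_sup.2.
by exists t.+1.
Qed.

Lemma mingap_slope_le : alpha <= (2 * B)%:R.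
Proof.
by apply: ge_sup; [exact: slope_sup.1 | move=> _ [t t0 ->]; apply: slope_ub].
Qed.

Definition mingap_defect (t : nat) : R := alpha * t%:R - (mu t)%:R.

Lemma mingap_defectD x y :
  mingap_defect (x + y) <= mingap_defect x + mingap_defect y.
Proof.
have := mingapD P S 0 x y; rewrite -(ler_nat R) /mingap_defect !natrD; lra.
Qed.

Lemma mingap_defect_bound x : 0 <= mingap_defect x <= (2 * B)%:R * x%:R.
Proof.
rewrite subr_ge0 mingap_slope_ub /= lerBlDr.
apply: le_trans (ler_wpM2r _ mingap_slope_le) _ => //.
by rewrite lerDl.
Qed.

(** Fekete's argument: some [t] has defect at most [e t / 2], subadditivity spreads this over
    [x %/ t] windows, and the remainder costs at most [2 B t], negligible for large [x]. *)
Lemma mingap_defect_sublinear (e : R) : 0 < e ->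
  exists N, forall x, (N <= x)%N -> mingap_defect x <= e * x%:R.
Proof.
move=> e0; have [_ [t t0 ->] Ht] := sup_adherent (divr_gt0 e0 (ltr0n R 2)) slope_sup.
rewrite -/alpha in Ht.
have tR : 0 < t%:R :> R by rewrite ltr0n.
have dt : mingap_defect t <= e / 2 * t%:R.
  have : (alpha - e / 2) * t%:R < (mu t)%:R by rewrite -ltr_pdivlMr.
  by rewrite /mingap_defect; lra.
have dM k : mingap_defect (k * t) <= k%:R * mingap_defect t.
  elim: k => [|k IH].
    have := mingap_le P S 0 0 0; rewrite gapsum0 leqn0 => /eqP.
    by rewrite mul0n mul0r /mingap_defect mulr0 sub0r => ->; rewrite oppr0.
  rewrite mulSn -addn1 natrD mulrDl mul1r addrC.
  by apply: le_trans (mingap_defectD _ _) _; rewrite lerD2l.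
set D := (2 * B)%:R * t%:R * 2 / e.
have [N HN] : exists N, D < N%:R by exact: nat_above.
exists N => x Hx.
rewrite {1}(divn_eq x t); apply: le_trans (mingap_defectD _ _) _.
have H1 := dM (x %/ t)%N.
have /andP[_ H2] := mingap_defect_bound (x %% t).
have H3 : (x %% t)%:R <= t%:R :> R by rewrite ler_nat ltnW // ltn_pmod.
have H4 : (x %/ t)%:R * t%:R <= x%:R :> R by rewrite -natrM ler_nat leq_trunc_div.
have H5 : (x %/ t)%:R * mingap_defect t <= e / 2 * x%:R.
  apply: le_trans (ler_wpM2l (ler0n _ _) dt) _.
  by rewrite mulrCA ler_pM2l // divr_gt0.
have H6 : (2 * B)%:R * (x %% t)%:R <= e / 2 * x%:R.
  apply: le_trans (ler_wpM2l (ler0n _ _) H3) _.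
  have H7 : D <= x%:R by apply: ltW (lt_le_trans HN _); rewrite ler_nat.
  have -> : (2 * B)%:R * t%:R = e / 2 * D.
    by rewrite /D; field; rewrite gt_eqF.
  by rewrite ler_pM2l // divr_gt0.
lra.
Qed.

(** Any window of [N.+1] block lengths contains [N] whole blocks, so the spacers inside a block
    cannot be denser than in the sparsest long windows. *)
Lemma mingap_slope_block M :
  (gapsum P S 0 0 (copies P 0 M).-1)%:R <= alpha * (copies P 0 M)%:R.
Proof.
set q := copies P 0 M; set A := gapsum _ _ _ _ _.
rewrite leNgt; apply/negP => H.
have H0 : 0 < A%:R - alpha * q%:R by rewrite subr_gt0.
set D := alpha * q%:R / (A%:R - alpha * q%:R).
have [N HN] : exists N, D < N%:R by exact: nat_above.
have [x Hx] := mingap_attained P S 0 (N.+1 * q).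
have := gapsum_blocks S P2 0 M x N; rewrite Hx -/q -/A -(ler_nat R) natrM => H1.
have := le_trans H1 (mingap_slope_ub _); rewrite natrM -addn1 natrD.
by move: HN; rewrite ltr_pdivrMr //; lra.
Qed.

(** In a long block, tiles of length [t] exceed the minimum by one at least once per
    [copies P r M * copies P 0 r] copies. The density in the block, which is at most the slope, thus
    exceeds [mu t / t] by the inverse of that number. *)
Lemma mingap_defect_ge r i i' M t :
  (gap P S r i < gap P S r i')%N -> (i'.+1 < copies P r M)%N ->
  (0 < t <= copies P 0 r)%N ->
  t%:R <= mingap_defect t * (copies P r M * copies P 0 r)%:R.
Proof.
move=> Hi HM Ht; set q := copies P 0 r; set Q := copies P r M.
have /andP[t0 _] := Ht.
have tR : 0 < t%:R :> R by rewrite ltr0n.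
rewrite leNgt; apply/negP => Hlt.
(* Beyond this many periods the two tiles lost to rounding no longer compensate the strict
   inequality. *)
pose D := 2 * t%:R * (mu t)%:R / (t%:R - mingap_defect t * (Q * q)%:R).
have H0 : 0 < t%:R - mingap_defect t * (Q * q)%:R by rewrite subr_gt0.
have [M' HM'] : exists M', D < M'%:R by exact: nat_above.
(* The number of periods is a product of cuts, so that the whole stretch is one block. *)
set N := copies P (r + M) M'.
have HN : D < N%:R.
  apply: lt_le_trans HM' _; rewrite ler_nat; apply: leq_trans (copies_ge P2 _ _).
  exact: ltnW (ltn_expl _ _).
have EQ : copies P 0 (r + M + M') = (N * (Q * q))%N.
  by rewrite !copiesD add0n -/q -/Q -/N; ring.
have [u Hu1 Hu2] := gapsum_bad_tiles P2 N Hi HM Ht.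
have := mingap_slope_block (r + M + M'); rewrite EQ => Hsl.
set U := ((N * (Q * q)).-1 %/ t)%N.
have Hw : (gapsum P S 0 0 (U * t) <= gapsum P S 0 0 (N * (Q * q)).-1)%N.
  by apply: leq_gapsum; apply: leq_trunc_div.
have NQ0 : (0 < N * (Q * q))%N by rewrite !muln_gt0 !copies_gt0.
have Hge : (N * (Q * q) <= U.+2 * t)%N.
  have := ltn_ceil (N * (Q * q)).-1 t0; rewrite -/U => /ltnW.
  rewrite mulSn; move: t0 NQ0; case: (N * (Q * q))%N => // w /=; rewrite !mulSn; lia.
have uU : (u <= U)%N by rewrite leq_divRL.
have HU : (U * mu t + N <= gapsum P S 0 0 (U * t))%N.
  have -> : (U * t = u * t + (U - u) * t)%N by rewrite -mulnDl subnKC.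
  rewrite gapsumD; have := mingap_tiles P S 0 t (U - u) (0 + u * t).
  have -> : (U * mu t = u * mu t + (U - u) * mu t)%N by rewrite -mulnDl subnKC.
  by move: Hu2; lia.
have := leq_trans HU Hw; rewrite -(ler_nat R) natrD natrM => /le_trans /(_ Hsl).
rewrite natrM => H1.
have : N%:R * (Q * q)%:R <= U.+2%:R * t%:R :> R by rewrite -!natrM ler_nat.
rewrite -[U.+2]addn2 natrD => H2.
have : D * (t%:R - mingap_defect t * (Q * q)%:R) < N%:R * (t%:R - mingap_defect t * (Q * q)%:R).
  by rewrite ltr_pM2r.
rewrite [X in X < _]divfK ?gt_eqF // /mingap_defect => H3.
have H4 := ler_wpM2r (ltW tR) H1.
have H5 := ler_wpM2l (ler0n R (mu t)) H2.
by move: H3 H4 H5; lra.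
Qed.
End DefectOfMinGap.

Lemma geometric_small (R : realType) (x D : R) : 0 <= x < 1 ->
  exists K, x ^+ K * D < 1.
Proof.
move=> /andP[x0 x1].
have y0 : 0 < 1 - x by rewrite subr_gt0.
have bern K : x ^+ K * (1 + K%:R * (1 - x)) <= 1.
  elim: K => [|K IH]; first by rewrite expr0 mul0r addr0 mulr1.
  apply: le_trans IH; rewrite exprSr -mulrA; apply: ler_wpM2l; first exact: exprn_ge0.
  rewrite -addn1 natrD; have := mulr_ge0 (ler0n R K) (ltW y0).
  by move: (K%:R) => k Hk; have := mulr_ge0 Hk (mulr_ge0 (ltW y0) (ltW y0)); nra.
have [K HK] := nat_above (2 * D / (1 - x)); exists K.
have := bern K; move: HK; rewrite ltr_pdivrMr // => /ltW HK.
have xK := exprn_ge0 K x0.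
have := ler_wpM2l xK HK; rewrite mulrDr; lra.
Qed.

(** * Non-flat limit parameters and failure of proportionality *)

Section NonFlat.
Variables (pi : int -> nat) (eta : int -> nat -> nat).

(** The limit parameters are indexed by the integers while gaps are built upwards from a lowest
    tower, so they are read from stage [m] on. *)
Definition cuts_from (m : int) (l : nat) : nat := pi (m + l%:Z).
Definition spacers_from (m : int) (l : nat) : nat -> nat := eta (m + l%:Z).

Hypothesis pi2 : forall m, (1 < pi m)%N.

Let P2 m l : (1 < cuts_from m l)%N. Proof. exact: pi2. Qed.

(** The two parts of [Sset] are the gaps without carry at stage [m] and those with exactly one carry
    into stage [m + 1]; starting [r] stages lower makes them gaps of level [r]. *)
Lemma Sset_gap m r x : Sset pi eta m x ->
  exists2 i, (i.+1 < copies (cuts_from (m - r%:Z)) r 2)%N &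
    x = (gap (cuts_from (m - r%:Z)) (spacers_from (m - r%:Z)) r i)%:Z.
Proof.
have Er : m - r%:Z + r%:Z = m by rewrite subrK.
have Er1 : m - r%:Z + r.+1%:Z = m + 1 by rewrite -addn1 PoszD addrA Er.
rewrite copiesS copiesS copies0 muln1 /cuts_from Er Er1.
have pm := pi2 m; have pm1 := pi2 (m + 1).
case=> [[j Hj ->]|[j Hj ->]].
  exists j; first by apply: leq_trans Hj _; rewrite leq_pmulr // ltnW.
  have -> : j = (0 * cuts_from (m - r%:Z) r + j)%N by rewrite mul0n.
  by rewrite gap_low ?mul0n ?add0n ?/spacers_from ?Er // /cuts_from Er.
exists (j * cuts_from (m - r%:Z) r + (cuts_from (m - r%:Z) r).-1)%N.
  rewrite /cuts_from Er -addnS prednK ?(ltnW pm) // -mulSnr mulnC.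
  by rewrite ltn_pmul2l // ltnW.
rewrite gap_high // -[j in gap _ _ _ j](add0n) -(mul0n (cuts_from (m - r%:Z) r.+1)).
by rewrite gap_low /spacers_from /cuts_from ?Er ?Er1.
Qed.

Lemma nonflat_gap m : Eset pi eta m <> [set 0]%classic -> forall r,
  exists i i',
    [/\ (gap (cuts_from (m - r%:Z)) (spacers_from (m - r%:Z)) r i <
         gap (cuts_from (m - r%:Z)) (spacers_from (m - r%:Z)) r i')%N &
        (i'.+1 < copies (cuts_from (m - r%:Z)) r 2)%N].
Proof.
move=> HE r.
have [x [y [Hx [Hy xy]]]] : exists x y, Sset pi eta m x /\ Sset pi eta m y /\ x <> y.
  apply: contrapT => H; apply: HE; apply/seteqP; split => z /=.
    move=> [x [y [Hx [Hy ->]]]]; apply/eqP; rewrite subr_eq0; apply/eqP.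
    by apply: contrapT => xy; apply: H; exists x, y.
  move=> ->; have Hs : Sset pi eta m (eta m 0%N)%:Z by left; exists 0%N; rewrite ?pi2.
  by exists (eta m 0%N)%:Z, (eta m 0%N)%:Z; rewrite subrr.
have [i Hi Ei] := Sset_gap r Hx; have [i' Hi' Ei'] := Sset_gap r Hy.
case: (ltngtP (gap (cuts_from (m - r%:Z)) (spacers_from (m - r%:Z)) r i)
  (gap (cuts_from (m - r%:Z)) (spacers_from (m - r%:Z)) r i')) => H.
- by exists i, i'.
- by exists i', i.
- by case: xy; rewrite Ei Ei' H.
Qed.

Lemma mingap_not_proportional (R : realType) B j1 j2 :
  (forall m j, (j < pi m)%N -> (eta m j <= B)%N) ->
  (exists m, Eset pi eta m <> [set 0]%classic) -> (0 < j1 < j2)%N ->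
  exists m d, (0 < d)%N /\
    (j2 * mingap (cuts_from m) (spacers_from m) 0 (j1 * d) <>
     j1 * mingap (cuts_from m) (spacers_from m) 0 (j2 * d))%N.
Proof.
move=> etaB [m Hm] Hj; have /andP[j10 j12] := Hj.
apply: contrapT => Hno.
have Heq m' d : (j2 * mingap (cuts_from m') (spacers_from m') 0 (j1 * d) =
     j1 * mingap (cuts_from m') (spacers_from m') 0 (j2 * d))%N.
  case: d => [|d].
    have E0 j : mingap (cuts_from m') (spacers_from m') 0 (j * 0) = 0%N.
      rewrite muln0; have := mingap_le (cuts_from m') (spacers_from m') 0 0 0.
      by rewrite gapsum0 leqn0 => /eqP.
    by rewrite !E0 !muln0.
  by apply: contrapT => H; apply: Hno; exists m', d.+1.
pose C : R := (2 * B)%:R * j1%:R * j1%:R / (j2%:R - j1%:R).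
pose Q := (pi m * pi (m + 1))%N.
have x01 : 0 <= j1%:R / (j2%:R : R) < 1.
  by rewrite divr_ge0 //= ltr_pdivrMr ?ltr0n ?(ltn_trans j10) // mul1r ltr_nat.
(* [K] pushes the scaling bound below [1 / (2 Q)], the lower bound obtained at the end. [Q] counts
   the copies over the two stages from [m] on, so it does not depend on [K]. *)
have [K HK] := geometric_small (C * (2 * Q%:R)) x01.
pose A := (j1 ^ K.+1)%N.
have A0 : (0 < A)%N by rewrite expn_gt0 j10.
(* Starting [A] stages below [m] gives blocks of at least [2 ^ A] copies, so some multiple [A * d]
   lies between half a block and a block. *)
pose r := A; pose m' := m - r%:Z.
pose P := cuts_from m'; pose S := spacers_from m'.
have SB l j : (j < P l)%N -> (S l j <= B)%N by apply: etaB.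
set q := copies P 0 r.
have qA : (A <= q)%N.
  by apply: leq_trans (copies_ge (P2 m') 0 r); apply: ltnW; apply: ltn_expl.
pose d := (q %/ A)%N.
have d0 : (0 < d)%N by rewrite divn_gt0.
have tq : (0 < A * d <= q)%N by rewrite muln_gt0 A0 d0 mulnC leq_trunc_div.
have qt : (q <= 2 * (A * d))%N.
  have := ltn_ceil q A0; rewrite -/d mulSn => /ltnW H; apply: leq_trans H _.
  by have := leq_pmulr A d0; rewrite [(d * A)%N]mulnC; lia.
have [i [i' [Hi Hi']]] := nonflat_gap Hm r.
have EQ : copies P r 2 = Q.
  rewrite !copiesS copies0 muln1 /P /cuts_from /m' subrK /Q; congr (_ * pi _)%N.
  by rewrite -addn1 PoszD addrA subrK.
have Hge := mingap_defect_ge R (P2 m') SB Hi Hi' tq.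
rewrite -/P -/S EQ -/q in Hge.
have Hdec := scaling_defect_decay Hj (@mingap_defectD R P S)
  (mingap_defect_bound R (P2 m') SB) (mingap_defect_sublinear (P2 m') SB).
have {}Hdec : mingap_defect R P S (A * d) <= (j1%:R / j2%:R) ^+ K * C.
  apply: Hdec => e; rewrite /mingap_defect.
  have := congr1 (fun n => n%:R : R) (Heq m' e); rewrite -/P -/S !natrM => H.
  by rewrite !mulrBr H; ring.
have tR : 0 < (A * d)%:R :> R by rewrite ltr0n; case/andP: tq.
have qtR : q%:R <= 2 * (A * d)%:R :> R by rewrite -natrM ler_nat.
have D0 : 0 <= mingap_defect R P S (A * d).
  by case/andP: (mingap_defect_bound R (P2 m') SB (A * d)%N).
have H1 : (A * d)%:R <= mingap_defect R P S (A * d) * Q%:R * (2 * (A * d)%:R).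
  apply: le_trans Hge _; rewrite natrM mulrA; apply: ler_wpM2l => //.
  by rewrite mulr_ge0.
have H2 : 1 <= mingap_defect R P S (A * d) * (2 * Q%:R).
  by rewrite -(ler_pM2r tR) mul1r; apply: le_trans H1 _; rewrite le_eqVlt; apply/orP; left; apply/eqP; ring.
have H3 := ler_wpM2r (mulr_ge0 (ler0n R 2) (ler0n R Q)) Hdec.
by move: HK; rewrite mulrA; lra.
Qed.

End NonFlat.

(** * Weighted norms and Jensen's inequality *)

Section WeightedNorm.
Variable C : numClosedFieldType.
Implicit Types (p q : {poly C}) (x u : C).

(** At [x = 1] this bounds the operator norm of [p(U^-1)]. A bound at some [x > 1], uniform along a
    sequence of polynomials, expresses a radius of convergence larger than 1. *)
Definition wnorm x p : C := \sum_(i < size p) `|p`_i| * x ^+ i.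

Lemma wnormE n x p : (size p <= n)%N -> wnorm x p = \sum_(i < n) `|p`_i| * x ^+ i.
Proof.
move=> pn; rewrite /wnorm (big_ord_widen n (fun i => `|p`_i| * x ^+ i)) //.
rewrite big_mkcond; apply: eq_bigr => i _; case: ltnP => // Hi.
by rewrite nth_default // normr0 mul0r.
Qed.

Lemma wnorm_ge0 x p : 0 <= x -> 0 <= wnorm x p.
Proof. by move=> x0; apply: sumr_ge0 => i _; rewrite mulr_ge0 ?exprn_ge0. Qed.

Lemma wnorm0 x : wnorm x 0 = 0.
Proof. by rewrite /wnorm size_poly0 big_ord0. Qed.

Lemma wnormZ x a p : wnorm x (a *: p) = `|a| * wnorm x p.
Proof.
rewrite (@wnormE (size p)) ?size_scale_leq // /wnorm mulr_sumr.
by apply: eq_bigr => i _; rewrite coefZ normrM mulrA.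
Qed.

Lemma wnormN x p : wnorm x (- p) = wnorm x p.
Proof. by rewrite -scaleN1r wnormZ normrN1 mul1r. Qed.

Lemma wnormD x p q : 0 <= x -> wnorm x (p + q) <= wnorm x p + wnorm x q.
Proof.
move=> x0; pose n := maxn (size p) (size q).
rewrite (@wnormE n x (p + q)) ?size_polyD // (@wnormE n x p) ?leq_maxl //.
rewrite (@wnormE n x q) ?leq_maxr // -big_split /=; apply: ler_sum => i _.
by rewrite coefD -mulrDl ler_wpM2r ?exprn_ge0 ?ler_normD.
Qed.

Lemma wnormB x p q : 0 <= x -> wnorm x (p - q) <= wnorm x p + wnorm x q.
Proof. by move=> x0; rewrite -(wnormN x q); apply: wnormD. Qed.

Lemma wnorm_sum (I : Type) (r : seq I) (Q : pred I) (F : I -> {poly C}) x :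
  0 <= x -> wnorm x (\sum_(i <- r | Q i) F i) <= \sum_(i <- r | Q i) wnorm x (F i).
Proof.
move=> x0; elim/big_ind2: _ => [|p a q b Hp Hq|//]; first by rewrite wnorm0.
by apply: le_trans (wnormD _ _ x0) _; apply: lerD.
Qed.

Lemma wnorm_XnM x n p : wnorm x ('X^n * p) = x ^+ n * wnorm x p.
Proof.
rewrite (@wnormE (n + size p)); last first.
  by apply: leq_trans (size_polyMleq _ _) _; rewrite size_polyXn.
rewrite big_split_ord /= big1 ?add0r => [|i _]; last first.
  by rewrite coefXnM ltn_ord normr0 mul0r.
rewrite /wnorm mulr_sumr; apply: eq_bigr => i _.
by rewrite coefXnM ltnNge leq_addr addKn exprD mulrCA.
Qed.

Lemma wnorm_Xn x n : wnorm x 'X^n = x ^+ n.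
Proof.
rewrite -['X^n]mulr1 wnorm_XnM (@wnormE 1) ?size_poly1 //.
by rewrite big_ord1 coef1 normr1 expr0 !mulr1.
Qed.

Lemma wnorm1 x : wnorm x 1 = 1.
Proof. by rewrite -(expr0 'X) wnorm_Xn expr0. Qed.

Lemma wnormM x p q : 0 <= x -> wnorm x (p * q) <= wnorm x p * wnorm x q.
Proof.
move=> x0.
have -> : p * q = \sum_(i < size p) p`_i *: ('X^i * q).
  rewrite -{1}[p]coefK poly_def mulr_suml.
  by apply: eq_bigr => i _; rewrite scalerAl.
apply: le_trans (wnorm_sum _ _ _ x0) _.
rewrite [wnorm x p]/wnorm mulr_suml; apply: ler_sum => i _.
by rewrite wnormZ wnorm_XnM mulrA.
Qed.

Lemma horner_le_wnorm x p u : `|u| <= x -> `|p.[u]| <= wnorm x p.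
Proof.
move=> ux; rewrite horner_coef; apply: le_trans (ler_norm_sum _ _ _) _.
by apply: ler_sum => i _; rewrite normrM normrX ler_wpM2l // lerXn2r // ?nnegrE ?(le_trans _ ux).
Qed.

Lemma wnorm_comp_XnZ x a n p : 0 <= x ->
  wnorm x (p \Po (a *: 'X^n)) <= wnorm (`|a| * x ^+ n) p.
Proof.
move=> x0; rewrite comp_polyE; apply: le_trans (wnorm_sum _ _ _ x0) _.
apply: ler_sum => i _; rewrite wnormZ exprZn -exprM wnormZ wnorm_Xn normrX.
by rewrite exprMn -exprM.
Qed.

End WeightedNorm.

Section CircleMean.
Variable C : numClosedFieldType.

Lemma prim_root_exists n : (0 < n)%N -> exists z : C, n.-primitive_root z.
Proof.
pose p : {poly C} := 'X^n - 1; have [r Dp] := closed_field_poly_normal p.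
move=> n_gt0; rewrite (monicP _) ?monicXnsubC // scale1r in Dp.
have rn1 : all n.-unity_root r by apply/allP => z; rewrite -root_prod_XsubC -Dp.
have sz_r : (n < (size r).+1)%N.
  by rewrite -(size_prod_XsubC r id) -Dp size_XnsubC.
have [|z] := hasP (has_prim_root n_gt0 rn1 _ sz_r); last by exists z.
by rewrite -separable_prod_XsubC -Dp separable_Xn_sub_1 // pnatr_eq0 -lt0n.
Qed.

(** The mean over [n.+1] equidistant points, [n] being the size of [p], kills every term of positive
    degree exactly. *)
Lemma circle_mean (p : {poly C}) (x b : C) : 0 <= x ->
  (forall u, `|u| = x -> `|p.[u]| <= b) -> `|p`_0| <= b.
Proof.
move=> x0 Hp; set n := size p.
have [w Hw] := prim_root_exists (ltn0Sn n).
have w1 : `|w| = 1.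
  apply/eqP; rewrite -(pexpr_eq1 (n := n.+1)) // -normrX (prim_expr_order Hw).
  by rewrite normr1.
have E : \sum_(k < n.+1) p.[x * w ^+ k] = n.+1%:R * p`_0.
  under eq_bigr => k _ do rewrite (@horner_coef_wide _ n.+1) ?leqnSn //.
  rewrite exchange_big /= big_ord_recl /= [X in _ + X]big1 => [|i _].
    under eq_bigr => k _ do rewrite expr0 mulr1.
    by rewrite sumr_const card_ord addr0 mulr_natl.
  under eq_bigr => k _ do rewrite exprMn mulrA -exprM mulnC exprM.
  rewrite -mulr_sumr; set v := w ^+ _.
  have v1 : v != 1.
    rewrite /v -(expr0 w) (eq_prim_root_expr Hw) mod0n modn_small //.
    by rewrite /lift /= /bump ltnS ltn_ord.
  suff -> : \sum_(k < n.+1) v ^+ k = 0 by rewrite mulr0.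
  apply: (mulfI (x := v - 1)); first by rewrite subr_eq0.
  by rewrite mulr0 -subrX1 /v -exprM mulnC exprM (prim_expr_order Hw) expr1n subrr.
have n0 : 0 < n.+1%:R :> C by rewrite ltr0n.
rewrite -(ler_pM2l n0) -(ger0_norm (ltW n0)) -normrM -E.
apply: le_trans (ler_norm_sum _ _ _) _.
apply: le_trans (ler_sum _ (fun (k : 'I_n.+1) _ => Hp (x * w ^+ k) _)) _ => [k _|].
  by rewrite normrM normrX w1 expr1n mulr1 ger0_norm.
by rewrite sumr_const card_ord ger0_norm ?ler0n // mulr_natl.
Qed.

(* Jensen's inequality; each zero [z] is traded for its Blaschke reflection,
   which does not change the modulus on the circle of radius [x]. *)
Lemma jensen_zeros (s : seq C) (g : {poly C}) (x b : C) : 0 < x ->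
  (forall z, z \in s -> `|z| = 1) ->
  (forall u, `|u| = x -> `|((\prod_(z <- s) ('X - z%:P)) * g).[u]| <= b) ->
  `|g`_0| * x ^+ size s <= b.
Proof.
move=> x0; elim: s g => [|z s IH] g Hs Hb.
  rewrite expr0 mulr1; apply: (circle_mean (ltW x0)) => u ux.
  by have := Hb u ux; rewrite big_nil mul1r.
have z1 : `|z| = 1 by apply: Hs; rewrite mem_head.
(* Its value at 0 is [x], where ['X - z%:P] had modulus 1: this is the factor gained for each
   zero. *)
pose h := x%:P - (z^* / x) *: 'X.
have -> : `|g`_0| * x ^+ size (z :: s) = `|(h * g)`_0| * x ^+ size s.
  have h0 : h.[0] = x by rewrite /h !hornerE ?mulr0 ?subr0.
  rewrite -!horner_coef0 hornerM h0 normrM (gtr0_norm x0).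
  by rewrite /= exprS; ring.
apply: IH => [y ys|u ux]; first by apply: Hs; rewrite in_cons ys orbT.
have := Hb u ux; rewrite big_cons !hornerM !normrM.
suff -> : `|h.[u]| = `|('X - z%:P).[u]| by rewrite mulrCA mulrA.
have xn : x != 0 by rewrite gt_eqF.
have ux2 : u * u^* = x ^+ 2 by rewrite -normCK ux.
rewrite /h !hornerE /=.
have -> : x - z^* / x * u = u / x * (u - z)^*.
  have E : x = u * u^* / x by rewrite ux2 expr2 mulfK.
  transitivity (u * u^* / x - z^* / x * u); first by rewrite -E.
  by rewrite rmorphB /=; field.
by rewrite normrM norm_conjC normrM normfV (gtr0_norm x0) ux divff // mul1r.
Qed.

Lemma jensen_roots (s : seq C) (p : {poly C}) (x b : C) : 0 < x ->
  uniq s -> (forall z, z \in s -> `|z| = 1) -> all (root p) s ->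
  (forall u, `|u| = x -> `|p.[u]| <= b) -> `|p`_0| * x ^+ size s <= b.
Proof.
move=> x0 us s1 ps Hb.
have [g Eg] : exists g, p = (\prod_(z <- s) ('X - z%:P)) * g.
  have [g Eg] := uniq_roots_prod_XsubC ps (etrans (uniq_rootsE s) us).
  by exists g; rewrite Eg mulrC.
have -> : `|p`_0| = `|g`_0|.
  rewrite Eg -!horner_coef0 hornerM normrM horner_prod normr_prod.
  rewrite big_seq big1 ?mul1r // => z zs.
  by rewrite hornerXsubC sub0r normrN s1.
by apply: (jensen_zeros x0 s1) => u ux; rewrite -Eg Hb.
Qed.

End CircleMean.

Lemma eventually_seq (T : eqType) (s : seq T) (Q : T -> nat -> Prop) :
  (forall y, y \in s -> exists N, forall n, (N <= n)%N -> Q y n) ->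
  exists N, forall y, y \in s -> forall n, (N <= n)%N -> Q y n.
Proof.
elim: s => [|y s IH] H; first by exists 0%N.
have [N1 H1] := H y (mem_head _ _).
have [z zs|N2 H2] := IH; first by apply: H; rewrite in_cons zs orbT.
exists (maxn N1 N2) => z; rewrite in_cons => /orP[/eqP ->|zs] n; rewrite geq_max => /andP[h1 h2].
  exact: H1.
exact: H2.
Qed.

Section ZerosOfLimits.
Variable C : numClosedFieldType.

(* The zeros of a limit of the polynomials [f M] are moved onto zeros of
   [f M - (interpolation polynomial)], to which Jensen's inequality applies. *)
Lemma limit_circle_zeros (f : nat -> {poly C}) (e M1 : nat) (delta x b : C) (s : seq C) :
  1 <= x -> 0 < delta ->
  (forall M i, (i < e)%N -> (f M)`_i = 0) ->
  (forall M, (M1 <= M)%N -> delta <= `|(f M)`_e|) ->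
  (forall M, wnorm x (f M) <= b) ->
  uniq s -> (forall y, y \in s -> `|y| = 1) ->
  (forall y, y \in s -> (f M).[y] @[M --> \oo] --> (0 : C)) ->
  delta * x ^+ size s <= 2 * (b + 1).
Proof.
move=> x1 d0 flow fdel fb us s1 fs.
have x0 : 0 < x by apply: lt_le_trans x1.
pose g M := drop_poly e (f M).
have Ef M : f M = 'X^e * g M.
  rewrite -[LHS](poly_take_drop e) mulrC; apply/polyP => i.
  rewrite coefD coef_take_poly; case: ifP => Hi; last by rewrite add0r.
  by rewrite flow // add0r.
have gb M : wnorm x (g M) <= b.
  apply: le_trans (fb M); rewrite Ef wnorm_XnM.
  by apply: ler_peMl; rewrite ?exprn_ege1 // wnorm_ge0 // ltW.
have g0 M : (g M)`_0 = (f M)`_e by rewrite coef_drop_poly add0n.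
(* Lagrange polynomial at [y], not normalized. *)
pose L y : {poly C} := \prod_(z <- rem y s) ('X - z%:P).
have Lyy y : y \in s -> (L y).[y] != 0.
  move=> ys; rewrite horner_prod prodf_seq_neq0; apply/allP => z.
  rewrite mem_rem_uniq // => /andP[/= zy _].
  by rewrite !hornerE subr_eq0 eq_sym.
have Lyz y z : y \in s -> z \in s -> z != y -> (L y).[z] = 0.
  move=> ys zs zy; apply/eqP; rewrite -[_ == 0]/(root (L y) z) root_prod_XsubC.
  by rewrite mem_rem_uniq // inE zy.
pose k := \sum_(y <- s) `|(L y).[y]|^-1 * wnorm x (L y).
have k0 : 0 <= k.
  by apply: sumr_ge0 => y _; rewrite mulr_ge0 ?invr_ge0 ?wnorm_ge0 // ltW.
(* This quotient is below [delta / 2], which keeps the constant coefficient away from 0, and below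
   1, which keeps the norm under [b + 1]. *)
pose m := delta / 2 / (delta / 2 + 1).
have d20 : 0 < delta / 2 by rewrite divr_gt0.
have d21 : 0 < delta / 2 + 1 by rewrite addr_gt0.
have m0 : 0 < m by rewrite divr_gt0.
have e0 : 0 < m / (k + 1) by rewrite divr_gt0 // ltr_wpDl.
have [N HN] : exists N, forall y, y \in s -> forall M, (N <= M)%N -> `|(f M).[y]| <= m / (k + 1).
  apply: eventually_seq => y ys; have /cvgrPdist_le /(_ _ e0) [N _ H] := fs y ys.
  by exists N => M /H /=; rewrite sub0r normrN.
pose M := maxn N M1.
(* [I] interpolates [g M] on [s], so [g M - I] vanishes on [s]; it is small because the values of
   [f M] on [s] tend to 0. *)
pose I := \sum_(y <- s) ((g M).[y] / (L y).[y]) *: L y.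
have Ib : wnorm x I <= m.
  apply: le_trans (wnorm_sum _ _ _ (ltW x0)) _.
  apply: (@le_trans _ _ (m / (k + 1) * k)); last first.
    by rewrite mulrAC ler_pdivrMr ?ltr_wpDl // ler_pM2l // lerDl.
  have -> : m / (k + 1) * k =
      \sum_(y <- s) m / (k + 1) * (`|(L y).[y]|^-1 * wnorm x (L y)).
    by rewrite -mulr_sumr.
  rewrite !big_seq; apply: ler_sum => y ys.
  rewrite wnormZ normrM normfV -[leLHS]mulrA ler_wpM2r ?mulr_ge0 ?invr_ge0 ?(wnorm_ge0 _ (ltW x0)) //.
  have := HN y ys M (leq_maxl _ _).
  by rewrite Ef hornerM hornerXn normrM normrX s1 // expr1n mul1r.
have md : m <= delta / 2 by rewrite ler_pdivrMr // ler_peMr ?lerDr // ltW.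
have m1 : m <= 1 by rewrite ler_pdivrMr // mul1r lerDl.
have I0 : `|I`_0| <= m.
  by apply: le_trans Ib; rewrite -horner_coef0; apply: horner_le_wnorm; rewrite normr0 ltW.
have H : `|(g M - I)`_0| * x ^+ size s <= b + 1.
  apply: jensen_roots => //.
    apply/allP => y ys; rewrite /root hornerD hornerN horner_sum.
    rewrite (bigD1_seq y) //= big_seq_cond big1 ?addr0.
      by rewrite hornerZ divfK ?subrr ?Lyy.
    by move=> z /andP[zs zy]; rewrite hornerZ (Lyz z y) ?mulr0 // eq_sym.
  move=> u ux; apply: (@le_trans _ _ (wnorm x (g M - I))); first by rewrite horner_le_wnorm ?ux.
  by apply: le_trans (wnormB _ _ (ltW x0)) _; apply: lerD; rewrite ?gb ?(le_trans Ib).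
have Hd : delta / 2 <= `|(g M - I)`_0|.
  rewrite coefB; apply: le_trans (lerB_dist _ _).
  have := fdel M (leq_maxr _ _); rewrite -g0 => H1.
  by rewrite lerBrDr; apply: le_trans H1; rewrite [leRHS]splitr lerD2l (le_trans I0).
rewrite -ler_pdivrMl ?ltr0n // mulrA [2^-1 * _]mulrC.
by apply: le_trans H; rewrite ler_wpM2r // exprn_ge0 // ltW.
Qed.

End ZerosOfLimits.

(** * Toeplitz forms and averaging *)

Section ToeplitzForm.
Variables (C : numClosedFieldType) (c : int -> C).
Implicit Types (p q y : {poly C}).

(* The sesquilinear form for which multiplication by 'X is the isometry
   [U^-1], when [c n = <U^n f, f>] and the polynomial 1 stands for [f]. *)
Definition form p q : C :=
  \sum_(i < size p) \sum_(l < size q) p`_i * (q`_l)^* * c (l%:Z - i%:Z).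

Lemma formE n m p q : (size p <= n)%N -> (size q <= m)%N ->
  form p q = \sum_(i < n) \sum_(l < m) p`_i * (q`_l)^* * c (l%:Z - i%:Z).
Proof.
move=> pn qm; rewrite /form.
rewrite (big_ord_widen n (fun i => \sum_(l < size q) p`_i * (q`_l)^* * c (l%:Z - i%:Z))) //.
rewrite big_mkcond; apply: eq_bigr => i _; case: ltnP => Hi; last first.
  by rewrite big1 // => l _; rewrite nth_default // !mul0r.
rewrite (big_ord_widen m (fun l => p`_i * (q`_l)^* * c (l%:Z - i%:Z))) //.
rewrite big_mkcond; apply: eq_bigr => l _; case: ltnP => // Hl.
by rewrite [q`_l]nth_default // conjC0 mulr0 mul0r.
Qed.

Lemma formDl p p' q : form (p + p') q = form p q + form p' q.
Proof.
pose n := maxn (size p) (size p').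
rewrite (@formE n (size q)) ?size_polyD // (@formE n (size q) p) ?leq_maxl //.
rewrite (@formE n (size q) p') ?leq_maxr // -big_split /=; apply: eq_bigr => i _.
by rewrite -big_split; apply: eq_bigr => l _; rewrite coefD !mulrDl.
Qed.

Lemma formZl a p q : form (a *: p) q = a * form p q.
Proof.
rewrite (@formE (size p) (size q)) ?size_scale_leq // mulr_sumr.
apply: eq_bigr => i _; rewrite mulr_sumr; apply: eq_bigr => l _.
by rewrite coefZ !mulrA.
Qed.

Lemma formNl p q : form (- p) q = - form p q.
Proof. by rewrite -scaleN1r formZl mulN1r. Qed.

Lemma form0l q : form 0 q = 0.
Proof. by rewrite /form size_poly0 big_ord0. Qed.

Lemma form_suml (I : Type) (r : seq I) (Q : pred I) (F : I -> {poly C}) q :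
  form (\sum_(i <- r | Q i) F i) q = \sum_(i <- r | Q i) form (F i) q.
Proof. by apply: (big_morph (form^~ q)) => [p p'|]; rewrite ?formDl ?form0l. Qed.

Lemma form_Xnl a p q : form ('X^a * p) q =
  \sum_(i < size p) \sum_(l < size q) p`_i * (q`_l)^* * c (l%:Z - i%:Z - a%:Z).
Proof.
rewrite (@formE (a + size p) (size q)) //; last first.
  by apply: leq_trans (size_polyMleq _ _) _; rewrite size_polyXn.
rewrite big_split_ord /= big1 ?add0r => [|i _]; last first.
  by rewrite big1 // => l _; rewrite coefXnM ltn_ord !mul0r.
apply: eq_bigr => i _; apply: eq_bigr => l _.
rewrite coefXnM ltnNge leq_addr addKn PoszD; congr (_ * c _).
by rewrite opprD addrA addrAC.
Qed.

Lemma form_Xnr a p q : form p ('X^a * q) =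
  \sum_(i < size p) \sum_(l < size q) p`_i * (q`_l)^* * c (l%:Z - i%:Z + a%:Z).
Proof.
rewrite (@formE (size p) (a + size q)) //; last first.
  by apply: leq_trans (size_polyMleq _ _) _; rewrite size_polyXn.
apply: eq_bigr => i _.
rewrite big_split_ord /= big1 ?add0r => [|l _]; last first.
  by rewrite coefXnM ltn_ord conjC0 mulr0 mul0r.
apply: eq_bigr => l _.
rewrite coefXnM ltnNge leq_addr addKn PoszD; congr (_ * c _).
lia.
Qed.

Lemma form_XnM a p q : form ('X^a * p) ('X^a * q) = form p q.
Proof.
have sX (r : {poly C}) : (size ('X^a * r)%R <= a + size r)%N.
  by apply: leq_trans (size_polyMleq _ _) _; rewrite size_polyXn.
rewrite (@formE (a + size p) (a + size q)) // big_split_ord /= big1 ?add0r => [|i _].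
  apply: eq_bigr => i _.
  rewrite big_split_ord /= big1 ?add0r => [|l _]; last first.
    by rewrite [_`_l]coefXnM ltn_ord conjC0 mulr0 mul0r.
  apply: eq_bigr => l _.
  rewrite !coefXnM !ltnNge !leq_addr !addKn; congr (_ * c _); lia.
by rewrite big1 // => l _; rewrite coefXnM ltn_ord !mul0r.
Qed.

Hypothesis cN : forall n, c (- n) = (c n)^*.

Lemma form_conj p q : form q p = (form p q)^*.
Proof.
rewrite /form exchange_big rmorph_sum; apply: eq_bigr => i _.
rewrite rmorph_sum; apply: eq_bigr => l _ /=.
by rewrite !rmorphM /= conjCK -cN opprB [(p`_i)^* * _]mulrC.
Qed.

Lemma formDr p q q' : form p (q + q') = form p q + form p q'.
Proof. by rewrite form_conj formDl rmorphD /= -!form_conj. Qed.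

Lemma formZr a p q : form p (a *: q) = a^* * form p q.
Proof. by rewrite form_conj formZl rmorphM /= -form_conj. Qed.

Lemma formNr p q : form p (- q) = - form p q.
Proof. by rewrite form_conj formNl rmorphN /= -form_conj. Qed.

Lemma form_sumr (I : Type) (r : seq I) (Q : pred I) (F : I -> {poly C}) q :
  form q (\sum_(i <- r | Q i) F i) = \sum_(i <- r | Q i) form q (F i).
Proof.
by rewrite form_conj form_suml rmorph_sum; apply: eq_bigr => i _ /=; rewrite -form_conj.
Qed.

Hypothesis form_ge0 : forall p, 0 <= form p p.

Local Notation N p := (form p p).

Lemma formD_le p q : N (p + q) <= 2 * (N p + N q).
Proof.
have := form_ge0 (p - q).
rewrite !formDl !formDr !formNl !formNr => H; rewrite -subr_ge0; apply: le_trans H _.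
by rewrite le_eqVlt; apply/orP; left; apply/eqP; ring.
Qed.

(** Positivity at [p - w *: q], where [w] is the phase of [form p q]. This additive version loses
    nothing when [p] and [q] have equal norms, as in [formM_le]. *)
Lemma form_cauchy p q : `|form p q| * 2 <= N p + N q.
Proof.
have [->|a0] := eqVneq (form p q) 0.
  by rewrite normr0 mul0r addr_ge0.
set a := form p q in a0 *; set w := a / `|a|.
have na0 : `|a| != 0 by rewrite normr_eq0.
have ww : w * w^* = 1 by rewrite -normCK /w normrM normfV normr_id divff // expr1n.
have aw : w^* * a = `|a|.
  rewrite /w rmorphM fmorphV /= [ `|a|^*]conj_Creal ?normr_real // mulrAC -[_^* * a]mulrC.
  by rewrite -normCK expr2 mulfK.
have := form_ge0 (p - w *: q).
rewrite !formDl !formDr !formNl !formNr !formZl !formZr -/a (form_conj p q) -/a.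
have -> : w * a^* = `|a|.
  by rewrite -[w]conjCK -rmorphM aw /= conj_Creal ?normr_real.
rewrite aw [w * _]mulrA ww mul1r => H; rewrite -subr_ge0; apply: le_trans H _.
by rewrite le_eqVlt; apply/orP; left; apply/eqP; ring.
Qed.

Lemma formM_le k q : N (k * q) <= wnorm 1 k ^+ 2 * N q.
Proof.
have E : k * q = \sum_(i < size k) k`_i *: ('X^i * q).
  rewrite -{1}[k]coefK poly_def mulr_suml.
  by apply: eq_bigr => i _; rewrite scalerAl.
rewrite -[leLHS]ger0_norm // {1}E form_suml.
apply: le_trans (ler_norm_sum _ _ _) _.
have wE : wnorm 1 k = \sum_(i < size k) `|k`_i|.
  by apply: eq_bigr => i _; rewrite expr1n mulr1.
rewrite expr2 -mulrA {1}wE mulr_suml; apply: ler_sum => i _.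
rewrite formZl normrM ler_wpM2l // E form_sumr.
apply: le_trans (ler_norm_sum _ _ _) _.
rewrite wE mulr_suml; apply: ler_sum => l _.
rewrite formZr normrM norm_conjC ler_wpM2l //.
have := form_cauchy ('X^i * q) ('X^l * q).
rewrite !form_XnM (_ : N q + N q = N q * 2); last by ring.
by rewrite ler_pM2r.
Qed.

Lemma form_le p q : `|form p q| <= c 0 * (wnorm 1 p * wnorm 1 q).
Proof.
have N1 : form 1 1 = c 0.
  by rewrite /form size_poly1 !big_ord1 coef1 conjC1 !mul1r subrr.
have c_le n : `|c n| <= c 0.
  have nat_case m : `|c m%:Z| <= c 0.
    have := form_cauchy 1 ('X^m * 1); rewrite form_XnM N1 form_Xnr size_poly1.
    rewrite !big_ord1 coef1 conjC1 !mul1r subrr add0r.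
    by rewrite (_ : c 0 + c 0 = c 0 * 2) ?ler_pM2r //; ring.
  case: n => m; first exact: nat_case.
  by rewrite NegzE cN norm_conjC nat_case.
rewrite /form; apply: le_trans (ler_norm_sum _ _ _) _.
rewrite mulrCA [X in X * _]/wnorm mulr_suml; apply: ler_sum => i _.
apply: le_trans (ler_norm_sum _ _ _) _.
rewrite /wnorm !mulr_sumr; apply: ler_sum => l _.
rewrite !normrM norm_conjC !expr1n !mulr1 -mulrA ler_wpM2l //.
by rewrite mulrC ler_wpM2r.
Qed.

(* [U^-(j b_k) -> F(U)^*] weakly, up to [e], read on the correlations [c]. *)
Definition weak_limit_upto (e : C) (F : {poly C}) (a : nat -> nat) :=
  forall n : int, exists K, forall k, (K <= k)%N ->
    `|c (n + (a k)%:Z) - \sum_(r < size F) F`_r * c (n - r%:Z)| <= e.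

(** Moving a power across the form gives [<p, U^-(j (b - L)) y> = <U^-(j L) U^(j b) p, y>], and
    [U^(j b)] is near [F(U^-1)]. Only finitely many coefficients occur, so one [K] serves all. *)
Lemma weak_limit_form e F (j : nat) (b : nat -> nat) p y L :
  weak_limit_upto e F (fun k => j * b k)%N ->
  exists K, forall k, (K <= k)%N -> (L <= b k)%N ->
    `|form p ('X^(j * (b k - L)) * y) - form ('X^(j * L) * (F * p)) y| <=
      e * (wnorm 1 p * wnorm 1 y).
Proof.
move=> HF.
pose nn (i l : nat) : int := l%:Z - i%:Z - (j * L)%N%:Z.
have [K HK] : exists K, forall i, i \in iota 0 (size p) -> forall k, (K <= k)%N ->
    forall l, l \in iota 0 (size y) ->
    `|c (nn i l + (j * b k)%N%:Z) - \sum_(r < size F) F`_r * c (nn i l - r%:Z)| <= e.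
  apply: eventually_seq => i _.
  have [K HK] := @eventually_seq _ (iota 0 (size y)) _ (fun l _ => HF (nn i l)).
  by exists K => k Kk l ly; apply: HK.
exists K => k Kk Lb.
have -> : form ('X^(j * L) * (F * p)) y = \sum_(i < size p) \sum_(l < size y)
   p`_i * (y`_l)^* * \sum_(r < size F) F`_r * c (nn i l - r%:Z).
  have -> : 'X^(j * L) * (F * p) = \sum_(r < size F) F`_r *: ('X^(j * L + r) * p).
    rewrite -{1}[F]coefK poly_def mulr_suml mulr_sumr; apply: eq_bigr => r _.
    by rewrite -scalerAl -scalerAr exprD mulrA.
  rewrite form_suml; under eq_bigr => r _ do rewrite formZl form_Xnl mulr_sumr.
  rewrite exchange_big; apply: eq_bigr => i _ /=.
  under eq_bigr => r _ do rewrite mulr_sumr.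
  rewrite exchange_big; apply: eq_bigr => l _ /=.
  rewrite mulr_sumr; apply: eq_bigr => r _; rewrite mulrCA; congr (_ * (_ * c _)).
  by rewrite /nn PoszD; lia.
rewrite form_Xnr -sumrB; apply: le_trans (ler_norm_sum _ _ _) _.
rewrite mulrCA [X in X * _]/wnorm mulr_suml; apply: ler_sum => i _.
rewrite -sumrB; apply: le_trans (ler_norm_sum _ _ _) _.
rewrite /wnorm !mulr_sumr; apply: ler_sum => l _.
rewrite -mulrBr !normrM norm_conjC !expr1n !mulr1 -mulrA ler_wpM2l //.
rewrite [leRHS]mulrC ler_wpM2l //.
have -> : l%:Z - i%:Z + (j * (b k - L))%N%:Z = nn i l + (j * b k)%N%:Z.
  by rewrite /nn mulnBr; have := leq_mul (leqnn j) Lb; lia.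
by apply: HK; rewrite ?mem_iota ?add0n ?leq0n ?ltn_ord.
Qed.

End ToeplitzForm.

(** * Strong limits by averaging *)

Section MazurStep.
Variables (C : numClosedFieldType) (c : int -> C).
Hypothesis cN : forall n, c (- n) = (c n)^*.
Hypothesis form_ge0 : forall p, 0 <= form c p p.
Variables (F : {poly C}) (j : nat) (b : nat -> nat) (e B : C) (p : {poly C}).
Hypothesis F1 : wnorm 1 F <= 1.
Hypothesis pB : wnorm 1 p <= B.
Hypothesis e0 : 0 <= e.
Hypothesis HF : weak_limit_upto c e F (fun k => j * b k)%N.

Local Notation N p := (form c p p).

(* [n ('X^(jL) F p) - v('X^j) p] measures how far the average over [n] chosen
   powers [U^-(j b_k) p], encoded by [v / ('X^L n)], is from [F(U^-1) p]. *)
Definition mazur_error (L n : nat) (v : {poly C}) : {poly C} :=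
  n%:R *: ('X^(j * L) * (F * p)) - (v \Po 'X^j) * p.

Let B0 : 0 <= B. Proof. exact: le_trans (wnorm_ge0 _ ler01) pB. Qed.
Let c0 : 0 <= c 0.
Proof.
by have := form_ge0 1; rewrite /form size_poly1 !big_ord1 coef1 conjC1 !mul1r subrr.
Qed.

Lemma comp_Xn_wnorm (v : {poly C}) i : wnorm 1 (v \Po 'X^i) <= wnorm 1 v.
Proof.
by have := @wnorm_comp_XnZ C 1 1 i v ler01; rewrite scale1r normr1 mul1r expr1n.
Qed.

Let wnormFp : wnorm 1 (F * p) <= B.
Proof.
apply: le_trans (wnormM _ _ ler01) _; rewrite -[leRHS]mul1r.
by apply: ler_pM; rewrite ?wnorm_ge0.
Qed.

Lemma mazur_error_wnorm L n v : wnorm 1 v <= n%:R ->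
  wnorm 1 (mazur_error L n v) <= 2 * n%:R * B.
Proof.
move=> vn; apply: le_trans (wnormB _ _ ler01) _.
have -> : 2 * n%:R * B = n%:R * B + n%:R * B by ring.
apply: lerD.
  by rewrite wnormZ wnorm_XnM expr1n mul1r normr_nat ler_wpM2l.
apply: le_trans (wnormM _ _ ler01) _.
by apply: ler_pM; rewrite ?wnorm_ge0 //; apply: le_trans (comp_Xn_wnorm _ _) vn.
Qed.

(** The new term [G] is bounded and, by the weak limit, almost orthogonal to the old error moved by
    an isometry. Squared norms thus add up: they grow like [n] instead of [n ^ 2], apart from the
    term in [e]. *)
Lemma mazur_step L n v : wnorm 1 v <= n%:R ->
  exists K, forall k, (K <= k)%N -> (L <= b k)%N ->
    N (mazur_error (b k) n.+1 ('X^(b k - L) * v + 1)) <=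
      N (mazur_error L n v) + 4 * (c 0 * B ^+ 2) + 4 * (e * B ^+ 2) * n%:R.
Proof.
move=> vn; set E := mazur_error L n v.
have [K HK] := weak_limit_form p E L HF.
exists K => k Kk Lb; have {HK} Hk := HK k Kk Lb.
pose G := 'X^(j * b k) * (F * p) - p.
have -> : mazur_error (b k) n.+1 ('X^(b k - L) * v + 1) = 'X^(j * (b k - L)) * E + G.
  rewrite /mazur_error /E /G comp_polyD comp_polyM comp_Xn_poly -exprM.
  rewrite (_ : 1 \Po 'X^j = 1); last by rewrite -['X^j]mulr1 -polyC1 comp_polyC.
  rewrite -[n.+1]addn1 natrD scalerDl scale1r mulrDl mul1r mulrBr -scalerAr.
  rewrite [X in _ *: X - _ + _]mulrA -exprD -mulnDr subnK // mulrA.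
  by rewrite !mulrA opprD addrACA.
have HG : wnorm 1 G <= 2 * B.
  apply: le_trans (wnormB _ _ ler01) _.
  by rewrite wnorm_XnM expr1n mul1r mulrDl mul1r lerD.
have NG : N G <= 4 * (c 0 * B ^+ 2).
  rewrite -[leLHS]ger0_norm //; apply: le_trans (form_le cN form_ge0 _ _) _.
  have -> : 4 * (c 0 * B ^+ 2) = c 0 * ((2 * B) * (2 * B)) by ring.
  by rewrite ler_wpM2l // ler_pM ?wnorm_ge0.
have cross : `|form c G ('X^(j * (b k - L)) * E)| <= 2 * (e * B ^+ 2) * n%:R.
  rewrite /G formDl formNl.
  have -> : 'X^(j * b k) * (F * p) = 'X^(j * (b k - L)) * ('X^(j * L) * (F * p)).
    by rewrite [in RHS]mulrA -exprD -mulnDr subnK.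
  rewrite form_XnM distrC; apply: le_trans Hk _.
  have -> : 2 * (e * B ^+ 2) * n%:R = e * (B * (2 * n%:R * B)) by ring.
  by rewrite ler_wpM2l // ler_pM ?wnorm_ge0 // mazur_error_wnorm.
clearbody G E; set z := form c G _ in cross *.
rewrite formDl !(formDr cN) form_XnM -/z (form_conj cN G) -/z.
have H1 : z^* + z <= 4 * (e * B ^+ 2) * n%:R.
  have zr : z^* + z \is Num.real.
    by apply/CrealP; rewrite rmorphD /= conjCK addrC.
  apply: le_trans (real_ler_norm zr) _; apply: le_trans (ler_normD _ _) _.
  rewrite norm_conjC; apply: le_trans (lerD cross cross) _.
  by rewrite le_eqVlt; apply/orP; left; apply/eqP; ring.
rewrite -addrA [z^* + _]addrA -[leRHS]addrA lerD2l addrC.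
by rewrite lerD.
Qed.

End MazurStep.

Section Mazur.
Variables (C : numClosedFieldType) (c1 c2 : int -> C).
Hypothesis archiC : forall x : C, 0 <= x -> exists n, x <= n%:R.
Hypothesis c1N : forall n, c1 (- n) = (c1 n)^*.
Hypothesis c2N : forall n, c2 (- n) = (c2 n)^*.
Hypothesis form1_ge0 : forall p, 0 <= form c1 p p.
Hypothesis form2_ge0 : forall p, 0 <= form c2 p p.
Variables (j1 j2 : nat) (b : nat -> nat).
Hypothesis bk : forall k, (k <= b k)%N.

Let c0_ge0 (c : int -> C) : (forall p, 0 <= form c p p) -> 0 <= c 0.
Proof.
by move=> /(_ 1); rewrite /form size_poly1 !big_ord1 coef1 conjC1 !mul1r subrr.
Qed.

(** The tolerance [e] precedes the polynomials because these will be truncations chosen after it. *)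
Lemma mazur (B d : C) : 0 <= B -> 0 < d -> exists e : C, 0 < e /\
  forall F1 F2 p1 p2 : {poly C}, wnorm 1 F1 <= 1 -> wnorm 1 F2 <= 1 ->
  wnorm 1 p1 <= B -> wnorm 1 p2 <= B ->
  weak_limit_upto c1 e F1 (fun k => j1 * b k)%N ->
  weak_limit_upto c2 e F2 (fun k => j2 * b k)%N ->
  exists L v, [/\ wnorm 1 v <= 1,
    form c1 ('X^(j1 * L) * (F1 * p1) - (v \Po 'X^j1) * p1)
            ('X^(j1 * L) * (F1 * p1) - (v \Po 'X^j1) * p1) <= d &
    form c2 ('X^(j2 * L) * (F2 * p2) - (v \Po 'X^j2) * p2)
            ('X^(j2 * L) * (F2 * p2) - (v \Po 'X^j2) * p2) <= d].
Proof.
(* After division by [n ^ 2] the terms in [e] leave [2 * (e * B ^+ 2)], which this [D] keeps below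
   [d / 2]. *)
move=> B0 d0; pose D := 2 * B ^+ 2 + 1.
have D0 : 0 < D by rewrite ltr_wpDl // mulr_ge0 // exprn_ge0.
exists (d / 2 / D); split; first by rewrite !divr_gt0.
set e := d / 2 / D => F1 F2 p1 p2 F11 F21 pB1 pB2 W1 W2.
have e0 : 0 <= e by rewrite !divr_ge0 // ltW.
pose A (c : int -> C) := 4 * (c 0 * B ^+ 2).
have A0 c : (forall p, 0 <= form c p p) -> 0 <= A c.
  move=> /c0_ge0 H; apply: mulr_ge0 => //; apply: mulr_ge0 => //.
  exact: exprn_ge0.
pose bnd (c : int -> C) n : C := A c * n%:R + 2 * (e * B ^+ 2) * n%:R ^+ 2.
have bndS c n : bnd c n + A c + 4 * (e * B ^+ 2) * n%:R <= bnd c n.+1.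
  rewrite /bnd -[n.+1]addn1 natrD -subr_ge0.
  have -> : A c * (n%:R + 1) + 2 * (e * B ^+ 2) * (n%:R + 1) ^+ 2 -
    (A c * n%:R + 2 * (e * B ^+ 2) * n%:R ^+ 2 + A c + 4 * (e * B ^+ 2) * n%:R) =
    2 * (e * B ^+ 2) by ring.
  by apply: mulr_ge0 => //; apply: mulr_ge0 => //; apply: exprn_ge0.
have ind n : exists L v, [/\ wnorm 1 v <= n%:R,
   form c1 (mazur_error F1 j1 p1 L n v) (mazur_error F1 j1 p1 L n v) <= bnd c1 n &
   form c2 (mazur_error F2 j2 p2 L n v) (mazur_error F2 j2 p2 L n v) <= bnd c2 n].
  elim: n => [|n [L [v [vn H1 H2]]]].
    exists 0%N, 0; rewrite wnorm0 /mazur_error !scale0r !comp_poly0 !mul0r !subr0 !form0l.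
    by rewrite /bnd !mulr0 expr0n /= !mulr0 addr0; split.
  have [K1 S1] := mazur_step c1N form1_ge0 F11 pB1 e0 W1 L vn.
  have [K2 S2] := mazur_step c2N form2_ge0 F21 pB2 e0 W2 L vn.
  (* One index that suits both forms, with [b k] at least the previous exponent [L]. *)
  pose k := maxn L (maxn K1 K2).
  have Lk : (L <= b k)%N by apply: leq_trans (leq_maxl _ _) (bk k).
  exists (b k), ('X^(b k - L) * v + 1); split.
  - apply: le_trans (wnormD _ _ ler01) _.
    by rewrite wnorm_XnM expr1n mul1r wnorm1 -addn1 natrD lerD.
  - have K1k : (K1 <= k)%N by rewrite !leq_max leqnn orbT.
    apply: le_trans (S1 k K1k Lk) _.
    by apply: le_trans (bndS c1 n); rewrite !lerD2r.
  - have K2k : (K2 <= k)%N by rewrite !leq_max leqnn !orbT.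
    apply: le_trans (S2 k K2k Lk) _.
    by apply: le_trans (bndS c2 n); rewrite !lerD2r.
have [n Hn] : exists n, (A c1 + A c2) / (d / 2) <= n%:R.
  by apply: archiC; rewrite divr_ge0 ?addr_ge0 ?A0 // ltW // divr_gt0.
have [L [v [vn H1 H2]]] := ind n.+1.
have n0 : n.+1%:R != 0 :> C by rewrite pnatr_eq0.
have np : 0 < n.+1%:R :> C by rewrite ltr0n.
have EE F p j : 'X^(j * L) * (F * p) - ((n.+1%:R^-1 *: v) \Po 'X^j) * p =
    n.+1%:R^-1 *: mazur_error F j p L n.+1 v.
  by rewrite /mazur_error scalerBr scalerA mulVf // scale1r comp_polyZ scalerAl.
have fin c : (forall p, 0 <= form c p p) -> (forall n, c (- n) = (c n)^*) ->
    A c / (d / 2) <= n%:R ->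
    forall E, form c E E <= bnd c n.+1 ->
    form c (n.+1%:R^-1 *: E) (n.+1%:R^-1 *: E) <= d.
  move=> cge cN cn E HE.
  rewrite formZl (formZr cN) conj_Creal ?ger0_real ?invr_ge0 // mulrA.
  rewrite -invfM mulrC ler_pdivrMr ?mulr_gt0 //; apply: le_trans HE _.
  rewrite /bnd.
  have H3 : A c * n.+1%:R <= d / 2 * (n.+1%:R * n.+1%:R).
    rewrite mulrA ler_wpM2r // mulrC -ler_pdivrMr ?divr_gt0 //.
    by apply: le_trans cn _; rewrite ler_nat.
  have H4 : 2 * (e * B ^+ 2) * n.+1%:R ^+ 2 <= d / 2 * (n.+1%:R * n.+1%:R).
    rewrite -expr2 ler_wpM2r ?exprn_ge0 //.
    have -> : 2 * (e * B ^+ 2) = d / 2 * (2 * B ^+ 2) / D by rewrite /e; ring.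
    by rewrite ler_pdivrMr // ler_wpM2l ?divr_ge0 ?(ltW d0) // /D lerDl.
  apply: le_trans (lerD H3 H4) _.
  by rewrite -mulrDl -splitr.
have Hsum c : (c = c1) \/ (c = c2) -> A c / (d / 2) <= n%:R.
  move=> Hc; apply: le_trans Hn; apply: ler_wpM2r.
    by rewrite invr_ge0 ltW // divr_gt0.
  by case: Hc => ->; rewrite ?lerDl ?lerDr; apply: A0.
exists L, (n.+1%:R^-1 *: v); split.
- by rewrite wnormZ normfV normr_nat mulrC ler_pdivrMr // mul1r.
- by rewrite EE; apply: fin => //; apply: Hsum; left.
- by rewrite EE; apply: fin => //; apply: Hsum; right.
Qed.

End Mazur.

(** * Power series on the circle and resultants *)

Section LimitRing.
Variable C : numClosedFieldType.

(* Such a sequence stands for an absolutely convergent power series. *)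
Definition limitseq_pred : {pred nat -> {poly C}} := fun a =>
  `[< (exists B, forall n, wnorm 1 (a n) <= B) /\
      (forall w : C, `|w| = 1 -> cvg ((a n).[w] @[n --> \oo])) >].

Lemma limitseqP (a : nat -> {poly C}) :
  reflect ((exists B, forall n, wnorm 1 (a n) <= B) /\
      (forall w : C, `|w| = 1 -> cvg ((a n).[w] @[n --> \oo])))
    (a \in limitseq_pred).
Proof. exact: asboolP. Qed.

Lemma limitseq_subring : subring_closed limitseq_pred.
Proof.
split.
- apply/limitseqP; split; first by exists 1 => n; rewrite wnorm1.
  by move=> w _; under eq_fun => n do rewrite hornerC; apply: is_cvg_cst.
- move=> a a' /limitseqP[[B HB] Ha] /limitseqP[[B' HB'] Ha']; apply/limitseqP; split.
    exists (B + B') => n; apply: le_trans (wnormB _ _ ler01) _; exact: lerD.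
  move=> w w1; under eq_fun => n do rewrite !fctE hornerD hornerN.
  by apply: is_cvgB; [apply: Ha | apply: Ha'].
- move=> a a' /limitseqP[[B HB] Ha] /limitseqP[[B' HB'] Ha']; apply/limitseqP; split.
    exists (B * B') => n; apply: le_trans (wnormM _ _ ler01) _.
    by apply: ler_pM; rewrite ?wnorm_ge0.
  move=> w w1; under eq_fun => n do rewrite !fctE hornerM.
  by apply: is_cvgM; [apply: Ha | apply: Ha'].
Qed.

HB.instance Definition _ := GRing.isSubringClosed.Build _ limitseq_pred limitseq_subring.

Definition limitseq := {a | a \in limitseq_pred}.
HB.instance Definition _ := Choice.on limitseq.
HB.instance Definition _ := SubType.on limitseq.
HB.instance Definition _ := [SubChoice_isSubComNzRing of limitseq by <:].

Definition circle := {w : C | `|w| == 1}.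
HB.instance Definition _ := SubType.on circle.
HB.instance Definition _ := Choice.on circle.

Lemma circleP (w : circle) : `|val w| = 1. Proof. exact/eqP/(valP w). Qed.

Definition eval_lim (w : circle) (a : limitseq) : C := lim ((val a n).[val w] @[n --> \oo]).

Lemma eval_lim_cvg (w : circle) (a : limitseq) :
  (val a n).[val w] @[n --> \oo] --> eval_lim w a.
Proof. by case/limitseqP: (valP a) => _; apply; apply: circleP. Qed.

Lemma eval_lim_is_cvg (w : circle) (a : limitseq) : cvg ((val a n).[val w] @[n --> \oo]).
Proof. by apply/cvg_ex; exists (eval_lim w a); apply: eval_lim_cvg. Qed.

Lemma eval_limE (w : circle) (a : limitseq) (l : C) :
  (val a n).[val w] @[n --> \oo] --> l -> eval_lim w a = l.
Proof. by move=> H; apply: cvg_lim H. Qed.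

Lemma eval_lim_is_zmod w : zmod_morphism (eval_lim w).
Proof.
move=> a a'; apply: eval_limE; rewrite raddfB /=.
under eq_fun => n do rewrite !fctE hornerD hornerN.
by apply: cvgB; apply: eval_lim_cvg.
Qed.
HB.instance Definition _ w := GRing.isZmodMorphism.Build _ _ (eval_lim w) (eval_lim_is_zmod w).

Lemma eval_lim_is_monoid w : monoid_morphism (eval_lim w).
Proof.
split.
  apply: eval_limE; rewrite rmorph1 /=.
  by under eq_fun => n do rewrite hornerC; apply: cvg_cst.
move=> a a'; apply: eval_limE; rewrite rmorphM /=.
under eq_fun => n do rewrite !fctE hornerM.
by apply: cvgM; apply: eval_lim_cvg.
Qed.
HB.instance Definition _ w := GRing.isMonoidMorphism.Build _ _ (eval_lim w) (eval_lim_is_monoid w).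

Lemma circle_exp_subproof (u w : circle) j : `|val u * val w ^+ j| == 1.
Proof. by rewrite normrM normrX !circleP expr1n mulr1. Qed.
Definition circle_exp (u w : circle) j : circle := exist (fun z => `|z| == 1) _ (circle_exp_subproof u w j).

Lemma subst_subproof (u : circle) j (a : limitseq) :
  (fun n => val a n \Po (val u *: 'X^j)) \in limitseq_pred.
Proof.
case/limitseqP: (valP a) => [[B HB] Ha]; apply/limitseqP; split.
  exists B => n; apply: le_trans (wnorm_comp_XnZ _ _ _ ler01) _.
  by rewrite circleP expr1n mulr1.
move=> w /eqP w1; under eq_fun => n do rewrite horner_comp hornerZ hornerXn.
apply/cvg_ex; exists (eval_lim (circle_exp u (exist (fun z => `|z| == 1) w w1) j) a).
exact: eval_lim_cvg.
Qed.

(** The series [a(u z^j)]: a rotation for [j = 1], the passage from [w] to [z^j] for [u = 1]. *)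
Definition subst (u : circle) j (a : limitseq) : limitseq :=
  exist (fun a => a \in limitseq_pred) _ (subst_subproof u j a).

Lemma subst_is_zmod u j : zmod_morphism (subst u j).
Proof. by move=> a a'; apply/val_inj/funext => n /=; rewrite !fctE comp_polyB. Qed.
HB.instance Definition _ u j := GRing.isZmodMorphism.Build _ _ (subst u j) (subst_is_zmod u j).

Lemma subst_is_monoid u j : monoid_morphism (subst u j).
Proof.
split; first by apply/val_inj/funext => n /=; exact: (rmorph1 (comp_poly _)).
by move=> a a'; apply/val_inj/funext => n /=; rewrite !fctE comp_polyM.
Qed.
HB.instance Definition _ u j := GRing.isMonoidMorphism.Build _ _ (subst u j) (subst_is_monoid u j).

Lemma eval_subst w u j a : eval_lim w (subst u j a) = eval_lim (circle_exp u w j) a.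
Proof.
apply: eval_limE => /=; under eq_fun => n do rewrite horner_comp hornerZ hornerXn.
exact: eval_lim_cvg.
Qed.

Definition circle1 : circle := exist (fun z => `|z| == 1) 1 (introT eqP (normr1 C)).

Definition decimate_poly j (p : {poly C}) : {poly C} := \poly_(i < size p) p`_(j * i).

Lemma coef_decimate_poly j p i : (0 < j)%N -> (decimate_poly j p)`_i = p`_(j * i).
Proof.
move=> j0; rewrite coef_poly; case: ltnP => // Hi.
by rewrite nth_default // (leq_trans Hi) // leq_pmull.
Qed.

Lemma wnorm_decimate_poly j p : (0 < j)%N -> wnorm 1 (decimate_poly j p) <= wnorm 1 p.
Proof.
move=> j0; rewrite (@wnormE _ (size p)) ?size_poly // (@wnormE _ (j * size p)) ?leq_pmull //.
under eq_bigr => i _ do rewrite expr1n mulr1 coef_decimate_poly //.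
under [leRHS]eq_bigr => i _ do rewrite expr1n mulr1.
rewrite -(big_mkord xpredT (fun i => `|p`_i|)).
elim: (size p) => [|n IH]; first by rewrite big_ord0 muln0 big_nil.
rewrite big_ord_recr /= mulnS (big_cat_nat (leq0n (j * n)) (leq_addl _ _)) /= lerD //.
rewrite big_ltn; last by rewrite -[X in (X < _)%N]add0n ltn_add2r.
by rewrite lerDl sumr_ge0.
Qed.

(** Membership is proved only where [a] is invariant under rotation by a primitive [j]-th root of
    unity; [insubd] makes the definition total. *)
Definition decimate j (a : limitseq) : limitseq :=
  insubd (0 : limitseq) (fun n => decimate_poly j (val a n)).

Lemma circle_root j (w : circle) : (0 < j)%N -> exists v : circle, val v ^+ j = val w.
Proof.
move=> j0; have Hv : `|j.-root (val w)| == 1.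
  by rewrite -(pexpr_eq1 (n := j)) // -normrX rootCK // circleP.
by exists (exist (fun z => `|z| == 1) _ Hv); rewrite /= rootCK.
Qed.

(** Invariance forces [a_i z^i = a_i], so only exponents divisible by [j] survive. Convergence at
    [w] is read off at a [j]-th root of [w]. *)
Lemma subst_decimate j (z : circle) (a : limitseq) :
  j.-primitive_root (val z) -> subst z 1 a = a -> subst circle1 j (decimate j a) = a.
Proof.
move=> Hz Ha; have j0 := prim_order_gt0 Hz.
have E n : decimate_poly j (val a n) \Po 'X^j = val a n.
  apply/polyP => i; rewrite coef_comp_poly_Xn //.
  case: ifP => [/divnK E|Hi]; first by rewrite coef_decimate_poly // mulnC E.
  have /(congr1 (fun b : limitseq => (val b n)`_i)) /= := Ha.
  rewrite comp_polyE; under eq_bigr => k _ do rewrite exprZn -exprM mul1n scalerA.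
  rewrite -(poly_def _ (fun k => (sval a n)`_k * sval z ^+ k)) coef_poly; case: ltnP => [_|Hs _]; last by rewrite nth_default.
  move/eqP; rewrite -subr_eq0 -{2}[_`_i]mulr1 -mulrBr mulf_eq0 subr_eq0.
  by rewrite -(prim_order_dvd Hz) Hi orbF => /eqP.
have Hin : (fun n => decimate_poly j (val a n)) \in limitseq_pred.
  case/limitseqP: (valP a) => [[B HB] _]; apply/limitseqP; split.
    by exists B => n; apply: le_trans (wnorm_decimate_poly _ j0) _.
  move=> w w1.
  have [v /= Hv] := circle_root (exist (fun z => `|z| == 1) w (introT eqP w1)) j0.
  have -> : (fun n => (decimate_poly j (val a n)).[w]) = fun n => (val a n).[val v].
    by apply/funext => n; rewrite -[in RHS]E horner_comp hornerXn Hv.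
  exact: eval_lim_is_cvg.
apply/val_inj/funext => n /=; rewrite scale1r insubdK //; exact: E.
Qed.

End LimitRing.

(** The leading coefficients must survive [f] for both Sylvester matrices to have the same size. *)
Lemma map_resultant_ring (A B : comNzRingType) (f : {rmorphism A -> B}) (p q : {poly A}) :
  f (lead_coef p) != 0 -> f (lead_coef q) != 0 ->
  f (resultant p q) = resultant (map_poly f p) (map_poly f q).
Proof.
move=> fp fq; rewrite /resultant /Sylvester_mx !size_map_poly_id0 //.
rewrite -det_map_mx map_col_mx; congr (\det (col_mx _ _));
  by apply: map_lin1_mx => v; rewrite map_poly_rV rmorphM /= map_rVpoly.
Qed.

Lemma horner_prod_XsubC (A : comNzRingType) (g : nat -> A) (j : nat) (x : A) :
  g 0%N = x -> (0 < j)%N -> (\prod_(k < j) ('X - (g k)%:P)).[x] = 0.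
Proof.
by move=> <-; case: j => // j _; rewrite horner_prod big_ord_recl hornerXsubC subrr mul0r.
Qed.

Lemma horner_map_cons (A B : comNzRingType) (f : {rmorphism A -> B}) (q : {poly A}) k x :
  (map_poly f (q * 'X + k%:P)).[x] = (map_poly f q).[x] * x + f k.
Proof. by rewrite rmorphD rmorphM /= map_polyX map_polyC hornerMXaddC. Qed.

Lemma prod_cyclic_shift (A : comNzRingType) (h : nat -> A) (j : nat) :
  h j = h 0%N -> \prod_(k < j) h k.+1 = \prod_(k < j) h k.
Proof.
case: j => [|j] E; first by rewrite !big_ord0.
by rewrite big_ord_recr /= E [RHS]big_ord_recl mulrC; congr (_ * _); apply: eq_bigr.
Qed.

Section NormPoly.
Variable C : numClosedFieldType.
Local Notation K := (limitseq C).
Local Notation subXn j := (subst (circle1 C) j).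

Lemma subst1 (a : K) : subst (circle1 C) 1 a = a.
Proof. by apply/val_inj/funext => n /=; rewrite scale1r comp_polyXr. Qed.

Lemma subst_subst u v (a : K) :
  subst u 1 (subst v 1 a) = subst (circle_exp u v 1) 1 a.
Proof.
apply/val_inj/funext => n /=; rewrite -comp_polyA; congr (_ \Po _).
by rewrite !expr1 comp_polyZ comp_polyX scalerA mulrC.
Qed.

Fixpoint circle_pow (z : circle C) k : circle C :=
  if k is k'.+1 then circle_exp z (circle_pow z k') 1 else circle1 C.

Lemma circle_powE z k : val (circle_pow z k) = val z ^+ k.
Proof. by elim: k => [|k IH] //=; rewrite expr1 exprS -IH. Qed.

(* The product of the ['X - F(zeta z)] over the j-th roots of unity [zeta]: its
   coefficients are invariant under rotation, hence are series in 'X^j. *)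
Lemma norm_poly_exists (j : nat) (F : K) : (0 < j)%N ->
  exists chi : {poly K}, [/\ chi \is monic, size chi = j.+1,
    root (map_poly (subXn j) chi) F &
    forall w x, root (map_poly (eval_lim w) chi) x ->
      exists z : circle C, val z ^+ j = val w /\ eval_lim z F = x].
Proof.
move=> j0; have [z0 Hz0] := prim_root_exists C j0.
have z1 : `|z0| == 1.
  by rewrite -(pexpr_eq1 (n := j)) // -normrX (prim_expr_order Hz0) normr1.
pose z : circle C := exist (fun z => `|z| == 1) z0 z1.
pose G k := subst (circle_pow z k) 1 F.
have G0 : G 0%N = F by exact: subst1.
have Gj : G j = F.
  rewrite /G -[RHS]subst1; congr (subst _ _ _); apply: val_inj.
  by rewrite circle_powE /= (prim_expr_order Hz0).
have GS k : subst z 1 (G k) = G k.+1 by rewrite /G subst_subst.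
pose Pi : {poly K} := \prod_(k < j) ('X - (G k)%:P).
have szPi : size Pi = j.+1 by rewrite size_prod_XsubC /index_enum -enumT size_enum_ord.
have monPi : Pi \is monic by exact: monic_prod_XsubC.
have invPi : map_poly (subst z 1) Pi = Pi.
  rewrite rmorph_prod /=.
  under eq_bigr => k _ do rewrite map_polyXsubC /= GS.
  by apply: (@prod_cyclic_shift _ (fun k => 'X - (G k)%:P)); rewrite G0 Gj.
have invc i : subst z 1 Pi`_i = Pi`_i by rewrite -{2}invPi coef_map.
pose chi : {poly K} := \poly_(i < j.+1) decimate j Pi`_i.
have mapchi : map_poly (subXn j) chi = Pi.
  apply/polyP => i; rewrite coef_map coef_poly /=; case: ltnP => Hi.
    exact: (@subst_decimate C j z _ Hz0 (invc i)).
  by rewrite raddf0 nth_default // szPi.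
have Pij : Pi`_j = 1 by move/monicP: monPi; rewrite /lead_coef szPi.
have subst_inj : injective (subXn j).
  move=> a a' /(congr1 val) /= E; apply/val_inj/funext => n.
  have /= := congr1 (@^~ n) E; rewrite !scale1r => En; apply/polyP => i.
  have := congr1 (fun p : {poly C} => p`_(i * j)) En.
  by rewrite /= !coef_comp_poly_Xn // dvdn_mull // mulnK.
have chij : chi`_j = 1.
  by apply: subst_inj; rewrite -coef_map mapchi Pij rmorph1.
have szchi : size chi = j.+1.
  apply/eqP; rewrite eqn_leq size_poly /= ltnNge; apply/negP => H.
  by move/eqP: chij; rewrite nth_default // eq_sym oner_eq0.
exists chi; split=> //.
- by rewrite monicE /lead_coef szchi chij.
- rewrite mapchi; apply/rootP; exact: (horner_prod_XsubC G0 j0).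
move=> w x; have [v Hv] := circle_root w j0.
have -> : map_poly (eval_lim w) chi = \prod_(k < j) ('X - (eval_lim v (G k))%:P).
  have -> : map_poly (eval_lim w) chi = map_poly (eval_lim v) Pi.
    rewrite -mapchi; apply/polyP => i; rewrite !coef_map /= eval_subst.
    by congr (eval_lim _ _); apply: val_inj; rewrite /= mul1r Hv.
  by rewrite rmorph_prod /=; apply: eq_bigr => k _; rewrite map_polyXsubC.
rewrite -(big_map (fun k : 'I_j => eval_lim v (G k)) xpredT (fun y => 'X - y%:P)).
rewrite root_prod_XsubC => /mapP[k _ ->].
exists (circle_exp (circle_pow z k) v 1); split; last by rewrite /G eval_subst.
by rewrite /= circle_powE expr1 exprMn -exprM mulnC exprM (prim_expr_order Hz0) expr1n mul1r.
Qed.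

End NormPoly.

(** * Joint approximation and the resultant *)

Section Approximation.
Variables (C : numClosedFieldType) (c1 c2 : int -> C).
Hypothesis archiC : forall x : C, 0 <= x -> exists n, x <= n%:R.
Hypothesis c1N : forall n, c1 (- n) = (c1 n)^*.
Hypothesis c2N : forall n, c2 (- n) = (c2 n)^*.
Hypothesis form1_ge0 : forall p, 0 <= form c1 p p.
Hypothesis form2_ge0 : forall p, 0 <= form c2 p p.
Variables (j1 j2 : nat) (b : nat -> nat).
Hypothesis j10 : (0 < j1)%N.
Hypothesis j20 : (0 < j2)%N.
Hypothesis bk : forall k, (k <= b k)%N.
Local Notation K := (limitseq C).
Local Notation N1 p := (form c1 p p).
Local Notation N2 p := (form c2 p p).
Local Notation subXn j := (subst (circle1 C) j).
Variables (F1 F2 : K).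
Hypothesis F1_le1 : forall M, wnorm 1 (val F1 M) <= 1.
Hypothesis F2_le1 : forall M, wnorm 1 (val F2 M) <= 1.
Hypothesis weak1 : forall e : C, 0 < e -> exists M0, forall M, (M0 <= M)%N ->
  weak_limit_upto c1 e (val F1 M) (fun k => j1 * b k)%N.
Hypothesis weak2 : forall e : C, 0 < e -> exists M0, forall M, (M0 <= M)%N ->
  weak_limit_upto c2 e (val F2 M) (fun k => j2 * b k)%N.

(** Up to the isometry ['X^(j * L)], one polynomial [u], evaluated at [U^-j1] on the first side and
    at [U^-j2] on the second, is near both [a1(U^-1)] and [a2(U^-1)]. *)
Definition approximable (a1 a2 : K) := forall d : C, 0 < d ->
  exists M0, forall M, (M0 <= M)%N -> exists L (u : {poly C}),
    N1 ('X^(j1 * L) * val a1 M - (u \Po 'X^j1)) <= d /\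
    N2 ('X^(j2 * L) * val a2 M - (u \Po 'X^j2)) <= d.

Lemma approximable1 : approximable 1 1.
Proof.
move=> d d0; exists 0%N => M _; exists 0%N, 1.
have E j : 'X^(j * 0) * val (1 : K) M - (1 \Po 'X^j) = 0.
  by rewrite muln0 expr0 mul1r (rmorph1 (comp_poly _)); apply: subrr.
by rewrite !E !form0l (ltW d0).
Qed.

Lemma form_quasi c (d : C) (x y : {poly C}) :
  (forall n, c (- n) = (c n)^*) -> (forall p, 0 <= form c p p) ->
  form c x x <= d -> form c y y <= d -> form c (x + y) (x + y) <= 4 * d.
Proof.
move=> cN c0 Hx Hy; apply: le_trans (formD_le cN c0 x y) _.
have -> : 4 * d = 2 * (d + d) by ring.
by rewrite ler_wpM2l // lerD.
Qed.

Lemma approximableD a1 a2 a1' a2' :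
  approximable a1 a2 -> approximable a1' a2' -> approximable (a1 + a1') (a2 + a2').
Proof.
move=> H H' d d0; have d4 : 0 < d / 4 by rewrite divr_gt0.
have [M0 HM] := H _ d4; have [M0' HM'] := H' _ d4.
exists (maxn M0 M0') => M; rewrite geq_max => /andP[/HM [L [u [H1 H2]]] /HM' [L' [u' [H1' H2']]]].
exists (L + L')%N, ('X^L' * u + 'X^L * u').
have E j (a a' : K) : 'X^(j * (L + L')) * val (a + a') M -
    (('X^L' * u + 'X^L * u') \Po 'X^j) =
  'X^(j * L') * ('X^(j * L) * val a M - (u \Po 'X^j)) +
  'X^(j * L) * ('X^(j * L') * val a' M - (u' \Po 'X^j)).
  rewrite raddfD /= fctE comp_polyD !comp_polyM !comp_Xn_poly -!exprM mulnDr exprD.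
  ring.
have Ed : d = 4 * (d / 4) by rewrite mulrC divfK ?pnatr_eq0.
by rewrite !E; split; rewrite [leRHS]Ed; apply: form_quasi; rewrite ?form_XnM.
Qed.

(** A series [k] in [w] becomes [k(z^j1)] on one side and [k(z^j2)] on the other, which is exactly
    what multiplying [u] by a truncation of [k] produces. *)
Lemma approximable_subXn k a1 a2 :
  approximable a1 a2 -> approximable (subXn j1 k * a1) (subXn j2 k * a2).
Proof.
move=> H d d0; case/limitseqP: (valP k) => [[B HB] _].
have B0 : 0 <= B := le_trans (wnorm_ge0 _ ler01) (HB 0%N).
have BB : 0 < B ^+ 2 + 1 by rewrite ltr_wpDl ?exprn_ge0.
have [M0 HM] := H _ (divr_gt0 d0 BB).
exists M0 => M /HM [L [u [H1 H2]]]; exists L, (val k M * u).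
have E j (a : K) : 'X^(j * L) * val (subXn j k * a) M - ((val k M * u) \Po 'X^j) =
  (val k M \Po 'X^j) * ('X^(j * L) * val a M - (u \Po 'X^j)).
  by rewrite rmorphM /= fctE /= scale1r comp_polyM mulrBr; ring.
have bnd c j x : (forall n, c (- n) = (c n)^*) -> (forall p, 0 <= form c p p) ->
    form c x x <= d / (B ^+ 2 + 1) ->
    form c ((val k M \Po 'X^j) * x) ((val k M \Po 'X^j) * x) <= d.
  move=> cN c0 Hx; apply: le_trans (formM_le cN c0 _ _) _.
  apply: (@le_trans _ _ ((B ^+ 2 + 1) * (d / (B ^+ 2 + 1)))); last first.
    by rewrite mulrC divfK // gt_eqF.
  apply: ler_pM => //; first by rewrite exprn_ge0 // wnorm_ge0.
  apply: (@le_trans _ _ (B ^+ 2)); last by rewrite lerDl.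
  rewrite lerXn2r ?nnegrE ?wnorm_ge0 //.
  exact: le_trans (comp_Xn_wnorm _ _) (HB M).
by rewrite !E; split; apply: bnd.
Qed.

(** [u] is multiplied by the average [v] that stands for both weak limits; [wnorm 1 v <= 1] keeps
    the earlier error from growing. *)
Lemma approximable_weak a1 a2 :
  approximable a1 a2 -> approximable (F1 * a1) (F2 * a2).
Proof.
move=> H d d0; have d4 : 0 < d / 4 by rewrite divr_gt0.
case/limitseqP: (valP a1) => [[B1 HB1] _]; case/limitseqP: (valP a2) => [[B2 HB2] _].
have B10 : 0 <= B1 := le_trans (wnorm_ge0 _ ler01) (HB1 0%N).
have B20 : 0 <= B2 := le_trans (wnorm_ge0 _ ler01) (HB2 0%N).
have [e [e0 He]] := mazur archiC c1N c2N form1_ge0 form2_ge0 j1 j2 bk (addr_ge0 B10 B20) d4.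
have [M1 W1] := weak1 e0; have [M2 W2] := weak2 e0.
have [M0 HM] := H _ d4.
exists (maxn M0 (maxn M1 M2)) => M; rewrite !geq_max => /and3P[/HM [L [u [H1 H2]]] /W1 w1 /W2 w2].
have [||L' [v [v1 G1 G2]]] := He _ _ (val a1 M) (val a2 M) (F1_le1 M) (F2_le1 M) _ _ w1 w2.
- by apply: le_trans (HB1 M) _; rewrite lerDl.
- by apply: le_trans (HB2 M) _; rewrite lerDr.
exists (L + L')%N, (u * v).
have E j (F a : K) : 'X^(j * (L + L')) * val (F * a) M - ((u * v) \Po 'X^j) =
  'X^(j * L) * ('X^(j * L') * (val F M * val a M) - (v \Po 'X^j) * val a M) +
  (v \Po 'X^j) * ('X^(j * L) * val a M - (u \Po 'X^j)).
  rewrite rmorphM /= fctE comp_polyM mulnDr exprD; ring.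
have bnd c j x : (forall n, c (- n) = (c n)^*) -> (forall p, 0 <= form c p p) ->
    form c x x <= d / 4 -> form c ((v \Po 'X^j) * x) ((v \Po 'X^j) * x) <= d / 4.
  move=> cN c0 Hx; apply: le_trans Hx; apply: le_trans (formM_le cN c0 _ _) _.
  rewrite ler_piMl // exprn_ile1 ?wnorm_ge0 //.
  exact: le_trans (comp_Xn_wnorm _ _) v1.
have Ed : d = 4 * (d / 4) by rewrite mulrC divfK ?pnatr_eq0.
rewrite !E; split; rewrite [leRHS]Ed; apply: form_quasi => //;
  by rewrite ?form_XnM //; apply: bnd.
Qed.

Lemma approximable_poly (q : {poly K}) :
  approximable (map_poly (subXn j1) q).[F1] (map_poly (subXn j2) q).[F2].
Proof.
elim/poly_ind: q => [|q k IH].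
  have := approximable_subXn 0 approximable1.
  by rewrite !map_poly0 !horner0 !rmorph0 !mul0r.
rewrite !horner_map_cons [_ * F1]mulrC [_ * F2]mulrC.
apply: approximableD; first exact: approximable_weak.
by have := approximable_subXn k approximable1; rewrite !mulr1.
Qed.

Theorem resultant_approximable : exists res : K,
  (forall d : C, 0 < d -> exists M0, forall M, (M0 <= M)%N -> exists L (u : {poly C}),
     N1 (('X^L * val res M - u) \Po 'X^j1) <= d /\ N2 (u \Po 'X^j2) <= d) /\
  (forall w, eval_lim w res = 0 -> exists z1 z2 : circle C,
     [/\ val z1 ^+ j1 = val w, val z2 ^+ j2 = val w & eval_lim z1 F1 = eval_lim z2 F2]).
Proof.
have [chi1 [mon1 sz1 root1 ev1]] := norm_poly_exists F1 j10.
have [chi2 [mon2 sz2 root2 ev2]] := norm_poly_exists F2 j20.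
(* [res = u chi1 + v chi2], where [chi1] and [chi2] vanish at [F1] and [F2] after substitution.
   Hence [v * chi2] evaluates to [res] on the first side and to 0 on the second. *)
have [||[u v] _ /= Euv] := @resultant_in_ideal _ chi1 chi2; rewrite ?sz1 ?sz2 //.
exists (resultant chi1 chi2); set res := resultant chi1 chi2 in Euv *; split.
  have Ev : v * chi2 = res%:P - u * chi1 by rewrite Euv addrC addKr.
  have := approximable_poly (v * chi2).
  have -> : (map_poly (subXn j2) (v * chi2)).[F2] = 0.
    by rewrite rmorphM hornerM (rootP root2) mulr0.
  have -> : (map_poly (subXn j1) (v * chi2)).[F1] = subXn j1 res.
    by rewrite Ev rmorphB rmorphM /= hornerD hornerN hornerM (rootP root1) mulr0 subr0 map_polyC hornerC.
  move=> H d /H [M0 HM]; exists M0 => M /HM [L [w [H1 H2]]]; exists L, w; split.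
    by move: H1; rewrite /= scale1r comp_polyB comp_polyM comp_Xn_poly -exprM.
  have : N2 ('X^(j2 * L) * 0 - (w \Po 'X^j2)) <= d := H2.
  by rewrite mulr0 sub0r formNl (formNr c2N) opprK.
move=> w Hw.
have lead1 p : p \is monic -> eval_lim w (lead_coef p) != 0.
  by move/monicP ->; rewrite rmorph1 oner_eq0.
have := map_resultant_ring (lead1 _ mon1) (lead1 _ mon2).
rewrite -/res [LHS]Hw => /esym/eqP; rewrite resultant_eq0 => Hg.
have [x Hx] : exists x, root (gcdp (map_poly (eval_lim w) chi1) (map_poly (eval_lim w) chi2)) x.
  by apply/closed_rootP; rewrite neq_ltn Hg orbT.
move: Hx; rewrite root_gcd => /andP[/ev1 [z1 [E1 <-]] /ev2 [z2 [E2 E]]].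
by exists z1, z2; rewrite E.
Qed.

End Approximation.

(** * Laws of the spacers *)

Lemma sum_shift_le (C : numDomainType) (f : nat -> C) u m n :
  (forall i, 0 <= f i) -> (u + m <= n)%N -> \sum_(i < m) f (i + u)%N <= \sum_(i < n) f i.
Proof.
move=> f0 /subnKC <-; rewrite !big_split_ord /= -addrA -[leLHS]add0r lerD ?sumr_ge0 //.
rewrite -[leLHS]addr0 lerD ?sumr_ge0 //.
by apply: ler_sum => i _; rewrite addnC.
Qed.

Section PassPolynomials.
Variables (C : numClosedFieldType) (P : nat -> nat) (S : nat -> nat -> nat) (t : nat).
Hypothesis P2 : forall l, (1 < P l)%N.

Definition pass_count M r : nat :=
  (\sum_(i < copies P 0 M - t) (gapsum P S 0 i t == r))%N.

(* The law of the number of spacers met while crossing [t] copies of tower 0,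
   starting from a uniformly chosen copy inside tower [M]. *)
Definition pass_poly M : {poly C} :=
  (copies P 0 M)%:R^-1 *: \sum_(i < copies P 0 M - t) 'X^(gapsum P S 0 i t).

Let q0 M : 0 < (copies P 0 M)%:R :> C. Proof. by rewrite ltr0n copies_gt0. Qed.

Lemma coef_pass_poly M r : (pass_poly M)`_r = (pass_count M r)%:R / (copies P 0 M)%:R.
Proof.
rewrite coefZ coef_sum mulrC /pass_count natr_sum; congr (_ / _).
by apply: eq_bigr => i _; rewrite coefXn eq_sym.
Qed.

Lemma coef_pass_poly_ge0 M r : 0 <= (pass_poly M)`_r.
Proof. by rewrite coef_pass_poly divr_ge0. Qed.

Lemma wnorm_pass_poly M x : wnorm x (pass_poly M) =
  (copies P 0 M)%:R^-1 * \sum_(i < copies P 0 M - t) x ^+ gapsum P S 0 i t.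
Proof.
transitivity (pass_poly M).[x].
  rewrite horner_coef; apply: eq_bigr => i _; congr (_ * _).
  by rewrite ger0_norm ?coef_pass_poly_ge0.
by rewrite hornerZ horner_sum; congr (_ * _); apply: eq_bigr => i _; rewrite hornerXn.
Qed.

Lemma wnorm1_pass_poly M :
  wnorm 1 (pass_poly M) = (copies P 0 M - t)%:R / (copies P 0 M)%:R.
Proof.
rewrite wnorm_pass_poly mulrC; congr (_ / _).
under eq_bigr => i _ do rewrite expr1n.
by rewrite sumr_const card_ord.
Qed.

Lemma wnorm1_pass_poly_le1 M : wnorm 1 (pass_poly M) <= 1.
Proof. by rewrite wnorm1_pass_poly ler_pdivrMr // mul1r ler_nat leq_subr. Qed.

(** Each of the [P M] copies of a block repeats its inner windows; windows that straddle two copies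
    only add to the right-hand side. Dividing by the number of all copies, the coefficients of
    [pass_poly] increase with [M]. *)
Lemma pass_count_copies M r : (P M * pass_count M r <= pass_count M.+1 r)%N.
Proof.
rewrite /pass_count copiesSr add0n; set q := copies P 0 M.
have [tq|qt] := ltnP t q; last first.
  by rewrite (eqP (qt : (q - t == 0)%N)) big_ord0 muln0.
pose f i : nat := gapsum P S 0 i t == r.
suff H c : (c * \sum_(i < q - t) f i <= \sum_(i < q * c - t) f i)%N by exact: H.
elim: c => [|c IH]; first by rewrite mul0n.
case: c IH => [_|c IH]; first by rewrite mul1n muln1.
have -> : (q * c.+2 - t = (q * c.+1 - t) + (t + (q - t)))%N.
  by rewrite (mulnS q c.+1); have := leq_pmulr q (ltn0Sn c); lia.
rewrite mulSn addnC !big_split_ord /= leq_add // -[leqLHS]add0n leq_add //.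
apply: leq_sum => i _; rewrite /f.
have -> : (q * c.+1 - t + (t + i) = c.+1 * q + i)%N.
  by rewrite mulnC addnA subnK // (leq_trans (ltnW tq)) // leq_pmull.
by rewrite gapsum_block // -/q; have := ltn_ord i; lia.
Qed.

Lemma coef_pass_polyS M r : (pass_poly M)`_r <= (pass_poly M.+1)`_r.
Proof.
rewrite !coef_pass_poly ler_pdivrMr // mulrAC ler_pdivlMr // -!natrM ler_nat.
rewrite copiesSr add0n mulnCA -[leqRHS]mulnC.
by rewrite leq_mul2l mulnC pass_count_copies orbT.
Qed.

Lemma coef_pass_poly_mono M M' r : (M <= M')%N -> (pass_poly M)`_r <= (pass_poly M')`_r.
Proof.
move/subnKC <-; elim: (M' - M)%N => [|k IH]; first by rewrite addn0.
by rewrite addnS; apply: le_trans IH (coef_pass_polyS _ _).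
Qed.

(** The coefficients increase and sum to at most 1, so the distance is at most the mass still
    missing at [M]. *)
Lemma wnorm_pass_polyB M M' : (t <= copies P 0 M)%N -> (M <= M')%N ->
  wnorm 1 (pass_poly M' - pass_poly M) <= t%:R / (copies P 0 M)%:R.
Proof.
move=> tM MM'; pose n := maxn (size (pass_poly M)) (size (pass_poly M')).
have -> : wnorm 1 (pass_poly M' - pass_poly M) =
    wnorm 1 (pass_poly M') - wnorm 1 (pass_poly M).
  rewrite (@wnormE _ n 1 (pass_poly M' - _)); last first.
    by apply: leq_trans (size_polyD _ _) _; rewrite size_polyN maxnC.
  rewrite (@wnormE _ n 1 (pass_poly M')) ?leq_maxr //.
  rewrite (@wnormE _ n 1 (pass_poly M)) ?leq_maxl // -sumrB.
  apply: eq_bigr => i _; rewrite -mulrBl; congr (_ * _).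
  by rewrite coefB !ger0_norm ?coef_pass_poly_ge0 // subr_ge0 coef_pass_poly_mono.
have H1 := wnorm1_pass_poly_le1 M'.
apply: (@le_trans _ _ (1 - wnorm 1 (pass_poly M))); first by rewrite lerD2r.
by rewrite wnorm1_pass_poly natrB // mulrBl divff ?gt_eqF // opprB addrC subrK.
Qed.

Lemma coef_pass_poly_low M r : (r < mingap P S 0 t)%N -> (pass_poly M)`_r = 0.
Proof.
move=> Hr; rewrite coef_pass_poly /pass_count big1 ?mul0r // => i _.
apply/eqP; rewrite eqb0; apply: contraTneq Hr => <-.
by rewrite -leqNgt mingap_le.
Qed.

(** A window attaining the minimum lies in some finite tower, and its weight cannot decrease
    afterwards. *)
Lemma coef_pass_poly_mingap : exists M1, exists2 delta : C, 0 < delta &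
  forall M, (M1 <= M)%N -> delta <= `|(pass_poly M)`_(mingap P S 0 t)|.
Proof.
have [x Hx] := mingap_attained P S 0 t.
pose M1 := (x + t).+1; exists M1, (copies P 0 M1)%:R^-1; first by rewrite invr_gt0.
move=> M HM; rewrite ger0_norm ?coef_pass_poly_ge0 //.
apply: le_trans (coef_pass_poly_mono _ HM).
rewrite coef_pass_poly ler_peMl ?invr_ge0 // ler1n /pass_count.
have Hxt : (x < copies P 0 M1 - t)%N.
  rewrite ltn_subRL addnC; apply: leq_trans (copies_ge P2 _ _).
  by apply: leq_trans (ltn_expl _ _) => //; rewrite /M1; lia.
by rewrite (bigD1 (Ordinal Hxt)) //= Hx eqxx.
Qed.

(** The constant 6 solves [c = 3/2 + (3/2) (c/2)]: a gap without carry costs at most 3/2, and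
    carries, at most every second copy, multiply a term of the next level by at most 3/2. *)
Lemma gap_exp_sum (B : nat) (y : C) :
  (forall l j, (j < P l)%N -> (S l j <= B)%N) -> 1 <= y -> y ^+ B <= 3 / 2 ->
  forall l n, \sum_(u < n) y ^+ gap P S l u <= 6 * n%:R.
Proof.
move=> SB y1 yB.
have y0 : 0 <= y by apply: le_trans y1.
have y32 k : (k <= B)%N -> y ^+ k <= 3 / 2.
  by move=> kB; apply: le_trans yB; apply: ler_weXn2l.
have step l n : \sum_(u < n) y ^+ gap P S l u <=
    3 / 2 * n%:R + 3 / 2 * \sum_(u < n %/ P l) y ^+ gap P S l.+1 u.
  elim: n => [|n IH]; first by rewrite div0n !big_ord0 !mulr0 addr0.
  rewrite big_ord_recr /= [n.+1%:R]mulrSr mulrDr mulr1.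
  rewrite divnS ?(ltnW (P2 l)) // gapE //.
  have p0 : (0 < P l)%N := ltnW (P2 l).
  case: ifP => Hd; rewrite ?add1n ?add0n.
    rewrite big_ord_recr /= exprD mulrDr.
    have H1 : y ^+ S l (P l).-1 * y ^+ gap P S l.+1 (n %/ P l) <=
        3 / 2 * y ^+ gap P S l.+1 (n %/ P l).
      by rewrite ler_wpM2r ?exprn_ge0 // y32 // SB // ltn_predL.
    apply: le_trans (lerD IH H1) _; rewrite -subr_ge0; set z := 3 / 2.
    by rewrite [leRHS](_ : _ = z); [rewrite divr_ge0 | ring].
  have H1 : y ^+ S l (n %% P l) <= 3 / 2 by rewrite y32 // SB // ltn_pmod.
  by apply: le_trans (lerD IH H1) _; rewrite addrAC.
move=> l n; elim/ltn_ind: n l => n IH l.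
case: n IH => [|n] IH; first by rewrite big_ord0 mulr0.
have Hlt : (n.+1 %/ P l < n.+1)%N by rewrite ltn_Pdiv.
apply: le_trans (step l n.+1) _.
have H2 : (n.+1 %/ P l)%:R * 2 <= n.+1%:R :> C.
  rewrite -natrM ler_nat; apply: leq_trans (leq_trunc_div n.+1 (P l)).
  by rewrite leq_mul2l P2 orbT.
have H3 : 3 / 2 * \sum_(u < n.+1 %/ P l) y ^+ gap P S l.+1 u <= 9 / 2 * n.+1%:R.
  apply: le_trans (ler_wpM2l _ (IH _ Hlt l.+1)) _; first by rewrite divr_ge0.
  have -> : 3 / 2 * (6 * (n.+1 %/ P l)%:R) = 9 / 2 * ((n.+1 %/ P l)%:R * 2) :> C by field.
  by rewrite ler_wpM2l // divr_ge0.
apply: le_trans (lerD (lexx _) H3) _.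
by rewrite -mulrDl ler_wpM2r // le_eqVlt; apply/orP; left; apply/eqP; field.
Qed.

(** A sum of [t] gaps is at most [t] times the largest one, whose exponential with base [x ^+ t] is
    bounded by the sum over all [t] gaps. *)
Lemma wnorm_pass_poly_bound (B : nat) (x : C) :
  (forall l j, (j < P l)%N -> (S l j <= B)%N) -> (0 < t)%N ->
  1 <= x -> x ^+ (t * B) <= 3 / 2 ->
  forall M, wnorm x (pass_poly M) <= (6 * t)%:R.
Proof.
move=> SB t0 x1 xB M; rewrite wnorm_pass_poly mulrC ler_pdivrMr //.
set q := copies P 0 M.
have x0 : 0 <= x by apply: le_trans x1.
pose y := x ^+ t.
have y1 : 1 <= y by apply: exprn_ege1.
have yB : y ^+ B <= 3 / 2 by rewrite -exprM.
have W i : x ^+ gapsum P S 0 i t <= \sum_(u < t) y ^+ gap P S 0 (i + u).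
  pose u := [arg max_(u > Ordinal t0) gap P S 0 (i + u)].
  have Hu : (gapsum P S 0 i t <= t * gap P S 0 (i + u))%N.
    rewrite -[X in (X * _)%N]card_ord -sum_nat_const leq_sum // => v _.
    by rewrite /u; case: arg_maxnP => // w _; apply.
  rewrite (bigD1 u) //=; apply: (@le_trans _ _ (y ^+ gap P S 0 (i + u))).
    by rewrite /y -exprM; apply: ler_weXn2l.
  by rewrite lerDl; apply: sumr_ge0 => v _; rewrite exprn_ge0 // exprn_ge0.
apply: (@le_trans _ _ (\sum_(i < q - t) \sum_(u < t) y ^+ gap P S 0 (i + u))).
  by apply: ler_sum => i _; apply: W.
rewrite exchange_big /= [(6 * t)%N]mulnC natrM -mulrA.
have -> : t%:R * (6 * q%:R) = \sum_(u < t) 6 * q%:R :> C.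
  by rewrite sumr_const card_ord mulr_natl.
apply: ler_sum => u _; apply: le_trans (gap_exp_sum SB y1 yB 0 q).
have [tq|/ltnW] := leqP t q; last by rewrite -subn_eq0 => /eqP ->; rewrite big_ord0 sumr_ge0 // => i _; rewrite exprn_ge0 // exprn_ge0.
have uq : (u + (q - t) <= q)%N by have := ltn_ord u; lia.
apply: (sum_shift_le (f := fun i => y ^+ gap P S 0 i) _ uq) => i.
by rewrite exprn_ge0 // exprn_ge0.
Qed.

Section AsLimitSeq.
Hypothesis archiC : forall x : C, 0 <= x -> exists n, x <= n%:R.
Hypothesis completeC : forall u : nat -> C,
  (forall e : C, 0 < e -> exists N, forall n, (N <= n)%N -> `|u n - u N| <= e) ->
  cvg (u n @[n --> \oo]).

(** The missing mass tends to 0, which makes the values Cauchy on the circle. Completeness is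
    assumed here and supplied for [R[i]] by [complex_complete]. *)
Lemma pass_poly_limitseq : pass_poly \in @limitseq_pred C.
Proof.
apply/limitseqP; split; first by exists 1 => M; apply: wnorm1_pass_poly_le1.
move=> w w1; apply: completeC => e e0.
have [N HN] := archiC (divr_ge0 (ler0n C t) (ltW e0)).
exists (N + t)%N => n Hn; rewrite -hornerN -hornerD.
have Hq : (N + t <= copies P 0 (N + t))%N.
  by apply: leq_trans (copies_ge P2 _ _); apply: ltnW; apply: ltn_expl.
apply: le_trans (horner_le_wnorm _ (_ : _ <= 1)) _; first by rewrite w1.
apply: le_trans (wnorm_pass_polyB _ Hn) _; first by apply: leq_trans Hq; rewrite leq_addl.
rewrite ler_pdivrMr //; move: HN; rewrite ler_pdivrMr // => /le_trans; apply.
by rewrite mulrC ler_wpM2l ?(ltW e0) // ler_nat (leq_trans _ Hq) // leq_addr.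
Qed.

Definition pass_series : limitseq C := exist (fun a => a \in @limitseq_pred C) _ pass_poly_limitseq.

End AsLimitSeq.

End PassPolynomials.

(** * Finiteness of the coincidence set *)

Section CoincidenceSet.
Variable C : numClosedFieldType.
Hypothesis archiC : forall x : C, 0 <= x -> exists n, x <= n%:R.

Lemma coef_comp_XnZ (p : {poly C}) (z : C) a i : (0 < a)%N ->
  (p \Po (z *: 'X^a))`_i = if (a %| i)%N then p`_(i %/ a) * z ^+ (i %/ a) else 0.
Proof.
move=> a0; have -> : p \Po (z *: 'X^a) = (\poly_(k < size p) (p`_k * z ^+ k)) \Po 'X^a.
  rewrite poly_def comp_polyE rmorph_sum /=; apply: eq_bigr => k _.
  by rewrite comp_polyZ comp_Xn_poly exprZn scalerA.
rewrite coef_comp_poly_Xn //; case: ifP => // _; rewrite coef_poly.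
by case: ltnP => // Hs; rewrite nth_default // mul0r.
Qed.

(** For [d <= 1] one has [(1 + d) ^+ N <= 1 + 3 ^ N d]; take [d = 1 / (2 * 3 ^ N)]. *)
Lemma exists_gt1_exp_le N : exists2 x : C, 1 < x & x ^+ N <= 3 / 2.
Proof.
pose d : C := (2 * 3 ^ N)%:R^-1.
have d0 : 0 < d by rewrite invr_gt0 ltr0n muln_gt0 expn_gt0.
have d1 : d <= 1 by rewrite invf_le1 ?ler1n ?ltr0n muln_gt0 expn_gt0.
exists (1 + d); first by rewrite ltrDl.
have : (1 + d) ^+ N <= 1 + (3 ^ N)%:R * d.
  elim: N {d d0 d1} (d) d0 d1 => [|N IH] d d0 d1; first by rewrite expr0 lerDl mulr_ge0 // ltW.
  rewrite exprSr; apply: le_trans (ler_wpM2r (addr_ge0 ler01 (ltW d0)) (IH d d0 d1)) _.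
  have k1 : 1 <= (3 ^ N)%:R :> C by rewrite ler1n expn_gt0.
  rewrite expnS natrM; move: ((3 ^ N)%:R) k1 => k k1.
  rewrite -subr_ge0.
  have -> : 1 + 3 * k * d - (1 + k * d) * (1 + d) = d * ((k - 1) + k * (1 - d)) by ring.
  by rewrite mulr_ge0 ?(ltW d0) // addr_ge0 ?mulr_ge0 ?subr_ge0 // (le_trans ler01).
move/le_trans; apply; rewrite /d natrM invfM mulrCA divff ?mulr1.
  by rewrite le_eqVlt; apply/orP; left; apply/eqP; field.
by rewrite pnatr_eq0 -lt0n expn_gt0.
Qed.

(* [F] behaves like a power series of order exactly [e], with radius of
   convergence larger than 1. *)
Definition order_radius (F : limitseq C) (e k : nat) (g : C) :=
  [/\ forall M i, (i < e)%N -> (val F M)`_i = 0,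
      exists M1, exists2 delta : C, 0 < delta &
        forall M, (M1 <= M)%N -> delta <= `|(val F M)`_e| &
      forall x, 1 <= x -> x ^+ k <= 3 / 2 -> forall M, wnorm x (val F M) <= g].

(** [F(z y^a) - G(x y^b)] starts at degree [a * eF] with the leading coefficient of [F] up to a
    phase, since [G] starts later. [limit_circle_zeros] then bounds the number of zeros. *)
Lemma coincidence_finite_lt (F G : limitseq C) a b eF eG kF kG gF gG (z x : circle C) :
  (0 < a)%N -> (0 < b)%N ->
  order_radius F eF kF gF -> order_radius G eG kG gG -> (a * eF < b * eG)%N ->
  finite_set [set y : circle C |
    eval_lim (circle_exp z y a) F = eval_lim (circle_exp x y b) G].
Proof.
move=> a0 b0 [F1 [M1 [delta d0 F2]] F3] [G1 _ G3] ab.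
pose f M := (val F M \Po (val z *: 'X^a)) - (val G M \Po (val x *: 'X^b)).
have fe M : `|(f M)`_(a * eF)| = `|(val F M)`_eF|.
  rewrite coefB !coef_comp_XnZ // dvdn_mulr // mulKn //.
  have -> : (if (b %| a * eF)%N then (val G M)`_((a * eF) %/ b) * val x ^+ ((a * eF) %/ b) else 0) = 0.
    case: ifP => // Hd; rewrite G1 ?mul0r // -(ltn_pmul2r b0) divnK //.
    by rewrite [X in (_ < X)%N]mulnC.
  by rewrite subr0 normrM normrX circleP expr1n mulr1.
have flow M i : (i < a * eF)%N -> (f M)`_i = 0.
  move=> Hi; rewrite coefB !coef_comp_XnZ //.
  have -> : (if (a %| i)%N then (val F M)`_(i %/ a) * val z ^+ (i %/ a) else 0) = 0.
    by case: ifP => // Hd; rewrite F1 ?mul0r // ltn_divLR // mulnC.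
  have -> : (if (b %| i)%N then (val G M)`_(i %/ b) * val x ^+ (i %/ b) else 0) = 0.
    by case: ifP => // Hd; rewrite G1 ?mul0r // ltn_divLR // mulnC (ltn_trans Hi).
  exact: subr0.
have [r r1 Hr] := exists_gt1_exp_le (a * kF + b * kG).
have r0 : 0 <= r by apply: le_trans ler01 (ltW r1).
have fb M : wnorm r (f M) <= gF + gG.
  apply: le_trans (wnormB _ _ r0) _; apply: lerD.
    apply: le_trans (wnorm_comp_XnZ _ _ _ r0) _; rewrite circleP mul1r; apply: F3.
      by rewrite exprn_ege1 // ltW.
    by rewrite -exprM; apply: le_trans Hr; apply: ler_weXn2l; rewrite ?(ltW r1) ?leq_addr.
  apply: le_trans (wnorm_comp_XnZ _ _ _ r0) _; rewrite circleP mul1r; apply: G3.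
    by rewrite exprn_ege1 // ltW.
  by rewrite -exprM; apply: le_trans Hr; apply: ler_weXn2l; rewrite ?(ltW r1) ?leq_addl.
have bound (s : seq (circle C)) : uniq s ->
    (forall y, y \in s -> eval_lim (circle_exp z y a) F = eval_lim (circle_exp x y b) G) ->
    delta * r ^+ size s <= 2 * (gF + gG + 1).
  move=> us Hs; rewrite -(size_map val s).
  apply: (limit_circle_zeros (ltW r1) d0 flow (M1 := M1) _ fb).
  - by move=> M HM; rewrite fe; apply: F2.
  - by rewrite map_inj_uniq //; apply: val_inj.
  - by move=> _ /mapP[y _ ->]; apply: circleP.
  move=> _ /mapP[y ys ->].
  rewrite -(subrr (eval_lim (circle_exp z y a) F)) {2}(Hs y ys).
  rewrite /f; under eq_fun => M do rewrite hornerD hornerN !horner_comp !hornerZ !hornerXn.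
  by apply: cvgB; apply: eval_lim_cvg.
apply: contrapT => Hinf.
have Hb : 0 <= 2 * (gF + gG + 1).
  by apply: le_trans (bound [::] isT (fun y => _)) => //; rewrite mulr_ge0 // ltW.
have r10 : 0 < r - 1 by rewrite subr_gt0.
have [n Hn] := archiC (divr_ge0 (divr_ge0 Hb (ltW d0)) (ltW r10)).
have bern k : 1 + k%:R * (r - 1) <= r ^+ k.
  elim: k => [|k IH]; first by rewrite mul0r addr0 expr0.
  rewrite exprSr; apply: le_trans (ler_wpM2r r0 IH).
  rewrite -subr_ge0 [k.+1%:R]mulrSr.
  have -> : (1 + k%:R * (r - 1)) * r - (1 + (k%:R + 1) * (r - 1)) = k%:R * (r - 1) ^+ 2 by ring.
  by rewrite mulr_ge0 // exprn_ge0 // ltW.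
have [B HB nB] := infinite_set_fset n Hinf.
have H2 : delta * r ^+ size (enum_fset B) <= 2 * (gF + gG + 1).
  by apply: bound => [|y yB]; [exact: fset_uniq | exact: HB].
move: nB; set k := size (enum_fset B) in H2 * => nk.
have {}Hn : 2 * (gF + gG + 1) / delta / (r - 1) <= k%:R.
  by apply: le_trans Hn _; rewrite ler_nat.
move: Hn; rewrite ler_pdivrMr // ler_pdivrMr // => Hn.
have H3 := ler_wpM2l (ltW d0) (bern k).
have := le_trans H3 (le_trans H2 Hn).
by rewrite mulrDr mulr1 [_ * delta]mulrC gerDr => /(lt_le_trans d0); rewrite ltxx.
Qed.

(** Writing [z1 = u1 y^b] and [z2 = u2 y^a] with [u1^a = u2^b = 1] leaves finitely many equations in
    the single unknown [y]. *)
Lemma coincidence_set_finite (F G : limitseq C) a b eF eG kF kG gF gG :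
  (0 < a)%N -> (0 < b)%N ->
  order_radius F eF kF gF -> order_radius G eG kG gG -> (b * eF <> a * eG)%N ->
  finite_set [set w : circle C | exists z1 z2 : circle C,
     [/\ val z1 ^+ a = val w, val z2 ^+ b = val w & eval_lim z1 F = eval_lim z2 G]].
Proof.
move=> a0 b0 HF HG ab.
pose U n : set (circle C) := [set z | val z ^+ n = 1].
have Ufin n : (0 < n)%N -> finite_set (U n).
  move=> n0.
  have [s Hs] : exists s : seq C, forall z, z ^+ n = 1 -> z \in s.
    have [s Hs] := closed_field_poly_normal ('X^n - 1 : {poly C}).
    exists s => z zn; rewrite -root_prod_XsubC.
    have -> : root (\prod_(y <- s) ('X - y%:P)) z = root ('X^n - 1%:P) z.
      by rewrite [in RHS]Hs lead_coefXnsubC // scale1r.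
    by rewrite /root !hornerE zn subrr.
  apply: (@sub_finite_set _ _ ((val : circle C -> C) @^-1` [set` s])).
    by move=> z zn; apply: Hs.
  by apply: finite_preimage => [y y' _ _ /val_inj|]; [ | exact: finite_seq].
pose Y z x : set (circle C) := [set y | eval_lim (circle_exp z y b) F = eval_lim (circle_exp x y a) G].
have Yfin z x : finite_set (Y z x).
  have := ltngtP (b * eF) (a * eG); case=> // H.
    exact: (coincidence_finite_lt z x b0 a0 HF HG H).
  have := coincidence_finite_lt x z a0 b0 HG HF H.
  by apply: sub_finite_set => y; rewrite /Y /=.
apply: (@sub_finite_set _ _ (\bigcup_(z in U a) \bigcup_(x in U b)
   [set circle_exp (circle1 C) y (a * b) | y in Y z x])); last first.
  apply: bigcup_finite => [|z _]; first exact: Ufin.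
  apply: bigcup_finite => [|x _]; first exact: Ufin.
  exact/finite_image/Yfin.
move=> w [z1 [z2 [E1 E2 E]]].
have ab0 : (0 < a * b)%N by rewrite muln_gt0 a0.
have [y Hy] := circle_root w ab0.
have quot (z : circle C) n m : val z ^+ n = val w -> (n * m = a * b)%N ->
    exists2 u : circle C, val u ^+ n = 1 & circle_exp u y m = z.
  move=> Hz nm; have u1 : `|val z / val y ^+ m| == 1.
    by rewrite normrM normfV normrX !circleP expr1n divr1.
  have y0 : val y ^+ m != 0 by rewrite -normr_eq0 normrX circleP expr1n oner_eq0.
  exists (exist (fun z => `|z| == 1) _ u1).
    rewrite /= exprMn exprVn Hz -exprM mulnC nm Hy divff //.
    by rewrite -normr_eq0 circleP oner_eq0.
  by apply: val_inj; rewrite /= divfK.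
have [u1 Hu1 Eu1] := quot z1 a b E1 erefl.
have [u2 Hu2 Eu2] := quot z2 b a E2 (mulnC b a).
exists u1 => //; exists u2 => //; exists y; first by rewrite /Y /= Eu1 Eu2.
by apply: val_inj; rewrite /= mul1r.
Qed.

End CoincidenceSet.

(** * Square-integrable functions *)

Section Integrable.
Context d (X : measurableType d) (R : realType).
Variable mu : {measure set X -> \bar R}.
Implicit Types f g : X -> R.
Local Notation int1 f := (mu.-integrable setT (EFin \o f)).

Lemma int1D f g : int1 f -> int1 g -> int1 (fun x => f x + g x).
Proof.
move=> If Ig; rewrite (_ : EFin \o _ = (EFin \o f) \+ (EFin \o g))%E; last first.
  by apply/funext => x /=; rewrite EFinD.
exact: integrableD.
Qed.

Lemma int1Z f a : int1 f -> int1 (fun x => a * f x).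
Proof.
move=> If; rewrite (_ : EFin \o _ = (fun x => a%:E * (EFin \o f) x))%E; last first.
  by apply/funext => x /=; rewrite EFinM.
exact: integrableZl.
Qed.

Lemma int1B f g : int1 f -> int1 g -> int1 (fun x => f x - g x).
Proof.
move=> If Ig; rewrite (_ : (fun x => f x - g x) = (fun x => f x + -1 * g x)).
  by apply: int1D => //; apply: int1Z.
by apply/funext => x; rewrite mulN1r.
Qed.

End Integrable.

Section SquareIntegrable.
Context (d : measure_display) (X : measurableType d) (R : realType).
Variable mu : probability X R.
Implicit Types (f g h : X -> R) (phi : X -> X).

Local Notation int1 f := (mu.-integrable [set: X] (EFin \o f)).

Definition L2 f := measurable_fun setT f /\ int1 (fun x => f x ^+ 2).

Definition ip f g : R := \int[mu]_x (f x * g x).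

Lemma L2_prod f g : L2 f -> L2 g -> int1 (fun x => f x * g x).
Proof.
move=> [mf f2] [mg g2].
apply: (@le_integrable _ _ _ mu setT measurableT _ (EFin \o (fun x => f x ^+ 2 + g x ^+ 2))).
- by apply/measurable_EFinP; apply: measurable_funM.
- move=> x _ /=; rewrite lee_fin; apply: le_trans (ler_norm _); rewrite normrM.
  rewrite -(real_normK (num_real (f x))) -(real_normK (num_real (g x))).
  by have := sqr_ge0 (`|f x| - `|g x|); have := mulr_ge0 (normr_ge0 (f x)) (normr_ge0 (g x)); nra.
- rewrite (_ : EFin \o _ = (EFin \o (fun x => f x ^+ 2)%R) \+ (EFin \o (fun x => g x ^+ 2)%R))%E.
    exact: integrableD.
  by apply/funext => x /=; rewrite EFinD.
Qed.

Lemma bounded_int1 f B : measurable_fun setT f -> (forall x, `|f x| <= B) -> int1 f.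
Proof.
move=> mf fB; apply: measurable_bounded_integrable => //.
  exact: le_lt_trans (probability_le1 mu measurableT) (ltry _).
exists B; split; first exact: num_real.
by move=> y By x _ /=; apply: le_trans (fB x) (ltW By).
Qed.

Lemma bounded_L2 f B : measurable_fun setT f -> (forall x, `|f x| <= B) -> L2 f.
Proof.
move=> mf fB; split=> //; apply: (@bounded_int1 _ (B ^+ 2)).
  by apply: measurable_funX.
move=> x; rewrite normrX lerXn2r ?nnegrE //.
by apply: le_trans (fB x).
Qed.

Lemma L2D f g : L2 f -> L2 g -> L2 (fun x => f x + g x).
Proof.
move=> Lf Lg; split; first by apply: measurable_funD; [case: Lf | case: Lg].
have -> : (fun x => (f x + g x) ^+ 2) = (fun x => (f x ^+ 2 + 2 * (f x * g x)) + g x ^+ 2).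
  by apply/funext => x; ring.
apply: int1D; last by case: Lg.
by apply: int1D; [case: Lf | apply/int1Z/L2_prod].
Qed.

Lemma L2Z f a : L2 f -> L2 (fun x => a * f x).
Proof.
move=> [mf If]; split; first exact: measurable_funM.
have -> : (fun x => (a * f x) ^+ 2) = (fun x => a ^+ 2 * f x ^+ 2).
  by apply/funext => x; ring.
exact: int1Z.
Qed.

Lemma L2B f g : L2 f -> L2 g -> L2 (fun x => f x - g x).
Proof.
move=> Lf Lg; have := L2D Lf (L2Z (-1) Lg).
by rewrite (_ : (fun x => f x + -1 * g x) = (fun x => f x - g x)) //; apply/funext => x; ring.
Qed.

Lemma ipC f g : ip f g = ip g f.
Proof. by apply: eq_Rintegral => x _; rewrite mulrC. Qed.

Lemma ipDl f g h : L2 f -> L2 g -> L2 h -> ip (fun x => f x + g x) h = ip f h + ip g h.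
Proof.
move=> Lf Lg Lh; rewrite /ip -RintegralD //; try exact: L2_prod.
by apply: eq_Rintegral => x _; rewrite mulrDl.
Qed.

Lemma ipZl f h a : L2 f -> L2 h -> ip (fun x => a * f x) h = a * ip f h.
Proof.
move=> Lf Lh; rewrite /ip -RintegralZl //; last exact: L2_prod.
by apply: eq_Rintegral => x _; rewrite mulrA.
Qed.

Lemma ipBl f g h : L2 f -> L2 g -> L2 h -> ip (fun x => f x - g x) h = ip f h - ip g h.
Proof.
move=> Lf Lg Lh; rewrite -[in RHS](mulN1r (ip g h)) -ipZl // -ipDl //; last exact: L2Z.
by apply: eq_Rintegral => x _; rewrite mulN1r.
Qed.

Lemma ip_ge0 f : 0 <= ip f f.
Proof. by apply: Rintegral_ge0 => x _; rewrite -expr2 sqr_ge0. Qed.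

(** The weight [a] lets a small norm on one side compensate a large one on the other. *)
Lemma ip_le f g (a : R) : 0 < a -> L2 f -> L2 g ->
  `|ip f g| <= a^-1 * ip f f + a * ip g g.
Proof.
move=> a0 Lf Lg; rewrite /ip -!RintegralZl //; try exact: L2_prod.
rewrite -RintegralD //; try by apply/int1Z/L2_prod.
apply: le_trans (le_normr_Rintegral _ (L2_prod Lf Lg)) _ => //.
apply: le_Rintegral => //.
- exact: (integrable_norm (L2_prod Lf Lg)).
- by apply: int1D; apply/int1Z/L2_prod.
move=> x _; rewrite -(ler_pM2l a0).
have -> : a * (a^-1 * (f x * f x) + a * (g x * g x)) = `|f x| ^+ 2 + (a * `|g x|) ^+ 2.
  by rewrite exprMn !real_normK ?num_real //; field; rewrite gt_eqF.
rewrite normrM; have := sqr_ge0 (`|f x| - a * `|g x|).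
have := mulr_ge0 (ltW a0) (mulr_ge0 (normr_ge0 (f x)) (normr_ge0 (g x))); nra.
Qed.

Definition preserves phi :=
  measurable_fun setT phi /\ forall A, measurable A -> mu (phi @^-1` A) = mu A.

Lemma preserves_ge0_integral phi (f : X -> \bar R) : preserves phi ->
  measurable_fun setT f -> (forall x, 0 <= f x)%E ->
  (\int[mu]_x f (phi x) = \int[mu]_x f x)%E.
Proof.
move=> [mphi Hphi] mf f0.
have := ge0_integral_pushforward mphi mu measurableT mf (fun x _ => f0 x).
rewrite preimage_setT => <-; apply: eq_measure_integral => A mA _.
exact: Hphi.
Qed.

Lemma preserves_int1 phi f : preserves phi -> int1 f -> int1 (f \o phi).
Proof.
move=> pphi /integrableP[mf If]; apply/integrableP; split.
  exact: (measurableT_comp mf (proj1 pphi)).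
rewrite (preserves_ge0_integral (f := fun x => `|(EFin \o f) x|%E) pphi) //.
exact: measurableT_comp.
Qed.

Lemma preserves_Rintegral phi f : preserves phi -> int1 f ->
  \int[mu]_x f (phi x) = \int[mu]_x f x.
Proof.
move=> pphi If; have [mphi Hphi] := pphi.
have /= mf : measurable_fun setT (EFin \o f) by case/integrableP: If.
have := integral_pushforward mphi mf (preserves_int1 pphi If : mu.-integrable (phi @^-1` setT) _) measurableT.
rewrite preimage_setT => H; rewrite /Rintegral; congr fine; rewrite -[LHS]H.
by apply: eq_measure_integral => A mA _; exact: Hphi.
Qed.

Lemma preserves_L2 phi f : preserves phi -> L2 f -> L2 (fun x => f (phi x)).
Proof.
move=> pphi [mf If]; split; last exact: (preserves_int1 pphi If).
by apply: (measurableT_comp mf); case: pphi.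
Qed.

Lemma preserves_ip phi f g : preserves phi -> L2 f -> L2 g ->
  ip (fun x => f (phi x)) (fun x => g (phi x)) = ip f g.
Proof. by move=> pphi Lf Lg; apply: (preserves_Rintegral pphi (L2_prod Lf Lg)). Qed.

End SquareIntegrable.

(** * Towers *)

Section IntegerPowers.
Context (d : measure_display) (X : measurableType d) (R : realType).
Variables (mu : probability X R) (T Tinv : X -> X).
Hypothesis TK : cancel T Tinv.
Hypothesis TinvK : cancel Tinv T.

Definition zpow (n : int) : X -> X :=
  match n with Posz n => iter n T | Negz n => iter n.+1 Tinv end.

Lemma zpowS n x : zpow (n + 1) x = T (zpow n x).
Proof.
case: n => [n|[|n]].
- by rewrite -PoszD addn1.
- by rewrite /= TinvK.
- have -> : Negz n.+1 + 1 = Negz n by rewrite !NegzE; lia.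
  by rewrite [RHS]/= TinvK.
Qed.

Lemma zpowB n x : zpow (n - 1) x = Tinv (zpow n x).
Proof. by rewrite -{2}(subrK 1 n) zpowS TK. Qed.

Lemma zpowD m n x : zpow (m + n) x = zpow m (zpow n x).
Proof.
elim/int_ind: m => [|m IH|m IH]; first by rewrite add0r.
  by rewrite -addn1 PoszD addrAC !zpowS IH.
by rewrite -addn1 PoszD opprD addrAC !zpowB IH.
Qed.

Lemma preserves_comp (phi psi : X -> X) :
  preserves mu phi -> preserves mu psi -> preserves mu (phi \o psi).
Proof.
move=> [m1 H1] [m2 H2]; split; first exact: measurableT_comp.
move=> A mA; rewrite comp_preimage H2 ?H1 //.
by rewrite -[X in measurable X]setTI; apply: m1.
Qed.

Hypothesis mT : preserves mu T.
Hypothesis mTinv : measurable_fun setT Tinv.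

Lemma preserves_inv : preserves mu Tinv.
Proof.
split=> // A mA; have [_ H] := mT.
rewrite -H; last by rewrite -[X in measurable X]setTI; apply: mTinv.
rewrite -comp_preimage; congr (mu _).
by apply/seteqP; split => x; rewrite /preimage /= TK.
Qed.

Lemma preserves_id : preserves mu id.
Proof. by split => // A mA; rewrite preimage_id. Qed.

Lemma preserves_zpow n : preserves mu (zpow n).
Proof.
case: n => n; last first.
  elim: n => [|n IH]; first exact: preserves_inv.
  exact: (preserves_comp preserves_inv IH).
elim: n => [|n IH]; first exact: preserves_id.
exact: (preserves_comp mT IH).
Qed.

End IntegerPowers.

Section FiniteUnion.
Context (d : measure_display) (X : measurableType d) (R : realType).
Variable mu : probability X R.

Lemma Rintegral_finite_union (F : nat -> set X) (n : nat) (v : X -> R) :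
  (forall i, (i < n)%N -> measurable (F i)) ->
  (forall i k, (i < n)%N -> (k < n)%N -> i != k -> F i `&` F k = set0) ->
  mu.-integrable setT (EFin \o v) ->
  (forall x, (forall i, (i < n)%N -> ~ F i x) -> v x = 0) ->
  \int[mu]_x v x = \sum_(i < n) \int[mu]_(x in F i) v x.
Proof.
move=> mF dF Iv v0.
pose D m := [set x | exists2 i, (i < m)%N & F i x].
have DS m : D m.+1 = D m `|` F m.
  apply/seteqP; split => x /=.
    move=> [ i]; rewrite ltnS leq_eqVlt => /orP[/eqP ->|im] Fx; [by right | left].
    by exists i.
  move=> [[i im Fx]|Fx]; last by exists m.
  by exists i => //; rewrite ltnS ltnW.
have H m : (m <= n)%N -> measurable (D m) /\
    \int[mu]_(x in D m) v x = \sum_(i < m) \int[mu]_(x in F i) v x.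
  elim: m => [_|m IH mn].
    have -> : D 0%N = set0 by apply/seteqP; split => x // [].
    by rewrite Rintegral_set0 big_ord0.
  have [mD E] := IH (ltnW mn); rewrite DS; split; first exact/measurableU/mF.
  rewrite big_ord_recr /= -E Rintegral_setU //; first exact: mF.
    apply: (integrableS measurableT) => //; apply: measurableU => //; exact: mF.
  apply/disj_setPS => x [[i im Fi] Fm].
  have : (F i `&` F m) x by [].
  by rewrite dF ?(ltn_trans im) // neq_ltn im.
have [mD <-] := H n (leqnn n).
rewrite [RHS]Rintegral_mkcond; apply: eq_Rintegral => x _.
rewrite patchE; case: ifPn => // /negP Hx; apply: v0 => i ni Fi; apply: Hx.
by rewrite inE; exists i.
Qed.

End FiniteUnion.

Lemma Rintegral_bound d (X : measurableType d) (R : realType) (mu : probability X R)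
  (D : set X) (v : X -> R) (K : R) : measurable D -> measurable_fun setT v ->
  (forall x, `|v x| <= K) -> `|\int[mu]_(x in D) v x| <= K * fine (mu D).
Proof.
move=> mD mv vK.
have Iv := integrableS measurableT mD (@subsetT _ _) (bounded_int1 mu mv vK).
apply: le_trans (le_normr_Rintegral mD Iv) _.
rewrite -Rintegral_cst //; apply: le_Rintegral => //; first exact: (integrable_norm Iv).
apply: (integrableS measurableT mD (@subsetT _ _)).
by apply: (bounded_int1 mu (B := `|K|)).
Qed.

Lemma count_out_of_tower (H : nat) (z : int) :
  (\sum_(b < H) ~~ (0 <= b%:Z + z < H%:Z)%R <= `|z|)%N.
Proof.
have low k : (\sum_(b < H) (b < k) <= k)%N.
  have [Hk|kH] := leqP H k.
    apply: leq_trans (_ : \sum_(b < H) 1 <= _)%N; last by rewrite sum1_card card_ord.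
    by apply: leq_sum => b _; case: (_ < _)%N.
  rewrite -(subnKC (ltnW kH)) big_split_ord /= [X in (_ + X <= _)%N]big1 ?addn0.
    apply: leq_trans (_ : \sum_(b < k) 1 <= _)%N; last by rewrite sum1_card card_ord.
    by apply: leq_sum => b _; case: (_ < _)%N.
  by move=> b _; rewrite ltnNge leq_addr.
case: z => k.
  apply: leq_trans (low k); rewrite [leqLHS](reindex_inj rev_ord_inj) /=.
  apply: leq_sum => b _; have [Hb|Hb] := ltnP b k; first exact: leq_b1.
  by rewrite leqn0 eqb0 negbK; have := ltn_ord b; apply/implyP; lia.
apply: leq_trans (low `|Negz k|%N); apply: leq_sum => b _.
have [Hb|Hb] := ltnP b `|Negz k|%N; first exact: leq_b1.
by rewrite leqn0 eqb0 negbK; have := ltn_ord b; apply/implyP; move: Hb; lia.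
Qed.

Lemma count_ge q m : (\sum_(i < q) (m <= i) <= q - m)%N.
Proof.
elim: q => [|q IH]; first by rewrite big_ord0.
rewrite big_ord_recr /=; move: IH; set S := (\sum_(i < q) _)%N; case: (leqP m q) => H /=; lia.
Qed.

Section Towers.
Context (d : measure_display) (X : measurableType d) (R : realType).
Variables (mu : probability X R) (T Tinv : X -> X).
Hypothesis TK : cancel T Tinv.
Hypothesis TinvK : cancel Tinv T.
Hypothesis mT : preserves mu T.
Hypothesis mTinv : measurable_fun setT Tinv.
Variables (p : nat -> nat) (s : nat -> nat -> nat) (L : nat -> nat -> set X).
Hypothesis p2 : forall n, (1 < p n)%N.
Local Notation hgt := (hgt p s).
Hypothesis mL : forall n k, (1 <= n)%N -> (k < hgt n)%N -> measurable (L n k).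
Hypothesis disL : forall n k k', (1 <= n)%N -> (k < hgt n)%N -> (k' < hgt n)%N ->
  k != k' -> L n k `&` L n k' = set0.
Hypothesis TL : forall n k, (1 <= n)%N -> (k.+1 < hgt n)%N -> T @` L n k = L n k.+1.
Hypothesis cutL : forall n k, (1 <= n)%N -> (k < hgt n)%N ->
  L n k = \bigcup_(i in [set i | (i < p n)%N]) L n.+1 (col_off p s n i + k)%N.
Local Notation zpow := (zpow T Tinv).

Lemma hgtS n : (1 <= n)%N -> hgt n.+1 = (p n * hgt n + \sum_(i < p n) s n i)%N.
Proof. by case: n. Qed.

Lemma hgt_ge n : (1 <= n)%N -> (n <= hgt n)%N.
Proof.
elim: n => // n IH _; case: n IH => // n IH; rewrite hgtS //.
apply: leq_trans (leq_addr _ _); have := IH isT; have := p2 n.+1.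
by move: (hgt _) (p _) => h q; nia.
Qed.

Lemma hgt_gt0 n : (1 <= n)%N -> (0 < hgt n)%N.
Proof. by move=> n1; apply: leq_trans (hgt_ge n1). Qed.

(** Position of the bottom of the [i]-th copy of tower [n], the same in every later tower. *)
Definition copy_off n i := (i * hgt n + gapsum p s n 0 i)%N.

Lemma copy_off_split n i j : (1 <= n)%N -> (j < p n)%N ->
  copy_off n (i * p n + j) = (copy_off n.+1 i + col_off p s n j)%N.
Proof.
move=> n1 jp; rewrite /copy_off /col_off gapsumD [(i * p n)%N]mulnC gapsum_pass //.
by rewrite add0n [(p n * i)%N]mulnC gapsum_low // hgtS //; ring.
Qed.

Lemma col_off_top n j : (1 <= n)%N -> (j < p n)%N ->
  (col_off p s n j + hgt n <= hgt n.+1)%N.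
Proof.
move=> n1 jp; rewrite /col_off hgtS // addnAC -mulSnr leq_add ?leq_mul2r ?jp ?orbT //.
by rewrite -(subnKC (ltnW jp)) big_split_ord /= leq_addr.
Qed.

Lemma copy_off_top n M i : (1 <= n)%N -> (i < copies p n M)%N ->
  (copy_off n i + hgt n <= hgt (n + M))%N.
Proof.
elim: M n i => [|M IH] n i n1.
  by rewrite copies0 addn0 ltnS leqn0 => /eqP ->; rewrite /copy_off gapsum0 mul0n.
rewrite copiesS mulnC => Hi; have p0 : (0 < p n)%N by apply: ltnW.
rewrite (divn_eq i (p n)) copy_off_split ?ltn_pmod // -addnA addnS -addSn.
apply: leq_trans (IH n.+1 (i %/ p n)%N _ _) => //; last by rewrite ltn_divLR.
by rewrite leq_add2l col_off_top // ltn_pmod.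
Qed.

Lemma level_split n M a x : (1 <= n)%N -> (a < hgt n)%N ->
  L n a x <-> exists2 i, (i < copies p n M)%N & L (n + M) (copy_off n i + a)%N x.
Proof.
elim: M n a => [|M IH] n a n1 an.
  rewrite copies0 addn0; split=> [Lx|[ i]]; first by exists 0%N; rewrite // /copy_off gapsum0.
  by rewrite ltnS leqn0 => /eqP ->; rewrite /copy_off gapsum0.
have p0 : (0 < p n)%N by apply: ltnW.
have top j : (j < p n)%N -> (col_off p s n j + a < hgt n.+1)%N.
  move=> jp; apply: leq_trans (col_off_top n1 jp).
  by rewrite ltn_add2l.
rewrite cutL // copiesS mulnC addnS -addSn; split.
  move=> [j /= jp]; rewrite IH ?top // => -[i Hi].
  exists (i * p n + j)%N; last by rewrite copy_off_split // -addnA.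
  apply: (@leq_trans (i.+1 * p n)); first by rewrite mulSnr ltn_add2l.
  by rewrite leq_mul2r Hi orbT.
move=> [i Hi]; rewrite (divn_eq i (p n)) copy_off_split ?ltn_pmod // -addnA => Lx.
exists (i %% p n)%N; rewrite /= ?ltn_pmod // IH ?top ?ltn_pmod //.
by exists (i %/ p n)%N; rewrite // ltn_divLR.
Qed.

Lemma level_zpow n a b z x : (1 <= n)%N -> (a < hgt n)%N -> (b < hgt n)%N ->
  b%:Z = a%:Z + z -> L n a x -> L n b (zpow z x).
Proof.
move=> n1 an bn Ez Lx; have {Ez} -> : z = b%:Z - a%:Z by rewrite Ez addrC addKr.
have [y [Ly ->]] : exists y, L n 0 y /\ x = zpow a%:Z y.
  elim: a an x Lx => [|a IH] an x; first by exists x.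
  rewrite -TL //= => -[y /(IH (ltnW an)) [y' [Ly' ->]] <-].
  by exists y'; rewrite -zpowS // -PoszD addn1.
rewrite -zpowD // subrK; elim: b bn => [//|b IH] bn.
by rewrite -TL //; exists (zpow b%:Z y); [apply: IH; apply: ltnW | rewrite -zpowS // -PoszD addn1].
Qed.

Lemma level_measure n a b : (1 <= n)%N -> (a < hgt n)%N -> (b < hgt n)%N ->
  mu (L n a) = mu (L n b).
Proof.
move=> n1 an bn; have [_ H] := preserves_zpow TK mT mTinv (b%:Z - a%:Z).
rewrite -(H (L n b)); last exact: mL.
congr (mu _); apply/seteqP; split => x /=.
  by apply: level_zpow => //; rewrite addrC subrK.
move=> Lx; have := @level_zpow n b a (a%:Z - b%:Z) _ n1 bn an _ Lx.
rewrite -zpowD // (_ : a%:Z - b%:Z + (b%:Z - a%:Z) = 0); last by ring.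
by apply; rewrite addrC subrK.
Qed.

Definition level_mass n : R := fine (mu (L n 0)).

Lemma level_mass_ge0 n : 0 <= level_mass n.
Proof. by rewrite /level_mass fine_ge0. Qed.

Lemma level_massE n a : (1 <= n)%N -> (a < hgt n)%N -> fine (mu (L n a)) = level_mass n.
Proof. by move=> n1 an; rewrite (level_measure n1 an (hgt_gt0 n1)). Qed.

Lemma column_integral n M a v : (1 <= n)%N -> (a < hgt n)%N ->
  mu.-integrable setT (EFin \o v) ->
  \int[mu]_(x in L n a) v x =
    \sum_(i < copies p n M) \int[mu]_(x in L (n + M) (copy_off n i + a)) v x.
Proof.
move=> n1 an Iv; have nM1 : (1 <= n + M)%N by rewrite (leq_trans n1) ?leq_addr.
have top i : (i < copies p n M)%N -> (copy_off n i + a < hgt (n + M))%N.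
  by move=> Hi; apply: leq_trans (copy_off_top n1 Hi); rewrite ltn_add2l.
have off_inj i k : i != k -> (copy_off n i + a != copy_off n k + a)%N.
  have mono i' k' : (i' < k')%N -> (copy_off n i' < copy_off n k')%N.
    move=> ik; rewrite /copy_off -addSn leq_add ?leq_gapsum ?(ltnW ik) //.
    by rewrite ltn_pmul2r // hgt_gt0.
  by rewrite eqn_add2r !neq_ltn => /orP[]/mono ->; rewrite ?orbT.
rewrite Rintegral_mkcond.
rewrite (@Rintegral_finite_union _ _ _ mu (fun i => L (n + M) (copy_off n i + a)) (copies p n M)).
- apply: eq_bigr => i _; apply: eq_Rintegral => x; rewrite inE => Lx.
  rewrite patchE ifT // inE; apply/(level_split M x n1 an).
  by exists i.
- by move=> i Hi; apply: mL => //; apply: top.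
- by move=> i k Hi Hk ik; apply: disL; rewrite ?top // off_inj.
- rewrite -restrict_EFin -integrable_mkcond; last exact: mL.
  by apply: (integrableS measurableT) => //; apply: mL.
- move=> x Hx; rewrite patchE ifF //; apply/negP; rewrite inE.
  by move=> /(level_split M x n1 an) [i /Hx].
Qed.

Lemma tower_integral n v : (1 <= n)%N -> mu.-integrable setT (EFin \o v) ->
  (forall x, (forall a, (a < hgt n)%N -> ~ L n a x) -> v x = 0) ->
  \int[mu]_x v x = \sum_(b < hgt n) \int[mu]_(x in L n b) v x.
Proof.
move=> n1 Iv v0; apply: (Rintegral_finite_union (F := L n)) => //.
  by move=> i Hi; apply: mL.
by move=> i k Hi Hk; apply: disL.
Qed.

Let int1_cst (c : R) : mu.-integrable setT (EFin \o cst c).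
Proof. by apply: (bounded_int1 mu (B := `|c|)). Qed.

Lemma level_mass_copies n M : (1 <= n)%N ->
  level_mass n = (copies p n M)%:R * level_mass (n + M).
Proof.
move=> n1; have nM1 : (1 <= n + M)%N by rewrite (leq_trans n1) ?leq_addr.
have h0 := hgt_gt0 n1.
rewrite {1}/level_mass -[LHS]mul1r -Rintegral_cst; last exact: mL.
rewrite (column_integral M n1 h0 (int1_cst 1)).
rewrite (eq_bigr (fun=> level_mass (n + M))) => [|i _].
  by rewrite sumr_const card_ord mulr_natl.
have Hi : (copy_off n i + 0 < hgt (n + M))%N.
  by apply: leq_trans (copy_off_top n1 (ltn_ord i)); rewrite ltn_add2l.
rewrite Rintegral_cst ?mul1r; last exact: mL.
exact: level_massE.
Qed.

Lemma tower_mass_le1 n : (1 <= n)%N -> (hgt n)%:R * level_mass n <= 1.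
Proof.
move=> n1; pose D := [set x | exists2 b, (b < hgt n)%N & L n b x].
have mD : measurable D.
  have -> : D = \bigcup_(b in [set b | (b < hgt n)%N]) L n b.
    by apply/seteqP; split => x /= [b bn Lb]; exists b.
  by apply: fin_bigcup_measurable => [|b bn]; [exact: finite_II | exact: mL].
have ID : mu.-integrable setT (EFin \o (cst (1 : R)) \_ D).
  rewrite -restrict_EFin -integrable_mkcond //.
  by apply: (integrableS measurableT) => //; apply: int1_cst.
have := tower_integral n1 ID; rewrite -Rintegral_mkcond Rintegral_cst // mul1r => E.
have : fine (mu D) <= 1.
  rewrite -lee_fin fineK; first exact: probability_le1.
  exact: fin_num_measure.
rewrite E; last first.
  by move=> x Hx; rewrite patchE ifF //; apply/negP; rewrite inE => -[b bn Lb]; apply: (Hx b).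
rewrite (eq_bigr (fun=> level_mass n)) => [|b _].
  by rewrite sumr_const card_ord mulr_natl.
transitivity (\int[mu]_(x in L n b) (1 : R)).
  apply: eq_Rintegral => x; rewrite inE => Lx.
  by rewrite patchE ifT // inE; exists b.
by rewrite Rintegral_cst ?mul1r ?level_massE //; apply: mL.
Qed.

Definition levfun n (g : X -> R) :=
  (forall a, (a < hgt n)%N -> forall x x', L n a x -> L n a x' -> g x = g x') /\
  (forall x, (forall a, (a < hgt n)%N -> ~ L n a x) -> g x = 0).

Lemma levfunS n g : (1 <= n)%N -> levfun n g -> levfun n.+1 g.
Proof.
move=> n1 [gc g0]; have split1 a x := @level_split n 1 a x n1.
have top i a : (i < copies p n 1)%N -> (a < hgt n)%N -> (copy_off n i + a < hgt n.+1)%N.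
  by move=> Hi an; have := copy_off_top n1 Hi; rewrite addn1; apply: leq_trans; rewrite ltn_add2l.
have sub b x x' : (b < hgt n.+1)%N -> L n.+1 b x -> L n.+1 b x' ->
    forall a, (a < hgt n)%N -> L n a x -> L n a x'.
  move=> bn Lx Lx' a an /(split1 _ _ an) [i Hi Li]; apply/(split1 _ _ an).
  exists i => //; move: Li; rewrite addn1 => Li.
  suff -> : (copy_off n i + a = b)%N by [].
  apply/eqP/negP => /negP ab; have : (L n.+1 (copy_off n i + a) `&` L n.+1 b) x by [].
  by rewrite disL // top.
split=> [b bn x x' Lx Lx'|x Hx]; last first.
  apply: g0 => a an /(split1 _ _ an) [i Hi]; rewrite addn1; apply: Hx; exact: top.
have [[a an La]|Hn] := pselect (exists2 a, (a < hgt n)%N & L n a x).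
  by apply: (gc a an) => //; apply: (sub b x).
rewrite !g0 // => a an La; apply: Hn; exists a => //.
exact: (sub b x').
Qed.

Lemma levfun_le n n' g : (1 <= n)%N -> (n <= n')%N -> levfun n g -> levfun n' g.
Proof.
move=> n1 /subnKC <- Hg; elim: (n' - n)%N => [|k IH]; first by rewrite addn0.
by rewrite addnS; apply: levfunS IH; rewrite (leq_trans n1) ?leq_addr.
Qed.

Lemma copy_offD n i t :
  copy_off n (i + t) = (copy_off n i + t * hgt n + gapsum p s n i t)%N.
Proof. by rewrite /copy_off gapsumD add0n; ring. Qed.

Section Correlation.
Variables (n M t W : nat) (z : int) (g h : X -> R) (Y : R).
Hypothesis n1 : (1 <= n)%N.
Hypothesis mg : measurable_fun setT g.
Hypothesis mh : measurable_fun setT h.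
Hypothesis gn : levfun n g.
Hypothesis hn : levfun n h.
Hypothesis gY : forall x, `|g x| <= Y.
Hypothesis hY : forall x, `|h x| <= Y.
Local Notation q := (copies p n M).
Local Notation w i := (gapsum p s n i t).
Hypothesis wW : forall i, (i < q - t)%N -> (w i <= W)%N.

Let passed x := g (zpow (z + (t * hgt n)%N%:Z) x) * h x.
Let shifted i x := g (zpow (z - (w i)%:Z) x) * h x.
Let Y0 : 0 <= Y := le_trans (normr_ge0 _) (gY point).
Let nM1 : (1 <= n + M)%N. Proof. by rewrite (leq_trans n1) ?leq_addr. Qed.

Let prod_bound k x : `|g (zpow k x) * h x| <= Y ^+ 2.
Proof. by rewrite normrM expr2 ler_pM. Qed.

Let prod_measurable k : measurable_fun setT (fun x => g (zpow k x) * h x).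
Proof.
apply: measurable_funM => //; apply: (measurableT_comp mg).
by case: (preserves_zpow TK mT mTinv k).
Qed.

Let top i b : (i < q)%N -> (b < hgt n)%N -> (copy_off n i + b < hgt (n + M))%N.
Proof. by move=> Hi bn; apply: leq_trans (copy_off_top n1 Hi); rewrite ltn_add2l. Qed.

Let sub i b x : (i < q)%N -> (b < hgt n)%N -> L (n + M) (copy_off n i + b) x -> L n b x.
Proof. by move=> Hi bn Lx; apply/(level_split M x n1 bn); exists i. Qed.

(* Away from the top of tower [n + M] and from the ends of tower [n], crossing
   [t] copies of tower [n] amounts to moving down by the spacers met. *)
Let passed_shifted i b : (i < q - t)%N -> (b < hgt n)%N ->
  (0 <= b%:Z + (z - (w i)%:Z) < (hgt n)%:Z)%R ->
  \int[mu]_(x in L (n + M) (copy_off n i + b)) passed x =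
  q%:R^-1 * \int[mu]_(x in L n b) shifted i x.
Proof.
move=> Hi bn; case Eb' : (b%:Z + (z - (w i)%:Z)) => [b'|//] /andP[_ b'n].
have {}b'n : (b' < hgt n)%N by [].
have Hiq : (i < q)%N by apply: leq_trans Hi (leq_subr _ _).
have Hit : (i + t < q)%N by rewrite addnC -ltn_subRL.
have q0 : q%:R != 0 :> R by rewrite pnatr_eq0 -lt0n copies_gt0.
have [c Hc] : exists c, (forall x, L n b x -> shifted i x = c) /\
    (forall x, L (n + M) (copy_off n i + b) x -> passed x = c).
  have [[x0 Lx0]|Hempty] := pselect (exists x, L n b x); last first.
    exists 0; split=> x Lx; case: Hempty; exists x => //.
    exact: (sub Hiq).
  have Lb' x : L n b x -> L n b' (zpow (z - (w i)%:Z) x) by exact: level_zpow.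
  exists (g (zpow (z - (w i)%:Z) x0) * h x0); split=> x Lx.
    by congr (_ * _); [apply: (gn.1 b') => //; apply: Lb' | apply: (hn.1 b)].
  have Lx' := sub Hiq bn Lx.
  congr (_ * _); last exact: (hn.1 b).
  apply: (gn.1 b') => //; last exact: Lb'.
  apply: (sub Hit) => //; apply: (level_zpow _ _ _ _ Lx); rewrite ?top //.
  by move: Eb'; rewrite copy_offD !PoszD => <-; lia.
case: Hc => Hs Hp.
rewrite (@eq_Rintegral _ _ _ mu _ (cst c)) => [|x]; last by rewrite inE => /Hp.
rewrite [X in _ = _ * X](@eq_Rintegral _ _ _ mu _ (cst c)) => [|x]; last by rewrite inE => /Hs.
have mLt := mL nM1 (top Hiq bn); have mLn := mL n1 bn.
rewrite !Rintegral_cst //.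
rewrite !level_massE // ?top // (level_mass_copies M n1).
by rewrite mulrCA [_^-1 * _]mulrA mulVf // mul1r.
Qed.

Let lm := level_mass (n + M).
Let lm0 : 0 <= lm. Proof. exact: level_mass_ge0. Qed.

Let term_bound i b : (i < q)%N -> (b < hgt n)%N ->
  `|\int[mu]_(x in L (n + M) (copy_off n i + b)) passed x -
    (i < q - t)%:R * (q%:R^-1 * \int[mu]_(x in L n b) shifted i x)| <=
  ((q - t <= i) + ((i < q - t)%N && ~~ (0 <= b%:Z + (z - (w i)%:Z) < (hgt n)%:Z)%R))%N%:R *
    (2 * Y ^+ 2 * lm).
Proof.
move=> Hi bn.
have K0 : 0 <= 2 * Y ^+ 2 * lm by rewrite !mulr_ge0 // exprn_ge0.
have B1 : `|\int[mu]_(x in L (n + M) (copy_off n i + b)) passed x| <= Y ^+ 2 * lm.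
  have mLt := mL nM1 (top Hi bn).
  apply: le_trans (Rintegral_bound mu mLt (prod_measurable (z + (t * hgt n)%N%:Z)) (prod_bound _)) _.
  by rewrite level_massE // top.
have q0 : q%:R != 0 :> R by rewrite pnatr_eq0 -lt0n copies_gt0.
have B2 : `|q%:R^-1 * \int[mu]_(x in L n b) shifted i x| <= Y ^+ 2 * lm.
  rewrite normrM normfV normr_nat -[leRHS](mulKf q0); apply: ler_wpM2l.
    by rewrite invr_ge0.
  apply: le_trans (Rintegral_bound mu (mL n1 bn) (prod_measurable (z - (w i)%:Z)) (prod_bound _)) _.
  by rewrite level_massE // (level_mass_copies M n1) mulrCA.
have [Hit|Hit] /= := ltnP i (q - t); last first.
  rewrite mul0r subr0 addn0 mul1r; apply: le_trans B1 _.
  by rewrite -mulrA ler_peMl ?mulr_ge0 ?exprn_ge0 // ler1n.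
rewrite mul1r add0n; case: (boolP (0 <= _ < _)) => Hb /=.
  by rewrite passed_shifted // subrr normr0 mul0r.
apply: le_trans (ler_normB _ _) _; apply: le_trans (lerD B1 B2) _.
by rewrite mul1r -mulr2n -mulrA mulr_natl.
Qed.

(** The integral splits over pairs (copy of tower [n], level). Bad pairs lie in the last [t] copies,
    of total mass at most [t / q], or are moved out of tower [n], at most [W + |z|] levels per copy.
    On a bad pair the two terms are bounded separately. *)
Lemma level_correlation :
  `|ip mu (fun x => g (zpow (z + (t * hgt n)%N%:Z) x)) h -
    q%:R^-1 * \sum_(i < q - t) ip mu (fun x => g (zpow (z - (w i)%:Z) x)) h| <=
  2 * Y ^+ 2 * (t%:R / q%:R + (W + `|z|)%N%:R * level_mass n).
Proof.
have q0 : 0 < q%:R :> R by rewrite ltr0n copies_gt0.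
have Iprod k : mu.-integrable setT (EFin \o (fun x => g (zpow k x) * h x)).
  exact: bounded_int1 (prod_measurable k) (prod_bound k).
have off k x : (forall a, (a < hgt n)%N -> ~ L n a x) -> g (zpow k x) * h x = 0.
  by move=> Hx; rewrite hn.2 // mulr0.
have -> : ip mu (fun x => g (zpow (z + (t * hgt n)%N%:Z) x)) h =
  \sum_(i < q) \sum_(b < hgt n) \int[mu]_(x in L (n + M) (copy_off n i + b)) passed x.
  rewrite exchange_big /= [LHS](tower_integral n1 (Iprod _) (off _)).
  by apply: eq_bigr => b _; apply: column_integral.
have -> : q%:R^-1 * \sum_(i < q - t) ip mu (fun x => g (zpow (z - (w i)%:Z) x)) h =
  \sum_(i < q) \sum_(b < hgt n) (i < q - t)%:R * (q%:R^-1 * \int[mu]_(x in L n b) shifted i x).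
  rewrite mulr_sumr (big_ord_widen q (fun i => q%:R^-1 * ip mu (fun x => g (zpow (z - (w i)%:Z) x)) h)) ?leq_subr //.
  rewrite big_mkcond; apply: eq_bigr => i _; rewrite -mulr_sumr -mulr_sumr.
  case: ifP => _; last by rewrite mul0r.
  by rewrite mul1r [X in _ * X](tower_integral n1 (Iprod _) (off _)).
rewrite -sumrB.
pose bad (i b : nat) := ((q - t <= i) +
  ((i < q - t)%N && ~~ (0 <= b%:Z + (z - (w i)%:Z) < (hgt n)%:Z)%R))%N.
apply: (@le_trans _ _ (\sum_(i < q) \sum_(b < hgt n) (bad i b)%:R * (2 * Y ^+ 2 * lm))).
  apply: le_trans (ler_norm_sum _ _ _) _; apply: ler_sum => i _.
  rewrite -sumrB; apply: le_trans (ler_norm_sum _ _ _) _; apply: ler_sum => b _.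
  exact: term_bound.
have count : (\sum_(i < q) \sum_(b < hgt n) bad i b <= t * hgt n + q * (W + `|z|))%N.
  have row i : (i < q)%N -> (\sum_(b < hgt n) bad i b <= (q - t <= i) * hgt n + (W + `|z|))%N.
    move=> Hi; rewrite /bad big_split /= leq_add //.
      by rewrite sum_nat_const card_ord mulnC.
    have [Hit|_] /= := ltnP i (q - t); last by rewrite big1.
    apply: leq_trans (count_out_of_tower _ _) _.
    by have := wW Hit; lia.
  apply: (@leq_trans (\sum_(i < q) ((q - t <= i) * hgt n + (W + `|z|)))%N).
    by apply: leq_sum => i _; apply: row.
  rewrite big_split /= sum_nat_const card_ord leq_add2r -big_distrl /= leq_mul2r.
  apply/orP; right.
  by apply: leq_trans (count_ge _ _) _; lia.
have -> : \sum_(i < q) \sum_(b < hgt n) (bad i b)%:R * (2 * Y ^+ 2 * lm) =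
    (\sum_(i < q) \sum_(b < hgt n) bad i b)%:R * (2 * Y ^+ 2 * lm).
  rewrite natr_sum mulr_suml; apply: eq_bigr => i _.
  by rewrite natr_sum mulr_suml.
have K0 : 0 <= 2 * Y ^+ 2 * lm by rewrite !mulr_ge0 // exprn_ge0.
apply: (@le_trans _ _ ((t * hgt n + q * (W + `|z|))%N%:R * (2 * Y ^+ 2 * lm))).
  by rewrite ler_wpM2r // ler_nat.
have Hlm : level_mass n = q%:R * lm by apply: level_mass_copies.
rewrite natrD !natrM Hlm.
have H1 := tower_mass_le1 n1; rewrite Hlm in H1.
have H2 : (hgt n)%:R * lm <= q%:R^-1.
  by rewrite -[leRHS]mul1r ler_pdivlMr // -mulrA [lm * _]mulrC.
have -> : (t%:R * (hgt n)%:R + q%:R * (W + `|z|)%:R) * (2 * Y ^+ 2 * lm) =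
  2 * Y ^+ 2 * (t%:R * ((hgt n)%:R * lm) + (W + `|z|)%:R * (q%:R * lm)) by ring.
apply: ler_wpM2l; first by rewrite mulr_ge0 // exprn_ge0.
by rewrite lerD2r ler_wpM2l.
Qed.

End Correlation.

End Towers.

Section L2Density.
Context (d : measure_display) (X : measurableType d) (R : realType).
Variable mu : probability X R.
Import HBNNSimple.

Lemma ip_sum_le (f g : X -> R) : L2 mu f -> L2 mu g ->
  ip mu (fun x => f x + g x) (fun x => f x + g x) <= 2 * (ip mu f f + ip mu g g).
Proof.
move=> Lf Lg; have := ip_ge0 mu (fun x => f x - g x).
have LD := L2D Lf Lg; have LB := L2B Lf Lg.
rewrite !ipBl // !(ipC mu _ (fun x => f x - g x)) !ipBl //.
rewrite !ipDl // !(ipC mu _ (fun x => f x + g x)) !ipDl //.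
by rewrite (ipC mu g f); lra.
Qed.

Lemma L2_indic (A : set X) : measurable A -> L2 mu (\1_A).
Proof.
move=> mA; apply: (bounded_L2 mu (B := 1)); first exact: measurable_indic.
by move=> x; rewrite indicE; case: (_ \in _); rewrite ?normr1 ?normr0.
Qed.

(** Induction over simple functions, then nonnegative ones by dominated convergence, then positive
    and negative parts. *)
Lemma L2_density (Q : (X -> R) -> Prop) :
  (forall A, measurable A -> Q (\1_A)) ->
  (forall f g, L2 mu f -> L2 mu g -> Q f -> Q g -> Q (fun x => f x + g x)) ->
  (forall a f, L2 mu f -> Q f -> Q (fun x => a * f x)) ->
  (forall f, L2 mu f -> (forall e : R, 0 < e -> exists g,
      [/\ L2 mu g, Q g & ip mu (fun x => f x - g x) (fun x => f x - g x) <= e]) -> Q f) ->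
  forall f, L2 mu f -> Q f.
Proof.
move=> Qind QD QZ Qlim.
have simple (g : {nnsfun X >-> R}) : L2 mu g /\ Q g.
  have [n [y ->]] : exists n (y : nat -> R),
      (g : X -> R) = (fun x => \sum_(i < n) (y i * \1_(g @^-1` [set y i]) x)).
    by eexists; exists (nth 0 (enum_fset (fset_set (g @` setT)))); apply/funext => x; exact: fimfunEord.
  elim: n => [|n [IH1 IH2]].
    have -> : (fun x => \sum_(i < 0) (y i * \1_(g @^-1` [set y i]) x)) =
      (fun x => 0 * \1_(set0 : set X) x) by apply/funext => x; rewrite big_ord0 mul0r.
    split; first exact/L2Z/L2_indic.
    by apply: QZ; [exact: L2_indic | exact: Qind].
  have -> : (fun x => \sum_(i < n.+1) (y i * \1_(g @^-1` [set y i]) x)) =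
    (fun x => \sum_(i < n) (y i * \1_(g @^-1` [set y i]) x) +
       y n * \1_(g @^-1` [set y n]) x).
    by apply/funext => x; rewrite big_ord_recr.
  have mA : measurable (g @^-1` [set y n]) by [].
  have Ln := L2_indic mA.
  split; first by apply: L2D => //; apply: L2Z.
  by apply: QD => //; [apply: L2Z | apply: QZ => //; apply: Qind].
have nonneg f : L2 mu f -> (forall x, 0 <= f x) -> Q f.
  move=> Lf f0; apply: Qlim => // e e0.
  have mf : measurable_fun setT (EFin \o f) by apply/measurable_EFinP; case: Lf.
  pose g := nnsfun_approx measurableT mf.
  have gle n x : g n x <= f x.
    rewrite -lee_fin /g nnsfun_approxE; apply: le_approx => // y _.
    by rewrite /= lee_fin.
  have g0 n x : 0 <= g n x by [].
  have gcvg x : g n x @[n --> \oo] --> f x.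
    have := @cvg_nnsfun_approx _ _ _ _ measurableT _ mf (fun x _ => f0 x) x I.
    by move/fine_cvgP => [].
  have Lg n := (simple (g n)).1.
  pose F n x := ((f x - g n x) ^+ 2)%:E.
  have mF n : measurable_fun setT (F n).
    by apply/measurable_EFinP/measurable_funX; have [] := L2B Lf (Lg n).
  have cF : {ae mu, forall x, setT x -> F ^~ x @ \oo --> (cst 0%E : X -> \bar R) x}.
    apply: aeW => x _; apply: cvg_EFin; first exact: nearW.
    rewrite /= (_ : 0 = (f x - f x) ^+ 2); last by rewrite subrr expr0n.
    rewrite expr2 (_ : _ \o _ = (fun n => (f x - g n x) * (f x - g n x))); last first.
      by apply/funext => n; rewrite /= expr2.
    by apply: cvgM; apply: cvgB; do ?[exact: cvg_cst | exact: gcvg].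
  have dF : {ae mu, forall x n, setT x -> (`|F n x| <= (f x ^+ 2)%:E)%E}.
    apply: aeW => x n _; rewrite /= lee_fin normrX lerXn2r ?nnegrE //.
    by rewrite ger0_norm ?subr_ge0 // lerBlDr lerDl.
  have [_ _ H] := dominated_convergence measurableT mF (measurable_cst _) cF Lf.2 dF.
  rewrite integral0 in H.
  have /fine_cvgP[_ /cvgrPdist_le /(_ _ e0) [n _ Hn]] := H.
  exists (g n); split=> //; first exact: (simple (g n)).2.
  have := Hn n (leqnn n); rewrite /= sub0r normrN => /(le_trans (ler_norm _)).
  by congr (_ <= _); congr fine; apply: eq_integral => x _; rewrite expr2.
move=> f Lf; have [mf _] := Lf.
pose fp x := 2^-1 * (`|f x| + f x); pose fn x := 2^-1 * (`|f x| + -1 * f x).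
have Labs : L2 mu (fun x => `|f x|).
  split; first exact: measurableT_comp.
  have -> : (fun x => `|f x| ^+ 2) = (fun x => f x ^+ 2).
    by apply/funext => x; rewrite real_normK ?num_real.
  by case: Lf.
have Lfp : L2 mu fp by apply/L2Z/L2D.
have Lfn : L2 mu fn by apply/L2Z/L2D => //; exact: L2Z.
have -> : f = (fun x => fp x + -1 * fn x).
  by apply/funext => x; rewrite /fp /fn; field.
have fpn : Q fp.
  apply: nonneg => // x; apply: mulr_ge0 => //.
  by have := ler_norm (- f x); rewrite normrN; lra.
apply: QD => //; first exact: L2Z.
apply: QZ => //; apply: nonneg => // x; rewrite mulr_ge0 // mulN1r subr_ge0.
exact: ler_norm.
Qed.

End L2Density.

(** * Archimedean property and completeness of the complex numbers *)

Section ComplexNumbers.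
Variable R : realType.
Implicit Types (x y : R[i]) (a b : R).
Local Notation C := (R[i] : numClosedFieldType).

Lemma complex_ge0 x : 0 <= x -> x = (complex.Re x)%:C%C.
Proof. by case: x => a b; rewrite lecE /= => /andP[/eqP ->]. Qed.

Lemma complex_archi x : 0 <= x -> exists n, x <= n%:R.
Proof.
move=> x0; have [n Hn] : exists n : nat, complex.Re x <= n%:R.
  exists (Num.bound (complex.Re x)); apply: ltW; apply: archi_boundP.
  by move: x0; rewrite lecE => /andP[].
by exists n; rewrite (complex_ge0 x0) -(rmorph_nat (real_complex R)) lecR.
Qed.

Lemma complex_norm_le x a b : `|complex.Re x| <= a -> `|complex.Im x| <= b ->
  `|x| <= (a + b)%:C%C.
Proof.
move=> Ha Hb; have a0 := le_trans (normr_ge0 _) Ha; have b0 := le_trans (normr_ge0 _) Hb.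
rewrite normc_def lecR.
rewrite -[leRHS]ger0_norm ?addr_ge0 // -sqrtr_sqr ler_wsqrtr //.
rewrite -[complex.Re x ^+ 2]real_normK ?num_real // -[complex.Im x ^+ 2]real_normK ?num_real //.
have := lerXn2r 2 (normr_ge0 _) a0 Ha; have := lerXn2r 2 (normr_ge0 _) b0 Hb.
have := mulr_ge0 a0 b0; rewrite sqrrD mulr2n; lra.
Qed.

Lemma complex_norm_ge_Re x : (`|complex.Re x|)%:C%C <= `|x|.
Proof.
rewrite normc_def lecR -sqrtr_sqr ler_wsqrtr // lerDl sqr_ge0 //.
Qed.

Lemma complex_norm_ge_Im x : (`|complex.Im x|)%:C%C <= `|x|.
Proof.
rewrite normc_def lecR -sqrtr_sqr ler_wsqrtr // lerDr sqr_ge0 //.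
Qed.

Lemma real_complete (v : nat -> R) :
  (forall e : R, 0 < e -> exists N, forall n, (N <= n)%N -> `|v n - v N| <= e) ->
  cvg (v n @[n --> \oo]).
Proof.
move=> H; apply/cauchy_cvgP/cauchy_ballP => e e0; near_simpl.
have [N HN] := H (e / 4) (divr_gt0 e0 (ltr0n _ 4)).
exists ([set n | (N <= n)%N], [set n | (N <= n)%N]); first by split; exists N.
move=> [m n] /= [Hm Hn]; rewrite /ball /=.
have -> : v m - v n = (v m - v N) - (v n - v N) by ring.
apply: le_lt_trans (ler_normD _ _) _; rewrite normrN.
have := HN _ Hm; have := HN _ Hn; lra.
Qed.

Lemma complex_complete (u : nat -> C) :
  (forall e : C, 0 < e -> exists N, forall n, (N <= n)%N -> `|u n - u N| <= e) ->
  cvg (u n @[n --> \oo]).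
Proof.
move=> H.
have He (e : R) : 0 < e -> exists N, forall n, (N <= n)%N -> `|u n - u N| <= e%:C%C.
  by move=> e0; apply: H; rewrite ltcR.
have cR : cvg ((complex.Re (u n) : R) @[n --> \oo]).
  apply: real_complete => e /He [N HN]; exists N => n /HN H1.
  by rewrite -lecR; apply: le_trans H1; rewrite -raddfB; apply: complex_norm_ge_Re.
have cI : cvg ((complex.Im (u n) : R) @[n --> \oo]).
  apply: real_complete => e /He [N HN]; exists N => n /HN H1.
  by rewrite -lecR; apply: le_trans H1; rewrite -raddfB; apply: complex_norm_ge_Im.
set a := lim ((complex.Re (u n) : R) @[n --> \oo]) in cR.
set b := lim ((complex.Im (u n) : R) @[n --> \oo]) in cI.
apply/cvg_ex; exists ((a +i* b)%C : C); apply/cvgrPdist_le => e e0.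
have e2 : 0 < complex.Re e / 2 by rewrite divr_gt0 //; move: e0; rewrite ltcE => /andP[].
have Ee : e = (complex.Re e / 2 + complex.Re e / 2)%:C%C.
  by rewrite -splitr; apply: complex_ge0; apply: ltW.
move/cvgrPdist_le : cR => /(_ _ e2) H1; move/cvgrPdist_le : cI => /(_ _ e2) H2.
near=> n; rewrite Ee; apply: complex_norm_le; rewrite raddfB /=.
- by near: n.
- by near: n.
Unshelve. all: by end_near. Qed.

End ComplexNumbers.

(** The exponents [w i] may repeat: an expectation under a law is computed as an average over
    samples. *)
Lemma sum_coef_sumXn (C : nzRingType) (a : C) (N : nat) (w : nat -> nat) (phi : nat -> C) :
  let F := a *: \sum_(i < N) 'X^(w i) in
  \sum_(r < size F) F`_r * phi r = a * \sum_(i < N) phi (w i).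
Proof.
move=> F; pose n := maxn (size F) (\max_(i < N) (w i).+1).
transitivity (\sum_(r < n) F`_r * phi r).
  rewrite (big_ord_widen n (fun r => F`_r * phi r)) ?leq_maxl // big_mkcond.
  by apply: eq_bigr => r _; case: ltnP => // Hr; rewrite nth_default ?mul0r.
transitivity (\sum_(r < n) \sum_(i < N) a * ((r == w i :> nat)%:R * phi r)).
  apply: eq_bigr => r _; rewrite coefZ coef_sum -mulr_sumr -mulrA; congr (a * _).
  by rewrite mulr_suml; apply: eq_bigr => i _; rewrite coefXn.
rewrite exchange_big mulr_sumr; apply: eq_bigr => i _ /=.
have wn : (w i < n)%N by rewrite leq_max (leq_bigmax i) orbT.
rewrite (bigD1 (Ordinal wn)) //= eqxx mul1r big1 ?addr0 // => r Hr.
case: eqP => E; last by rewrite mul0r mulr0.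
by case/eqP: Hr; apply: val_inj.
Qed.

(** * Correlations *)

Lemma gap_shift p s n l i :
  gap (fun l => p (n + l)%N) (fun l => s (n + l)%N) l i = gap p s (n + l) i.
Proof.
rewrite /gap; move: (i.+1) => f; elim: f l i => // f IH l i /=.
by case: ifP => // _; rewrite IH addnS.
Qed.

Section CorrelationLimit.
Context (d : measure_display) (X : measurableType d) (R : realType).
Variables (mu : probability X R) (T Tinv : X -> X).
Hypothesis TK : cancel T Tinv.
Hypothesis TinvK : cancel Tinv T.
Hypothesis mT : preserves mu T.
Hypothesis mTinv : measurable_fun setT Tinv.
Variables (p : nat -> nat) (s : nat -> nat -> nat) (L : nat -> nat -> set X).
Hypothesis p2 : forall n, (1 < p n)%N.
Local Notation hgt := (hgt p s).
Hypothesis mL : forall n k, (1 <= n)%N -> (k < hgt n)%N -> measurable (L n k).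
Hypothesis disL : forall n k k', (1 <= n)%N -> (k < hgt n)%N -> (k' < hgt n)%N ->
  k != k' -> L n k `&` L n k' = set0.
Hypothesis TL : forall n k, (1 <= n)%N -> (k.+1 < hgt n)%N -> T @` L n k = L n k.+1.
Hypothesis cutL : forall n k, (1 <= n)%N -> (k < hgt n)%N ->
  L n k = \bigcup_(i in [set i | (i < p n)%N]) L n.+1 (col_off p s n i + k)%N.
Hypothesis genL : forall A, measurable A -> forall eps : R, 0 < eps ->
  exists n, (1 <= n)%N /\ exists K : set nat, K `<=` [set k | (k < hgt n)%N] /\
    (mu ((A `\` \bigcup_(k in K) L n k) `|` (\bigcup_(k in K) L n k `\` A)) < eps%:E)%E.
Local Notation zpow := (zpow T Tinv).
Local Notation levfun := (levfun p s L).

Definition level_approx (g : X -> R) := forall e : R, 0 < e ->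
  exists n (g' : X -> R) (Y : R), [/\ (1 <= n)%N, levfun n g', measurable_fun setT g',
    forall x, `|g' x| <= Y & ip mu (fun x => g x - g' x) (fun x => g x - g' x) <= e].

Lemma L2_level_approx g : L2 mu g -> level_approx g.
Proof.
move: g; apply: L2_density => [A mA|f g Lf Lg Af Ag|a f Lf Af|f Lf Af] e e0.
- have [n [n1 [K [Kn HK]]]] := genL mA e0.
  set B := \bigcup_(k in K) L n k in HK.
  have mB : measurable B.
    apply: fin_bigcup_measurable => [|k kK]; last by apply: mL => //; apply: Kn.
    by apply: sub_finite_set Kn _; apply: finite_II.
  exists n, (\1_B), 1; split=> //.
  + split=> [a an x x' Lx Lx'|x Hx]; last first.
      by rewrite indicE memNset // => -[k kK Lk]; apply: (Hx k) => //; apply: Kn.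
    rewrite !indicE; have [aK|aK] := pselect (K a).
      by rewrite !mem_set //; exists a.
    have out y : L n a y -> ~ B y.
      move=> La [k kK Lk]; have : (L n k `&` L n a) y by [].
      rewrite (disL n1 (Kn k kK) an) //.
      by apply/eqP => E; apply: aK; rewrite -E.
    by rewrite !memNset //; apply: out.
  + by move=> x; rewrite indicE; case: (_ \in _); rewrite ?normr1 ?normr0.
  set D := (_ `|` _) in HK.
  have mD : measurable D by apply: measurableU; apply: measurableD.
  have -> : ip mu (fun x => \1_A x - \1_B x) (fun x => \1_A x - \1_B x) =
      \int[mu]_(x in D) (1 : R).
    rewrite Rintegral_mkcond; apply: eq_Rintegral => x _ /=.
    rewrite patchE !indicE /D in_setU !in_setD.
    by case: (x \in A); case: (x \in B) => /=; rewrite ?subrr ?subr0 ?sub0r ?mulr1 ?mulr0 ?mulrNN ?mulr1.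
  rewrite Rintegral_cst // mul1r -lee_fin fineK; first exact: ltW.
  exact: fin_num_measure.
- have e4 : 0 < e / 4 by rewrite divr_gt0.
  have [n [f' [Y [n1 lf mf fY Hf]]]] := Af _ e4.
  have [m [g' [Z [m1 lg mg gZ Hg]]]] := Ag _ e4.
  exists (maxn n m), (fun x => f' x + g' x), (Y + Z); split.
  + by rewrite leq_max n1.
  + have [c1 z1] := levfun_le p2 disL cutL n1 (leq_maxl n m) lf.
    have [c2 z2] := levfun_le p2 disL cutL m1 (leq_maxr n m) lg.
    split=> [a an x x' Lx Lx'|x Hx]; last by rewrite z1 // z2 // addr0.
    by rewrite (c1 a an x x') // (c2 a an x x').
  + exact: measurable_funD.
  + by move=> x; apply: le_trans (ler_normD _ _) _; apply: lerD.
  have Lf' := bounded_L2 mu mf fY; have Lg' := bounded_L2 mu mg gZ.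
  have := ip_sum_le (L2B Lf Lf') (L2B Lg Lg').
  rewrite (_ : (fun x => f x - f' x + (g x - g' x)) = (fun x => f x + g x - (f' x + g' x))).
    by move/le_trans; apply; lra.
  by apply/funext => x; ring.
- have a0 : 0 < a ^+ 2 + 1 by rewrite ltr_wpDl ?sqr_ge0.
  have [n [f' [Y [n1 [cf zf] mf fY Hf]]]] := Af _ (divr_gt0 e0 a0).
  exists n, (fun x => a * f' x), (`|a| * Y); split=> //.
  + split=> [b bn x x' Lx Lx'|x Hx]; first by rewrite (cf b bn x x').
    by rewrite zf // mulr0.
  + exact: measurable_funM.
  + by move=> x; rewrite normrM ler_wpM2l.
  have Lf' := bounded_L2 mu mf fY; have Lr := L2B Lf Lf'.
  rewrite (_ : (fun x => a * f x - a * f' x) = (fun x => a * (f x - f' x))); last first.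
    by apply/funext => x; ring.
  rewrite ipZl //; last exact: L2Z.
  rewrite ipC ipZl // mulrA -expr2.
  move: Hf; rewrite ler_pdivlMr // => /(le_trans _); apply.
  by rewrite mulrC ler_wpM2l ?ip_ge0 // lerDl.
- have e4 : 0 < e / 4 by rewrite divr_gt0.
  have [g [Lg Ag Hg]] := Af _ e4.
  have [n [g' [Y [n1 lg mg gY Hg']]]] := Ag _ e4.
  exists n, g', Y; split=> //.
  have Lg' := bounded_L2 mu mg gY.
  have := ip_sum_le (L2B Lf Lg) (L2B Lg Lg').
  rewrite (_ : (fun x => f x - g x + (g x - g' x)) = (fun x => f x - g' x)).
    by move/le_trans; apply; lra.
  by apply/funext => x; ring.
Qed.

Definition corr g h z := ip mu (fun x => g (zpow z x)) h.

Let pz z := preserves_zpow TK mT mTinv z.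

Lemma corr_le g h z (a : R) : 0 < a -> L2 mu g -> L2 mu h ->
  `|corr g h z| <= a^-1 * ip mu g g + a * ip mu h h.
Proof.
move=> a0 Lg Lh; apply: le_trans (ip_le a0 (preserves_L2 (pz z) Lg) Lh) _.
by rewrite (preserves_ip (pz z) Lg Lg).
Qed.

Lemma corrBl g g' h z : L2 mu g -> L2 mu g' -> L2 mu h ->
  corr (fun x => g x - g' x) h z = corr g h z - corr g' h z.
Proof. by move=> Lg Lg' Lh; apply: ipBl => //; apply: (preserves_L2 (pz z)). Qed.

Lemma corrBr g h h' z : L2 mu g -> L2 mu h -> L2 mu h' ->
  corr g (fun x => h x - h' x) z = corr g h z - corr g h' z.
Proof.
move=> Lg Lh Lh'; have Lgz := preserves_L2 (pz z) Lg.
by rewrite /corr ipC ipBl // !(ipC mu _ (fun x => g (zpow z x))).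
Qed.

Variables (P : nat -> nat) (S : nat -> nat -> nat) (nn : nat -> nat) (t : nat).
Hypothesis P2 : forall l, (1 < P l)%N.
Hypothesis nn_large : forall N, exists K, forall k, (K <= k)%N -> (N <= nn k)%N.
Hypothesis stable : forall l, exists K, forall k, (K <= k)%N ->
  p (nn k + l)%N = P l /\ forall j, (j < P l)%N -> s (nn k + l)%N j = S l j.
Local Notation q M := (copies P 0 M).
Local Notation w i := (gapsum P S 0 i t).

(** How far [U^(t h)], for [h] the height of tower [nn k], is from the truncation at [M] of its weak
    limit, read on one correlation. *)
Definition corr_gap g h M k z : R := corr g h (z + (t * hgt (nn k))%N%:Z) -
  (q M)%:R^-1 * \sum_(i < q M - t) corr g h (z - (w i)%:Z).

Let q0 M : 0 < (q M)%:R :> R. Proof. by rewrite ltr0n copies_gt0. Qed.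

Lemma corr_gap_le g h M k z (a : R) : 0 < a -> L2 mu g -> L2 mu h ->
  `|corr_gap g h M k z| <= 2 * (a^-1 * ip mu g g + a * ip mu h h).
Proof.
move=> a0 Lg Lh; set b := _ + _; apply: le_trans (ler_normB _ _) _.
have b0 : 0 <= b.
  by rewrite addr_ge0 // mulr_ge0 ?ip_ge0 ?invr_ge0 // ltW.
have -> : 2 * b = b + b by ring.
apply: lerD; first exact: corr_le.
rewrite normrM normfV normr_nat -ler_pdivlMl ?invr_gt0 // invrK.
apply: le_trans (ler_norm_sum _ _ _) _.
apply: (@le_trans _ _ (\sum_(i < q M - t) b)); first by apply: ler_sum => i _; apply: corr_le.
by rewrite sumr_const card_ord -[_ *+ _]mulr_natl ler_wpM2r // ler_nat leq_subr.
Qed.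

Lemma corr_gapBl g g' h M k z : L2 mu g -> L2 mu g' -> L2 mu h ->
  corr_gap (fun x => g x - g' x) h M k z = corr_gap g h M k z - corr_gap g' h M k z.
Proof.
move=> Lg Lg' Lh; rewrite /corr_gap corrBl //.
under eq_bigr => i _ do rewrite corrBl //.
by rewrite sumrB; ring.
Qed.

Lemma corr_gapBr g h h' M k z : L2 mu g -> L2 mu h -> L2 mu h' ->
  corr_gap g (fun x => h x - h' x) M k z = corr_gap g h M k z - corr_gap g h' M k z.
Proof.
move=> Lg Lh Lh'; rewrite /corr_gap corrBr //.
under eq_bigr => i _ do rewrite corrBr //.
by rewrite sumrB; ring.
Qed.

Lemma stable_upto M : exists K, forall k, (K <= k)%N -> (1 <= nn k)%N ->
  copies p (nn k) M = q M /\
  forall i, (i + t < q M)%N -> gapsum p s (nn k) i t = w i.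
Proof.
have [K HK] : exists K, forall l, (l < M)%N -> forall k, (K <= k)%N ->
    p (nn k + l)%N = P l /\ forall j, (j < P l)%N -> s (nn k + l)%N j = S l j.
  elim: M => [|M [K HK]]; first by exists 0%N.
  have [K' HK'] := stable M; exists (maxn K K') => l; rewrite ltnS leq_eqVlt.
  move=> /orP[/eqP ->|lM] k; rewrite geq_max => /andP[h1 h2]; first exact: HK'.
  exact: HK.
exists K => k Kk n1; split.
  by apply: eq_bigr => l _; have [-> _] := HK l (ltn_ord l) k Kk.
move=> i Hi; apply: eq_bigr => u _.
rewrite -[nn k]addn0 -gap_shift; symmetry; apply: (@eq_gap _ _ _ _ M) => //.
  move=> l lM; have [E1 E2] := HK l lM k Kk; rewrite !add0n; split=> [|j Hj]; first by rewrite E1.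
  by rewrite E2.
by have := ltn_ord u; lia.
Qed.

(** [M] alone controls the end effect [t / q], uniformly in [z]. A large [k] then makes the levels
    so small that the fixed shift [W + |z|] is negligible. *)
Lemma corr_gap_levfun n g h (Y e : R) : (1 <= n)%N -> levfun n g -> levfun n h ->
  measurable_fun setT g -> measurable_fun setT h ->
  (forall x, `|g x| <= Y) -> (forall x, `|h x| <= Y) -> 0 < e ->
  exists M0, forall M, (M0 <= M)%N -> forall z, exists K, forall k, (K <= k)%N ->
    `|corr_gap g h M k z| <= e.
Proof.
move=> n1 lg lh mg mh gY hY e0.
have [M0 HM0] := nat_above (4 * Y ^+ 2 * t%:R / e).
exists M0 => M HM z.
have [K1 HK1] := stable_upto M.
pose W := (\sum_(i < q M - t) w i)%N.
have [N HN] := nat_above (4 * Y ^+ 2 * (W + `|z|)%N%:R / e).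
have [K2 HK2] := nn_large (maxn n N.+1).
exists (maxn K1 K2) => k; rewrite geq_max => /andP[/HK1 H1 /HK2].
rewrite geq_max => /andP[nk Nk]; have nk1 : (1 <= nn k)%N by apply: leq_trans nk.
have [Eq Ew] := H1 nk1.
have wW i : (i < copies p (nn k) M - t)%N -> (gapsum p s (nn k) i t <= W)%N.
  rewrite Eq => Hi; rewrite Ew; last by rewrite addnC -ltn_subRL.
  by rewrite /W (bigD1 (Ordinal Hi)) //= leq_addr.
have := level_correlation TK TinvK mT mTinv p2 mL disL TL cutL z nk1 mg mh
  (levfun_le p2 disL cutL n1 nk lg) (levfun_le p2 disL cutL n1 nk lh) gY hY wW.
rewrite Eq => Hlev.
have -> : corr_gap g h M k z = ip mu (fun x => g (zpow (z + (t * hgt (nn k))%N%:Z) x)) h -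
   (q M)%:R^-1 * \sum_(i < q M - t) ip mu (fun x => g (zpow (z - (gapsum p s (nn k) i t)%:Z) x)) h.
  rewrite /corr_gap; congr (_ - _ * _); apply: eq_bigr => i _.
  by rewrite Ew // addnC -ltn_subRL.
apply: le_trans Hlev _.
have Y2 : 0 <= Y ^+ 2 by rewrite exprn_ge0 // (le_trans (normr_ge0 _) (gY point)).
have B1 : 2 * Y ^+ 2 * (t%:R / (q M)%:R) <= e / 2.
  rewrite mulrA ler_pdivrMr //.
  have : M0%:R <= (q M)%:R :> R.
    rewrite ler_nat; apply: leq_trans (copies_ge P2 _ _).
    by apply: leq_trans HM _; apply: ltnW; apply: ltn_expl.
  move=> H; have := lt_le_trans HM0 H; rewrite ltr_pdivrMr //; lra.
have B2 : 2 * Y ^+ 2 * ((W + `|z|)%N%:R * level_mass mu L (nn k)) <= e / 2.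
  have Hm := tower_mass_le1 TK TinvK mT mTinv p2 mL disL TL nk1.
  have Hh : N%:R <= (hgt (nn k))%:R :> R.
    by rewrite ler_nat; apply: leq_trans (ltnW Nk) (hgt_ge s p2 nk1).
  have lm0 : 0 <= level_mass mu L (nn k) by apply: level_mass_ge0.
  have H2 : 4 * Y ^+ 2 * (W + `|z|)%N%:R <= (hgt (nn k))%:R * e.
    by move: HN; rewrite ltr_pdivrMr // => /ltW/le_trans; apply; rewrite ler_wpM2r // ltW.
  have := ler_wpM2r lm0 H2; have := ler_wpM2r (ltW e0) Hm; lra.
by rewrite mulrDr; lra.
Qed.

(** [M0] has to be found before [z]; approximation by level functions allows this because
    [corr_gap_le] is uniform in [M], [k] and [z]. *)
Theorem corr_gap_limit g h (e : R) : L2 mu g -> L2 mu h -> 0 < e ->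
  exists M0, forall M, (M0 <= M)%N -> forall z, exists K, forall k, (K <= k)%N ->
    `|corr_gap g h M k z| <= e.
Proof.
move=> Lg Lh e0.
pose dh := e / (12 * (ip mu h h + 1)).
have hh0 := ip_ge0 mu h.
have hh : 0 < 12 * (ip mu h h + 1) by rewrite mulr_gt0 // ltr_wpDl.
have dh0 : 0 < dh by rewrite divr_gt0.
have e12 : 0 < e / 12 by rewrite divr_gt0.
have [n [g' [Y [n1 lg mg gY Hg]]]] := L2_level_approx Lg (mulr_gt0 dh0 e12).
have Lg' := bounded_L2 mu mg gY.
have gg0 := ip_ge0 mu g'.
have gg : 0 < 12 * (ip mu g' g' + 1) by rewrite mulr_gt0 // ltr_wpDl.
(* [h] is approximated after [g'], since the weight depends on the norm of [g']. Each of the two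
   replacements costs [2 * (e / 12 + e / 12) = e / 3]. *)
pose dg := 12 * (ip mu g' g' + 1) / e.
have dg0 : 0 < dg by rewrite divr_gt0.
have dgV0 : 0 < e / 12 / dg by rewrite divr_gt0.
have [m [h' [Z [m1 lh mh hZ Hh]]]] := L2_level_approx Lh dgV0.
have Lh' := bounded_L2 mu mh hZ.
have e3 : 0 < e / 3 by rewrite divr_gt0.
have Y0 : 0 <= Y := le_trans (normr_ge0 _) (gY point).
have Z0 : 0 <= Z := le_trans (normr_ge0 _) (hZ point).
have gYZ x : `|g' x| <= Y + Z by apply: le_trans (gY x) _; rewrite lerDl.
have hYZ x : `|h' x| <= Y + Z by apply: le_trans (hZ x) _; rewrite lerDr.
have nm1 : (1 <= maxn n m)%N by rewrite leq_max n1.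
have [M0 HM0] := corr_gap_levfun nm1 (levfun_le p2 disL cutL n1 (leq_maxl n m) lg)
  (levfun_le p2 disL cutL m1 (leq_maxr n m) lh) mg mh gYZ hYZ e3.
exists M0 => M HM z; have [K HK] := HM0 M HM z; exists K => k Kk.
have H3 := HK k Kk.
have Lr := L2B Lg Lg'; have Ls := L2B Lh Lh'.
have H1 : `|corr_gap (fun x => g x - g' x) h M k z| <= e / 3.
  apply: le_trans (corr_gap_le M k z dh0 Lr Lh) _.
  have A1 : dh^-1 * ip mu (fun x => g x - g' x) (fun x => g x - g' x) <= e / 12.
    by rewrite ler_pdivrMl.
  have A2 : dh * ip mu h h <= e / 12.
    rewrite /dh -mulrA ler_pM2l // -ler_pdivlMl ?invr_gt0 // invrK.
    by have := hh0; lra.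
  lra.
have H2 : `|corr_gap g' (fun x => h x - h' x) M k z| <= e / 3.
  apply: le_trans (corr_gap_le M k z dg0 Lg' Ls) _.
  have A1 : dg * ip mu (fun x => h x - h' x) (fun x => h x - h' x) <= e / 12.
    by move: Hh; rewrite ler_pdivlMr // mulrC.
  have A2 : dg^-1 * ip mu g' g' <= e / 12.
    rewrite ler_pdivrMl //.
    have -> : dg * (e / 12) = ip mu g' g' + 1 by rewrite /dg; field; rewrite gt_eqF.
    by rewrite lerDl.
  lra.
have -> : corr_gap g h M k z = corr_gap (fun x => g x - g' x) h M k z +
    corr_gap g' (fun x => h x - h' x) M k z + corr_gap g' h' M k z.
  by rewrite corr_gapBl // corr_gapBr //; ring.
apply: le_trans (ler_normD _ _) _; have := ler_normD (corr_gap (fun x => g x - g' x) h M k z)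
  (corr_gap g' (fun x => h x - h' x) M k z); lra.
Qed.

Section ComplexCorrelations.
Variables g h : X -> R.
Hypothesis Lg : L2 mu g.
Hypothesis Lh : L2 mu h.
Local Notation C := (R[i] : numClosedFieldType).

(** This is [<U^z f, f>] for [f = g + i h]. *)
Definition complex_corr (z : int) : C :=
  ((corr g g z + corr h h z) +i* (corr h g z - corr g h z))%C.

Lemma corr_zpow u v (l i : int) : L2 mu u -> L2 mu v ->
  corr u v (l - i) = ip mu (fun x => u (zpow l x)) (fun x => v (zpow i x)).
Proof.
move=> Lu Lv; rewrite /corr -(preserves_ip (pz i) (preserves_L2 (pz (l - i)) Lu) Lv).
congr (ip mu _ _); apply/funext => x.
by rewrite -zpowD // subrK.
Qed.

Lemma corrN u v z : L2 mu u -> L2 mu v -> corr u v (- z) = corr v u z.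
Proof.
by move=> Lu Lv; rewrite -[- z]add0r corr_zpow // ipC.
Qed.

Lemma complex_corrN z : complex_corr (- z) = (complex_corr z)^*.
Proof.
rewrite /complex_corr !corrN //.
transitivity ((corr g g z + corr h h z) -i* (corr h g z - corr g h z) : C)%C => //.
by rewrite opprB.
Qed.

Lemma L2_sum n (F : nat -> X -> R) : (forall i, L2 mu (F i)) ->
  L2 mu (fun x => \sum_(i < n) F i x).
Proof.
move=> LF; elim: n => [|n IH].
  by under eq_fun do rewrite big_ord0; apply: (@bounded_L2 _ _ _ _ _ 0) => // x; rewrite normr0.
by under eq_fun do rewrite big_ord_recr /=; apply: L2D.
Qed.

Lemma ip_suml n (F : nat -> X -> R) v : (forall i, L2 mu (F i)) -> L2 mu v ->
  ip mu (fun x => \sum_(i < n) F i x) v = \sum_(i < n) ip mu (F i) v.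
Proof.
move=> LF Lv; elim: n => [|n IH].
  rewrite big_ord0 -[RHS](mul0r (ip mu (F 0%N) v)) -ipZl //.
  by congr (ip mu _ _); apply/funext => x; rewrite big_ord0 mul0r.
rewrite big_ord_recr /= -IH -ipDl //; last exact: L2_sum.
by congr (ip mu _ _); apply/funext => x; rewrite big_ord_recr.
Qed.

Lemma ip_sum_sum n (F : nat -> X -> R) : (forall i, L2 mu (F i)) ->
  ip mu (fun x => \sum_(i < n) F i x) (fun x => \sum_(i < n) F i x) =
  \sum_(i < n) \sum_(l < n) ip mu (F l) (F i).
Proof.
move=> LF; rewrite ip_suml //; last exact: L2_sum.
rewrite exchange_big /=; apply: eq_bigr => i _; rewrite ipC ip_suml //.
by apply: eq_bigr => l _; rewrite ipC.
Qed.

(* The form is the squared norm of the function [sum (u_l)^* U^l (g + ih)]. *)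
Lemma complex_corr_form_ge0 u : 0 <= form complex_corr u u.
Proof.
pose V l x := complex.Re u`_l * g (zpow l%:Z x) + complex.Im u`_l * h (zpow l%:Z x).
pose W l x := complex.Re u`_l * h (zpow l%:Z x) - complex.Im u`_l * g (zpow l%:Z x).
have Lgl (l : nat) : L2 mu (fun x => g (zpow l%:Z x)) := preserves_L2 (pz l%:Z) Lg.
have Lhl (l : nat) : L2 mu (fun x => h (zpow l%:Z x)) := preserves_L2 (pz l%:Z) Lh.
have LV l : L2 mu (V l) by apply: L2D; apply: L2Z.
have LW l : L2 mu (W l) by apply: L2B; apply: L2Z.
have : (form complex_corr u u)^* = form complex_corr u u.
  by rewrite -form_conj //; apply: complex_corrN.
have : 0 <= complex.Re (form complex_corr u u); last first.
  by case: (form _ _ _) => a b /= a0 [Eb]; rewrite lecE /= a0 andbT; apply/eqP; lra.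
suff -> : complex.Re (form complex_corr u u) =
    ip mu (fun x => \sum_(i < size u) V i x) (fun x => \sum_(i < size u) V i x) +
    ip mu (fun x => \sum_(i < size u) W i x) (fun x => \sum_(i < size u) W i x).
  by rewrite addr_ge0 ?ip_ge0.
rewrite !ip_sum_sum // /form raddf_sum -big_split; apply: eq_bigr => i _ /=.
rewrite raddf_sum -big_split; apply: eq_bigr => l _ /=.
rewrite /V /W ipDl ?ipBl //; try by [apply: L2Z | apply: L2D; apply: L2Z | apply: L2B; apply: L2Z].
rewrite !ipZl //; try by [apply: L2D; apply: L2Z | apply: L2B; apply: L2Z].
rewrite ![ip mu (fun x => _ (zpow l x)) _]ipC.
rewrite ![ip mu (fun x => _ - _) _]ipBl ?ipDl //; try by apply: L2Z.
rewrite !ipZl // /complex_corr !corr_zpow //.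
rewrite ![ip mu (fun x => _ (zpow i x)) _]ipC.
case: (u`_i) => ai bi; case: (u`_l) => al bl /=.
ring.
Qed.

Lemma complex_corr_weak_limit (e : C) : 0 < e ->
  exists M0, forall M, (M0 <= M)%N ->
    weak_limit_upto complex_corr e (pass_poly C P S t M)
      (fun k => t * hgt (nn k))%N.
Proof.
move=> e0; have e4 : 0 < complex.Re e / 4 by rewrite divr_gt0 //; move: e0; rewrite ltcE => /andP[].
have lim u v := corr_gap_limit (g := u) (h := v).
have [M1 H1] := lim _ _ _ Lg Lg e4; have [M2 H2] := lim _ _ _ Lh Lh e4.
have [M3 H3] := lim _ _ _ Lh Lg e4; have [M4 H4] := lim _ _ _ Lg Lh e4.
exists (maxn (maxn M1 M2) (maxn M3 M4)) => M.
rewrite !geq_max => /andP[/andP[/H1 {}H1 /H2 {}H2] /andP[/H3 {}H3 /H4 {}H4]] z.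
have [K1 {}H1] := H1 z; have [K2 {}H2] := H2 z.
have [K3 {}H3] := H3 z; have [K4 {}H4] := H4 z.
exists (maxn (maxn K1 K2) (maxn K3 K4)) => k.
rewrite !geq_max => /andP[/andP[/H1 {}H1 /H2 {}H2] /andP[/H3 {}H3 /H4 {}H4]].
rewrite /pass_poly (sum_coef_sumXn _ _ (fun i => gapsum P S 0 i t)
  (fun r => complex_corr (z - r%:Z))).
set D := (X in `|X|).
have qE : (copies P 0 M)%:R^-1 = ((copies P 0 M)%:R^-1 : R)%:C%C :> C.
  by rewrite fmorphV rmorph_nat.
have reZ (a : R) (x : C) : complex.Re (a%:C%C * x) = a * complex.Re x.
  by case: x => b c /=; rewrite mul0r subr0.
have imZ (a : R) (x : C) : complex.Im (a%:C%C * x) = a * complex.Im x.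
  by case: x => b c /=; rewrite mul0r addr0.
have DR : complex.Re D = corr_gap g g M k z +
    corr_gap h h M k z.
  rewrite /D qE raddfB /= reZ raddf_sum /= big_split /= /corr_gap; ring.
have DI : complex.Im D = corr_gap h g M k z -
    corr_gap g h M k z.
  rewrite /D qE raddfB /= imZ raddf_sum /= sumrB /corr_gap; ring.
have -> : e = (complex.Re e / 4 + complex.Re e / 4 + (complex.Re e / 4 + complex.Re e / 4))%:C%C.
  by rewrite [LHS](complex_ge0 (ltW e0)); congr (_%:C)%C; field.
apply: complex_norm_le; rewrite ?DR ?DI.
- by apply: le_trans (ler_normD _ _) _; apply: lerD.
- by apply: le_trans (ler_normB _ _) _; apply: lerD.
Qed.

End ComplexCorrelations.

End CorrelationLimit.

(** * Spectral measures *)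

Section CirclePoint.
Variable R : realType.
Local Notation C := (R[i] : numClosedFieldType).
Implicit Types t : R.

(** The sign is negative because ['X] stands for [U^-1], while the spectral measure attaches
    [exp(2 pi i t)] to the operator itself. *)
Definition cis t : C := (cos (2 * pi * t) -i* sin (2 * pi * t))%C.

Lemma cis_norm t : `|cis t| == 1.
Proof. by rewrite /cis normc_def /= sqrrN cos2Dsin2 sqrtr1. Qed.

Definition circle_point t : circle C := exist (fun w => `|w| == 1) (cis t) (cis_norm t).

Lemma cis_exp t n : cis t ^+ n = (cos (2 * pi * n%:R * t) -i* sin (2 * pi * n%:R * t))%C.
Proof.
elim: n => [|n IH]; first by rewrite expr0 mulr0 mul0r cos0 sin0 oppr0.
rewrite exprS IH /cis; have -> : 2 * pi * n.+1%:R * t = 2 * pi * t + 2 * pi * n%:R * t.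
  by rewrite -natr1; ring.
rewrite cosD sinD; simpc; congr (_ +i* _)%C; ring.
Qed.

Definition wave (n : int) t : C :=
  (cos (2 * pi * n%:~R * t) +i* sin (2 * pi * n%:~R * t))%C.

Lemma cis_wave t (i l : nat) : cis t ^+ i * (cis t ^+ l)^* = wave (l%:Z - i%:Z) t.
Proof.
rewrite !cis_exp /wave -[(_ -i* _)%C^*]/((cos (2 * pi * l%:R * t) +i* - - sin (2 * pi * l%:R * t))%C).
have -> : 2 * pi * (l%:Z - i%:Z)%:~R * t = 2 * pi * l%:R * t - 2 * pi * i%:R * t.
  by rewrite rmorphB /=; ring.
rewrite cosB sinB; simpc; congr (_ +i* _)%C; ring.
Qed.

Definition sqn (u : {poly C}) t : R := complex.Re (u.[cis t] * u.[cis t]^*).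

Lemma sqn_norm u t : (sqn u t)%:C%C = `|u.[cis t]| ^+ 2.
Proof. by rewrite normCK /sqn -complex_ge0 // mul_conjC_ge0. Qed.

Lemma sqn_ge0 u t : 0 <= sqn u t.
Proof. by rewrite -lecR sqn_norm exprn_ge0. Qed.

Lemma sqnE u t : sqn u t = \sum_(i < size u) \sum_(l < size u)
  (complex.Re (u`_i * (u`_l)^*) * cos (2 * pi * (l%:Z - i%:Z)%:~R * t) -
   complex.Im (u`_i * (u`_l)^*) * sin (2 * pi * (l%:Z - i%:Z)%:~R * t)).
Proof.
rewrite /sqn horner_coef rmorph_sum mulr_suml raddf_sum; apply: eq_bigr => i _ /=.
rewrite mulr_sumr raddf_sum; apply: eq_bigr => l _ /=.
by rewrite rmorphM mulrACA cis_wave /wave; case: (u`_i * _).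
Qed.

End CirclePoint.

Section TrigIntegral.
Variables (R : realType) (nu : {measure set R -> \bar R}) (e : int -> R[i]).
Hypothesis nu_fin : (nu setT < +oo)%E.
Hypothesis int_cos : forall n : int,
  (\int[nu]_t cos (2 * pi * n%:~R * t) = complex.Re (e n))%R.
Hypothesis int_sin : forall n : int,
  (\int[nu]_t sin (2 * pi * n%:~R * t) = complex.Im (e n))%R.
Local Notation C := (R[i] : numClosedFieldType).
Local Notation int1 f := (nu.-integrable setT (EFin \o f)).

Lemma measurable_wave (n : int) : measurable_fun setT (fun t : R => cos (2 * pi * n%:~R * t)) /\
  measurable_fun setT (fun t : R => sin (2 * pi * n%:~R * t)).
Proof.
split.
  apply: (measurableT_comp (f := @cos R)).
    by apply: continuous_measurable_fun; apply: continuous_cos.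
  by apply: measurable_funM.
apply: (measurableT_comp (f := @sin R)).
  by apply: continuous_measurable_fun; apply: continuous_sin.
by apply: measurable_funM.
Qed.

Lemma integrable_wave (n : int) : int1 (fun t => cos (2 * pi * n%:~R * t)) /\
  int1 (fun t => sin (2 * pi * n%:~R * t)).
Proof.
have [mc ms] := measurable_wave n.
split; apply: measurable_bounded_integrable => //; exists 1; split=> // M M1 x _ /=;
  apply: le_trans (ltW M1); rewrite ler_norml.
  by rewrite cos_geN1 cos_le1.
by rewrite sin_geN1 sin_le1.
Qed.

Lemma integrable_Rsum I (r : seq I) (f : I -> R -> R) :
  (forall i, int1 (f i)) ->
  int1 (fun t => \sum_(i <- r) f i t) /\
  (\int[nu]_t (\sum_(i <- r) f i t) = \sum_(i <- r) \int[nu]_t f i t)%R.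
Proof.
move=> intf; elim: r => [|i r [I1 I2]].
  rewrite (_ : (fun t => _) = cst 0); last by apply/funext => t; rewrite big_nil.
  by rewrite big_nil Rintegral_cst // mul0r; split => //; apply: integrable0.
rewrite (_ : (fun t => _) = (fun t => f i t + \sum_(j <- r) f j t)); last first.
  by apply/funext => t; rewrite big_cons.
by rewrite big_cons RintegralD // I2; split => //; apply: int1D.
Qed.

Lemma integrable_Rcomb (f g : R -> R) (a b : R) : int1 f -> int1 g ->
  int1 (fun t => a * f t - b * g t) /\
  (\int[nu]_t (a * f t - b * g t) = a * \int[nu]_t f t - b * \int[nu]_t g t)%R.
Proof.
move=> I1 I2.
have I1' : int1 (fun t => a * f t) by apply: int1Z.
have I2' : int1 (fun t => b * g t) by apply: int1Z.
by rewrite RintegralB // !RintegralZl //; split => //; apply: int1B.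
Qed.

(** The spectral isometry on polynomials, with [e] the Fourier coefficients of [nu]. *)
Lemma sqn_integral (u : {poly C}) : int1 (sqn u) /\
  (\int[nu]_t sqn u t = complex.Re (form e u u))%R.
Proof.
pose f (i l : nat) t := complex.Re (u`_i * (u`_l)^*) * cos (2 * pi * (l%:Z - i%:Z)%:~R * t) -
   complex.Im (u`_i * (u`_l)^*) * sin (2 * pi * (l%:Z - i%:Z)%:~R * t).
have If i l : int1 (f i l).
  by apply: (integrable_Rcomb _ _ _ _).1; [apply: (integrable_wave _).1 | apply: (integrable_wave _).2].
have Ef i l : (\int[nu]_t f i l t = complex.Re (u`_i * (u`_l)^* * e (l%:Z - i%:Z)))%R.
  rewrite (integrable_Rcomb _ _ _ _).2; try by [apply: (integrable_wave _).1 | apply: (integrable_wave _).2].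
  by rewrite int_cos int_sin; case: (u`_i * _) => a b; case: (e _).
have [I1 I2] := integrable_Rsum (index_enum 'I_(size u))
  (fun i => (integrable_Rsum (index_enum 'I_(size u)) (fun l => If i l)).1).
rewrite (_ : sqn u = (fun t => \sum_(i < size u) \sum_(l < size u) f i l t)); last first.
  by apply/funext => t; rewrite sqnE.
split => //.
rewrite I2 /form raddf_sum; apply: eq_bigr => i _ /=.
rewrite (integrable_Rsum (index_enum 'I_(size u)) (fun l => If i l)).2 raddf_sum.
by apply: eq_bigr => l _; rewrite Ef.
Qed.

Lemma measurable_sqn (u : {poly C}) : measurable_fun setT (sqn u).
Proof. by apply/measurable_EFinP; case/integrableP: (sqn_integral u).1. Qed.

Lemma measurable_sqn_ge (u : {poly C}) (a : R) : measurable [set t | a <= sqn u t].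
Proof.
have m : measurable_fun setT (EFin \o sqn u) by apply/measurable_EFinP; apply: measurable_sqn.
by have := emeasurable_fun_c_infty measurableT m a%:E; rewrite setTI.
Qed.

Lemma sqn_markov (u : {poly C}) (a b : R) : 0 < a -> complex.Re (form e u u) <= a * b ->
  (nu [set t | (a <= sqn u t)%R] <= b%:E)%E.
Proof.
move=> a0 Hb.
have [iu Eu] := sqn_integral u.
have m1 : measurable_fun setT (EFin \o sqn u) by apply/measurable_EFinP; apply: measurable_sqn.
have := le_integral_abse nu measurableT m1 a0; rewrite setTI.
have -> : [set t | (a%:E <= `|(EFin \o sqn u) t|)%E] = [set t | a <= sqn u t].
  by apply/seteqP; split => t /=; rewrite lee_fin ger0_norm ?sqn_ge0.
under eq_integral do rewrite /= ger0_norm ?sqn_ge0 //.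
have -> : (\int[nu]_t (sqn u t)%:E = (complex.Re (form e u u))%:E)%E.
  by rewrite -Eu /Rintegral fineK //; apply: integrable_fin_num.
move=> H; rewrite -(@lee_pmul2l _ a%:E) ?lte_fin //.
by apply: le_trans H _; rewrite -EFinM lee_fin.
Qed.

End TrigIntegral.

(** Substituting ['X^j] replaces [U] by [U^j], so the forms of [U] can be read on spectral measures
    of its powers. *)
Lemma form_comp_Xn (C : numClosedFieldType) (c : int -> C) j u :
  (forall n, c (- n) = (c n)^*) ->
  form c (u \Po 'X^j) (u \Po 'X^j) = form (fun n => c (j%:Z * n)) u u.
Proof.
move=> cN; rewrite comp_polyE form_suml; apply: eq_bigr => i _.
rewrite formZl form_sumr // mulr_sumr; apply: eq_bigr => l _.
rewrite formZr // -!mulrA; congr (_ * (_ * _)).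
rewrite -!exprM /form !size_polyXn big_ord_recr /= big_ord_recr /= !coefXn !eqxx.
rewrite big1 => [|a _]; last by rewrite big1 // => b _; rewrite coefXn (ltn_eqF (ltn_ord a)) !mul0r.
rewrite big1 => [|b _]; last by rewrite coefXn (ltn_eqF (ltn_ord b)) conjC0 mulr0 mul0r.
by rewrite !add0r conjC1 !mul1r mulrBr.
Qed.

(** * From polynomial approximation to singularity *)

Section Singular.
Variable R : realType.
Local Notation C := (R[i] : numClosedFieldType).

Lemma borel_cantelli (nu : {measure set R -> \bar R}) (B : nat -> set R) :
  (forall k, measurable (B k)) ->
  (forall k, (nu (B k) <= (1 / (2 ^ k.+1)%:R)%:E)%E) -> nu (lim_sup_set B) = 0%E.
Proof.
move=> mB HB; apply: lim_sup_set_cvg0 => //.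
apply: le_lt_trans (_ : (1%:E < +oo)%E); last exact: ltry.
apply: le_trans (@epsilon_trick0 _ 1 xpredT ler01).
by apply: lee_nneseries => // k _ _; apply: HB.
Qed.

Lemma not_lim_sup_set (B : nat -> set R) t : ~ lim_sup_set B t ->
  exists N, forall k, (N <= k)%N -> ~ B k t.
Proof.
move=> H; apply: contrapT => /forallNP Hn; apply: H => N _.
have /existsNP[k /not_implyP[Nk /contrapT Bk]] := Hn N.
by exists k.
Qed.

Variables (nu1 nu2 : {measure set R -> \bar R}) (c1 c2 : int -> C) (j1 j2 : nat).
Hypothesis nu1_fin : (nu1 setT < +oo)%E.
Hypothesis nu2_fin : (nu2 setT < +oo)%E.
Hypothesis c1N : forall n, c1 (- n) = (c1 n)^*.
Hypothesis c2N : forall n, c2 (- n) = (c2 n)^*.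
Hypothesis cos1 : forall n : int,
  (\int[nu1]_t cos (2 * pi * n%:~R * t) = complex.Re (c1 (j1%:Z * n)))%R.
Hypothesis sin1 : forall n : int,
  (\int[nu1]_t sin (2 * pi * n%:~R * t) = complex.Im (c1 (j1%:Z * n)))%R.
Hypothesis cos2 : forall n : int,
  (\int[nu2]_t cos (2 * pi * n%:~R * t) = complex.Re (c2 (j2%:Z * n)))%R.
Hypothesis sin2 : forall n : int,
  (\int[nu2]_t sin (2 * pi * n%:~R * t) = complex.Im (c2 (j2%:Z * n)))%R.
Variable res : limitseq C.
Hypothesis approx : forall e : C, 0 < e -> exists M0, forall M, (M0 <= M)%N ->
  exists L (u : {poly C}),
    form c1 (('X^L * val res M - u) \Po 'X^j1) (('X^L * val res M - u) \Po 'X^j1) <= e /\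
    form c2 (u \Po 'X^j2) (u \Po 'X^j2) <= e.

(** By Borel-Cantelli, [u k] tends to 0 almost everywhere for [nu2], and
    ['X^(LL k) * val res (MM k) - u k] does so for [nu1]. Where both happen [res] vanishes, the
    power of ['X] having modulus 1. *)
Lemma singular_off_zeros : exists A N : set R,
  [/\ measurable A, measurable N, nu2 (~` A) = 0%E, nu1 N = 0%E &
      A `<=` N `|` [set t | eval_lim (circle_point t) res = 0]].
Proof.
pose dl k : R := 1 / (2 ^ k.+1)%:R.
have dl0 k : 0 < dl k by rewrite divr_gt0 ?ltr01 // ltr0n expn_gt0.
have dl_small (e : R) : 0 < e -> exists N, forall k, (N <= k)%N -> dl k <= e.
  move=> e0; exists (Num.bound e^-1) => k Hk.
  rewrite /dl ler_pdivrMr ?ltr0n ?expn_gt0 // mulrC -ler_pdivrMr // mul1r.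
  apply: ltW; apply: lt_le_trans (archi_boundP _) _; first by rewrite invr_ge0 ltW.
  rewrite ler_nat (leq_trans Hk) // (leq_trans (leqnSn k)) //.
  exact: ltnW (ltn_expl k.+1 (ltnSn 1)).
have Hk k : exists x : nat * nat * {poly C}, let: (M, L, u) := x in
    [/\ (k <= M)%N, (nu1 [set t | (dl k <= sqn ('X^L * val res M - u) t)%R] <= (dl k)%:E)%E &
        (nu2 [set t | (dl k <= sqn u t)%R] <= (dl k)%:E)%E].
  (* With the square, Markov's inequality at threshold [dl k] leaves a measure of at most [dl k],
     which is summable. *)
  have d2 : (0 : C) < (dl k * dl k)%:C%C by rewrite ltcR mulr_gt0.
  have [M0 H] := approx d2.
  have [L [u [H1 H2]]] := H (maxn M0 k) (leq_maxl _ _).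
  (* Requiring [k <= M] makes the truncations of [res] converge along the chosen sequence. *)
  exists (maxn M0 k, L, u); split; first exact: leq_maxr.
    apply: (sqn_markov nu1_fin cos1 sin1) => //.
    by rewrite -form_comp_Xn //; move: H1; rewrite lecE => /andP[].
  apply: (sqn_markov nu2_fin cos2 sin2) => //.
  by rewrite -form_comp_Xn //; move: H2; rewrite lecE => /andP[].
have [x Hx] := choice Hk.
pose MM k := (x k).1.1; pose LL k := (x k).1.2; pose u k := (x k).2.
pose B1 k := [set t | dl k <= sqn ('X^(LL k) * val res (MM k) - u k) t].
pose B2 k := [set t | dl k <= sqn (u k) t].
have H k : [/\ (k <= MM k)%N, (nu1 (B1 k) <= (dl k)%:E)%E & (nu2 (B2 k) <= (dl k)%:E)%E].
  by have := Hx k; rewrite /B1 /B2 /MM /LL /u; case: (x k) => [[M L] v].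
have mB1 k : measurable (B1 k) by apply: (measurable_sqn_ge nu1_fin cos1 sin1).
have mB2 k : measurable (B2 k) by apply: (measurable_sqn_ge nu2_fin cos2 sin2).
have ml (B : nat -> set R) : (forall k, measurable (B k)) -> measurable (lim_sup_set B).
  by move=> mB; apply: bigcap_measurable => // k _; apply: bigcup_measurable.
exists (~` lim_sup_set B2), (lim_sup_set B1); split.
- by apply: measurableC; apply: ml.
- by apply: ml.
- by rewrite setCK; apply: borel_cantelli => // k; case: (H k).
- by apply: borel_cantelli => // k; case: (H k).
move=> t /not_lim_sup_set[N2 HN2].
have [|/not_lim_sup_set[N1 HN1]] := pselect (lim_sup_set B1 t); first by left.
right; rewrite /=; apply/eqP; rewrite -normr_eq0 eq_le normr_ge0 andbT.
apply/ler_addgt0Pl => e e0; rewrite addr0.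
have e3 : 0 < complex.Re (e / 3).
  by have : 0 < e / 3 := divr_gt0 e0 (ltr0n _ 3); rewrite ltcE => /andP[].
have Ee : e / 3 = (complex.Re (e / 3))%:C%C by apply: complex_ge0; rewrite divr_ge0 // ltW.
have [N0 HN0] := dl_small (complex.Re (e / 3) ^+ 2) (exprn_gt0 _ e3).
have /cvgrPdist_le/(_ (e / 3)) := eval_lim_cvg (w := circle_point t) (a := res).
rewrite divr_gt0 // => /(_ isT) [N3 _ HN3].
pose k := maxn (maxn N0 N1) (maxn N2 N3).
have small v : ~ dl k <= sqn v t -> `|v.[cis t]| <= e / 3.
  move=> /negP; rewrite -ltNge => Hv.
  rewrite -(ler_pXn2r (_ : (0 < 2)%N)) ?nnegrE ?normr_ge0 //; last by rewrite divr_ge0 // ltW.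
  rewrite -sqn_norm Ee -rmorphXn lecR; apply: le_trans (ltW Hv) (HN0 _ _).
  by rewrite /k !leq_max leqnn.
have s1 := small _ (HN1 k _); have s2 := small _ (HN2 k _).
have s3 : `|eval_lim (circle_point t) res - (val res (MM k)).[cis t]| <= e / 3.
  by apply: HN3; rewrite /= (leq_trans _ (_ : (k <= MM k)%N)) //; [rewrite !leq_max leqnn !orbT | case: (H k)].
have E : `|(val res (MM k)).[cis t]| = `|('X^(LL k) * val res (MM k)).[cis t]|.
  by rewrite hornerM hornerXn normrM normrX (eqP (cis_norm t)) expr1n mul1r.
have -> : e = e / 3 + (e / 3 + e / 3) by field.
rewrite -[X in `|X|](subrK (val res (MM k)).[cis t]).
apply: le_trans (ler_normD _ _) (lerD s3 _).
rewrite E -[X in X.[_]](subrK (u k)) hornerD; apply: le_trans (ler_normD _ _) (lerD _ _).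
  by apply: s1; rewrite !leq_max leqnn !orbT.
by apply: s2; rewrite !leq_max leqnn !orbT.
Qed.

End Singular.

Lemma spectral_measure_corr d (X : measurableType d) (R : realType) (mu : probability X R)
  (T Tinv : X -> X) (TK : cancel T Tinv) (TinvK : cancel Tinv T) (mT : preserves mu T)
  (mTinv : measurable_fun setT Tinv) (j : nat) (g h : X -> R)
  (nu : {measure set R -> \bar R}) : L2 mu g -> L2 mu h -> spectral_measure mu T j g h nu ->
  let c := complex_corr mu T Tinv g h in
  forall n : int,
    (\int[nu]_t cos (2 * pi * n%:~R * t) = complex.Re (c (j%:Z * n)))%R /\
    (\int[nu]_t sin (2 * pi * n%:~R * t) = complex.Im (c (j%:Z * n)))%R.
Proof.
move=> Lg Lh [[nu_fin _] H] c.
have prod u v n : L2 mu u -> L2 mu v ->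
    mu.-integrable setT (EFin \o (fun x => u (iter (j * n) T x) * v x)).
  by move=> Lu Lv; apply: L2_prod => //; apply: (preserves_L2 (preserves_zpow TK mT mTinv (j * n)%N%:Z)).
have Hpos (n : nat) :
    (\int[nu]_t cos (2 * pi * n%:R * t) = complex.Re (c (j%:Z * n%:Z)))%R /\
    (\int[nu]_t sin (2 * pi * n%:R * t) = complex.Im (c (j%:Z * n%:Z)))%R.
  have [Hc Hs] := H n; split; rewrite /Rintegral ?Hc ?Hs.
    by rewrite /c /complex_corr /= /corr /ip -RintegralD //; apply: prod.
  by rewrite /c /complex_corr /= /corr /ip -RintegralB //; apply: prod.
case=> n; first exact: Hpos.
rewrite NegzE [j%:Z * _]mulrN {1 2}/c complex_corrN // -/c.
have [Hc Hs] := Hpos n.+1.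
have Em (t : R) : 2 * pi * (- n.+1%:Z)%:~R * t = - (2 * pi * n.+1%:R * t).
  by rewrite rmorphN /= mulrN mulNr.
split.
  under eq_Rintegral do rewrite Em cosN.
  by rewrite Hc; case: (c _).
under eq_Rintegral do rewrite Em sinN -mulN1r.
rewrite RintegralZl // ?mulN1r ?Hs; first by case: (c _).
exact: (integrable_wave nu_fin n.+1%:Z).2.
Qed.

(** [cos (2 x) = 1 - 2 (sin x)^2] at [x = pi (t - s)], where the sine is positive if [s < t]. *)
Lemma cis_inj (R : realType) (s t : R) : 0 <= s < 1 -> 0 <= t < 1 -> cis s = cis t -> s = t.
Proof.
wlog st : s t / s <= t.
  by move=> H Hs Ht E; case: (leP s t) => [st|/ltW ts]; [apply: H | apply/esym/H].
move=> /andP[s0 s1] /andP[t0 t1] [Ec Es].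
have c1 : cos (2 * pi * (t - s)) = 1.
  rewrite mulrBr cosB Ec; have -> : sin (2 * pi * s) = sin (2 * pi * t) by lra.
  by rewrite -!expr2 cos2Dsin2.
have [//|ne] := eqVneq s t.
have ts : 0 < t - s by rewrite subr_gt0 lt_neqAle ne.
have := @sin_gt0_pi R (pi * (t - s)); rewrite mulr_gt0 ?pi_gt0 //=.
rewrite -[X in _ < X]mulr1 ltr_pM2l ?pi_gt0 //.
have -> : t - s < 1 by lra.
move=> /(_ isT) sp.
have : cos (2 * pi * (t - s)) = 1 - 2 * sin (pi * (t - s)) ^+ 2.
  have -> : 2 * pi * (t - s) = pi * (t - s) + pi * (t - s) by ring.
  by rewrite cosD -!expr2; have := cos2Dsin2 (pi * (t - s)); lra.
by rewrite c1; have := exprn_gt0 2 sp; lra.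
Qed.

Lemma finite_circle_preimage (R : realType) (Z : set (circle (R[i] : numClosedFieldType))) :
  finite_set Z -> finite_set [set t : R | 0 <= t < 1 /\ Z (circle_point t)].
Proof.
move=> fZ; pose D w := [set t : R | 0 <= t < 1 /\ circle_point t = w].
apply: (@sub_finite_set _ _ ((fun w => xget 0 (D w)) @` Z)); last exact: finite_image.
move=> t [t01 Zt]; exists (circle_point t) => //.
have [x01 E] : D (circle_point t) (xget 0 (D (circle_point t))).
  by apply: (@xgetPex _ _ (D (circle_point t))); exists t.
by apply: cis_inj => //; apply: (congr1 val E).
Qed.

Section Atoms.
Variables (R : realType) (sigma : {measure set R -> \bar R}).
Hypothesis sigma_fin : (sigma setT < +oo)%E.

Lemma large_atoms_finite n : finite_set [set t | ((n.+1%:R^-1)%:E <= sigma [set t])%E].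
Proof.
apply: contrapT => /infinite_set_fset inf.
have fin : sigma setT \is a fin_num by rewrite ge0_fin_numE.
have [B BA cB] := inf (Num.bound (n.+1%:R * fine (sigma setT))).
have : (sigma [set` B] <= sigma setT)%E.
  apply: le_measure; rewrite ?inE //; apply: countable_measurable => //.
  exact/finite_set_countable/finite_fset.
have -> : sigma [set` B] = (\sum_(t \in [set` B]) sigma [set t])%E.
  have {1}-> : [set` B] = \bigcup_(t in [set` B]) [set t].
    by apply/seteqP; split => [x Bx|x [y By ->]] //; exists x.
  rewrite measure_fin_bigcup //; last by move=> i k _ _ [x [-> ->]].
rewrite leNgt => /negP; apply.
rewrite fsbig_finite // set_fsetK.
apply: (@lt_le_trans _ _ (\sum_(i <- B) (n.+1%:R^-1)%:E)%E); last first.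
  rewrite big_seq [leRHS]big_seq; apply: lee_sum => t tB; exact: BA.
rewrite -(fineK fin) sumEFin lte_fin big_const_seq count_predT iter_addr_0 -[_ *+ _]mulr_natr.
rewrite mulrC ltr_pdivlMr // mulrC; apply: lt_le_trans (archi_boundP _) _.
  by rewrite mulr_ge0 // fine_ge0.
by rewrite ler_nat.
Qed.

Lemma measurable_atoms : measurable (atoms sigma).
Proof.
apply: countable_measurable => //.
apply: (@sub_countable _ _ _ (\bigcup_n [set t | ((n.+1%:R^-1)%:E <= sigma [set t])%E])).
  apply: subset_card_le => t; rewrite /atoms /= => t0.
  have fin : sigma [set t] \is a fin_num.
    rewrite ge0_fin_numE //; apply: le_lt_trans sigma_fin.
    by apply: le_measure; rewrite ?inE.
  have f0 : 0 < fine (sigma [set t]) by rewrite fine_gt0 // t0 ltey_eq fin.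
  exists (Num.bound (fine (sigma [set t]))^-1) => //=.
  rewrite -(fineK fin) lee_fin -[leRHS]invrK lef_pV2 ?posrE ?invr_gt0 //.
  apply: ltW; apply: lt_trans (archi_boundP _) _; first by rewrite invr_ge0 ltW.
  by rewrite ltr_nat.
apply: bigcup_countable => // n _; exact/finite_set_countable/large_atoms_finite.
Qed.

(** The points of [D] are either atoms, removed by [cont_part], or of measure zero. *)
Lemma cont_part_finite (A D : set R) : measurable A -> finite_set D ->
  sigma (A `\` D) = 0%E -> cont_part sigma A = 0%E.
Proof.
move=> mA fD A0; have ma := measurable_atoms.
have mD (B : set R) : B `<=` D -> measurable B.
  move=> BD; apply: countable_measurable => //; apply/finite_set_countable.
  exact: sub_finite_set fD.
have fDa : finite_set (D `\` atoms sigma) by apply: sub_finite_set fD => t [].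
have D0 : sigma (D `\` atoms sigma) = 0%E.
  have -> : D `\` atoms sigma = \bigcup_(t in D `\` atoms sigma) [set t].
    by apply/seteqP; split => [x Bx|x [y By ->]] //; exists x.
  rewrite measure_fin_bigcup //; last by move=> i k _ _ [x [-> ->]].
  apply: fsbig1 => t [_ /negP]; rewrite -leNgt => H.
  by apply/eqP; rewrite eq_le H measure_ge0.
apply/eqP; rewrite eq_le measure_ge0 andbT /cont_part.
apply: (@le_trans _ _ (sigma ((A `\` D) `|` (D `\` atoms sigma)))).
  apply: le_measure; rewrite ?inE.
  - exact: measurableD.
  - by apply: measurableU; apply: measurableD => //; apply: mD.
  - by move=> t [At na]; have [Dt|nD] := pselect (D t); [right | left].
rewrite measureU0 ?A0 //; first by apply: measurableD => //; apply: mD.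
by apply: measurableD => //; apply: mD.
Qed.

End Atoms.

Lemma dominates0 (R : realType) (sigma nu : {measure set R -> \bar R}) (A : set R) :
  measurable A -> sigma `<< nu -> nu A = 0%E -> sigma A = 0%E.
Proof.
move=> mA dom nuA; apply/(measure0_null_setP _ mA).
by apply: dom; apply/(measure0_null_setP _ mA).
Qed.

(** * Rank-one transformations *)

Lemma hgt_ext (p p' : nat -> nat) s : (forall n, (1 <= n)%N -> p n = p' n) ->
  forall n, hgt p s n = hgt p' s n.
Proof.
by move=> E; elim=> [|[|n] IH] //; rewrite [LHS]/= [RHS]/= -!/(hgt _ s n.+1) IH E.
Qed.

Lemma rank_one_ext d (X : measurableType d) (R : realType) (mu : probability X R) (T : X -> X)
  (p p' : nat -> nat) s : (forall n, (1 <= n)%N -> p n = p' n) ->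
  rank_one mu T p s -> rank_one mu T p' s.
Proof.
move=> E [mT [L H]]; split => //; exists L.
have Eh : hgt p s = hgt p' s by apply/funext/hgt_ext.
have Ec : col_off p s = col_off p' s by apply/funext => n; apply/funext => i; rewrite /col_off Eh.
case: H; rewrite Ec Eh => H1 H2 H3 H4 H5; split => //.
by move=> n k n1 kn; rewrite H4 // E.
Qed.

Lemma stabilizing_ext (p p' : nat -> nat) s nk pi eta :
  (forall n, (1 <= n)%N -> p n = p' n) ->
  stabilizing p s nk pi eta -> stabilizing p' s nk pi eta.
Proof.
move=> E [H1 H2]; split=> // m; have [[K HK] Hs] := H2 m; split=> //.
by exists K => k /HK[k0 <-]; split=> //; rewrite E //; lia.
Qed.

Lemma stabilizing_cuts_ge2 (p : nat -> nat) s nk pi eta : (forall n, (1 < p n)%N) ->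
  stabilizing p s nk pi eta -> forall m, (1 < pi m)%N.
Proof. by move=> p2 [_ H] m; have [[K /(_ K (leqnn K))[_ <-]] _] := H m. Qed.

(** Delaying the subsequence by [|m| + 1] terms makes [n_k + m] larger than [k], so [absz] is
    harmless; the finitely many columns share one threshold. *)
Lemma stabilizing_stages p s nk pi eta (m : int) : stabilizing p s nk pi eta ->
  exists nn : nat -> nat, (forall k, (k < nn k)%N) /\
    forall l, exists K, forall k, (K <= k)%N ->
      p (nn k + l)%N = cuts_from pi m l /\
      forall j, (j < cuts_from pi m l)%N -> s (nn k + l)%N j = spacers_from eta m l j.
Proof.
move=> [nkS H]; have nk_ge k : (k <= nk k)%N by elim: k => // k IH; apply: leq_ltn_trans (nkS k).
exists (fun k => absz ((nk (k + (absz m).+1)%N)%:Z + m)); split=> [k|l].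
  by have := nk_ge (k + (absz m).+1)%N; lia.
have [[K HK] Hs] := H (m + l%:Z).
have /choice[f Hf] : forall j, exists K', (j < pi (m + l%:Z)%R)%N -> forall k, (K' <= k)%N ->
    0 < (nk k)%:Z + (m + l%:Z) /\ s (absz ((nk k)%:Z + (m + l%:Z))) j = eta (m + l%:Z) j.
  move=> j; have [jp|] := boolP (j < pi (m + l%:Z)%R)%N; last by exists 0%N.
  by have [K' HK'] := Hs j jp; exists K'.
exists (maxn K (\max_(j < pi (m + l%:Z)%R) f j)) => k; rewrite geq_max => /andP[Kk fk].
have nn_add : (absz ((nk (k + (absz m).+1)%N)%:Z + m)%R + l)%N =
    absz ((nk (k + (absz m).+1)%N)%:Z + (m + l%:Z)).
  by have := nk_ge (k + (absz m).+1)%N; lia.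
rewrite nn_add; split.
  by have [_ ->] := HK (k + (absz m).+1)%N (leq_trans Kk (leq_addr _ _)).
move=> j jp; have [//|_ ->//] := Hf j jp (k + (absz m).+1)%N.
apply: leq_trans (leq_addr _ _); apply: leq_trans fk.
exact: (leq_bigmax (Ordinal jp)).
Qed.

Lemma pass_series_order_radius (C : numClosedFieldType) P S t B
  (P2 : forall l, (1 < P l)%N) archiC completeC :
  (forall l j, (j < P l)%N -> (S l j <= B)%N) -> (0 < t)%N ->
  order_radius (@pass_series C P S t P2 archiC completeC) (mingap P S 0 t) (t * B) (6 * t)%:R.
Proof.
move=> SB t0; split=> [M i it||x x1 xB M].
- exact: coef_pass_poly_low.
- exact: coef_pass_poly_mingap.
- exact: wnorm_pass_poly_bound SB t0 x1 xB M.
Qed.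

Theorem mainTheorem1 (R : realType) (d : measure_display) (X : measurableType d)
  (mu : probability X R) (T : X -> X)
  (p : nat -> nat) (s : nat -> nat -> nat) :
  (forall n, (1 <= n)%N -> (2 <= p n)%N) ->
  cvgn (series (fun n : nat => if n == 0%N then 0 : R
          else (\sum_(i < p n) s n i)%:R / (hgt p s n.+1)%:R)) ->
  rank_one mu T p s ->
  forall (nk : nat -> nat) (pi : int -> nat) (eta : int -> nat -> nat),
  stabilizing p s nk pi eta ->
  (exists B : nat, forall m j, (j < pi m)%N -> (eta m j <= B)%N) ->
  (exists m : int, Eset pi eta m <> [set 0]) ->
  forall j1 j2 : nat, (1 <= j1)%N -> (j1 < j2)%N ->
  forall sigma1 sigma2 : {measure set R -> \bar R},
  max_spectral_type mu T j1 sigma1 ->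
  max_spectral_type mu T j2 sigma2 ->
  mutually_singular (cont_part sigma1) (cont_part sigma2).
Proof.
move=> p2' _ rank nk pi eta stab [B HB] nonflat j1 j2 j10 j12 sigma1 sigma2.
(* Each maximal spectral type is dominated by the spectral measure of one function, so one function
   per power is enough. *)
move=> [[sigma1_fin _] _ [g1 [h1 [nu1 [g1L h1L sp1 dom1]]]]].
move=> [[sigma2_fin _] _ [g2 [h2 [nu2 [g2L h2L sp2 dom2]]]]].
have j20 : (0 < j2)%N := ltn_trans j10 j12.
have LL (f : X -> R) : L2_0 mu f -> L2 mu f by case.
move/LL : g1L => g1L; move/LL : h1L => h1L; move/LL : g2L => g2L; move/LL : h2L => h2L.
(* The bound on [p] starts at index 1, whereas the tower lemmas ask for two columns at every index;
   index 0 is set to 2. *)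
pose pp (n : nat) := if n == 0%N then 2%N else p n.
have pp2 n : (1 < pp n)%N by rewrite /pp; case: eqP => // /eqP; rewrite -lt0n => /p2'.
have ppE n : (1 <= n)%N -> p n = pp n by rewrite /pp; case: n.
move/(stabilizing_ext ppE) : stab => stab; move/(rank_one_ext ppE) : rank.
move=> [[mT [Tinv [TK TinvK mTinv]] muT] [L [mL disL TL cutL genL]]].
have mT' : preserves mu T by split.
have pi2 := stabilizing_cuts_ge2 pp2 stab.
have j12' : (0 < j1 < j2)%N by rewrite j10.
have [m [e [e0 ne]]] := mingap_not_proportional pi2 R HB nonflat j12'.
have [nn [nn_ge stable]] := stabilizing_stages m stab.
set P := cuts_from pi m in ne stable; set S := spacers_from eta m in ne stable.
have P2 l : (1 < P l)%N by apply: pi2.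
have SB l j : (j < P l)%N -> (S l j <= B)%N by apply: HB.
have nn_large N : exists K, forall k, (K <= k)%N -> (N <= nn k)%N.
  by exists N => k Nk; apply: leq_trans Nk (ltnW (nn_ge k)).
pose C : numClosedFieldType := R[i].
pose F t := @pass_series C P S t P2 (@complex_archi R) (@complex_complete R).
(* One sequence for both powers: [j * b k] is [j * e] tower heights, that is, a passage through
   [t = j * e] copies. *)
pose b k := (e * hgt pp s (nn k))%N.
have bk k : (k <= b k)%N.
  apply: leq_trans (leq_pmull _ e0); apply: leq_trans (ltnW (nn_ge k)) _.
  by apply: hgt_ge => //; apply: leq_ltn_trans (nn_ge k).
have weak j g h : L2 mu g -> L2 mu h -> forall x : C, 0 < x -> exists M0, forall M, (M0 <= M)%N ->
    weak_limit_upto (complex_corr mu T Tinv g h) x (val (F (j * e)%N) M) (fun k => j * b k)%N.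
  move=> Lg Lh x x0; rewrite (_ : (fun k => _) = (fun k => j * e * hgt pp s (nn k))%N); last first.
    by apply/funext => k; rewrite mulnA.
  exact: (complex_corr_weak_limit TK TinvK mT' mTinv pp2 mL disL TL cutL genL (j * e) P2 nn_large
    stable Lg Lh x0).
pose c1 := complex_corr mu T Tinv g1 h1; pose c2 := complex_corr mu T Tinv g2 h2.
have c1N n : c1 (- n) = (c1 n)^* by apply: complex_corrN.
have c2N n : c2 (- n) = (c2 n)^* by apply: complex_corrN.
have [res [approx zeros]] := @resultant_approximable C c1 c2 (@complex_archi R) c1N c2N
  (complex_corr_form_ge0 TK TinvK mT' mTinv g1L h1L)
  (complex_corr_form_ge0 TK TinvK mT' mTinv g2L h2L) j1 j2 b j10 j20 bk
  (F (j1 * e)%N) (F (j2 * e)%N)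
  (fun M => wnorm1_pass_poly_le1 _ _ _ P2 M) (fun M => wnorm1_pass_poly_le1 _ _ _ P2 M)
  (weak j1 _ _ g1L h1L) (weak j2 _ _ g2L h2L).
have W1 := spectral_measure_corr TK TinvK mT' mTinv g1L h1L sp1.
have W2 := spectral_measure_corr TK TinvK mT' mTinv g2L h2L sp2.
have [[nu1_fin nu1_out] _] := sp1; have [[nu2_fin _] _] := sp2.
have [A [N [mA mN A0 N0 AN]]] := singular_off_zeros nu1_fin nu2_fin c1N c2N
  (fun n => (W1 n).1) (fun n => (W1 n).2) (fun n => (W2 n).1) (fun n => (W2 n).2) approx.
have fD : finite_set [set t : R | 0 <= t < 1 /\
    [set w : circle C | eval_lim w res = 0] (circle_point t)].
  apply: finite_circle_preimage; apply: sub_finite_set (zeros) _.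
  have je0 j : (0 < j)%N -> (0 < j * e)%N by move=> ?; rewrite muln_gt0 e0 andbT.
  exact: (coincidence_set_finite (@complex_archi R) j10 j20
    (pass_series_order_radius P2 (@complex_archi R) (@complex_complete R) SB (je0 _ j10))
    (pass_series_order_radius P2 (@complex_archi R) (@complex_complete R) SB (je0 _ j20)) ne).
set D := [set t | _] in fD.
have mD : measurable D by apply: countable_measurable => //; apply: finite_set_countable.
have m01 : measurable [set t : R | 0 <= t < 1].
  have -> : [set t : R | 0 <= t < 1] = [set` `[(0 : R), 1[].
    by apply/seteqP; split => t /=; rewrite in_itv.
  exact: measurable_itv.
exists A; split => //.
  (* A point of [A] in [[0, 1)] outside [D] is not a zero of [res], hence lies in the null set [N];
     [nu1] has no mass outside [[0, 1)]. *)
  apply: (cont_part_finite sigma1_fin mA fD); apply: (dominates0 _ dom1); first exact: measurableD.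
  apply/eqP; rewrite eq_le measure_ge0 andbT.
  apply: (@le_trans _ _ (nu1 (N `|` ~` [set t | 0 <= t < 1]))).
    apply: le_measure; rewrite ?inE.
    - exact: measurableD.
    - by apply: measurableU => //; apply: measurableC.
    - move=> t [/AN [Nt|zt] nD]; [by left | right => t01; apply: nD; by split].
  by rewrite measureU0 ?N0 //; apply: measurableC.
apply: (cont_part_finite sigma2_fin (measurableC mA) (finite_set0 R)).
by rewrite setD0; apply: (dominates0 (measurableC mA) dom2).
Qed.
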